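(* Let $T$ and $R$ be contractions on a Hilbert space $\mathcal{H}$, let $T_t=(1-t)T+tR$ for $t\in[0,1]$, and let $\mathcal{E}_t$ be a semi-spectral measure of $T_t$. Suppose that $\varphi\in\big(B^1_{\infty1}\big)_+$. Then the function $$ t\mapsto\varphi(T_t),\quad 0\le t\le1, $$ is differentiable in the operator norm and $$ \frac{d}{ds}\varphi(T_s)\Big|_{s=t}=\iint\limits_{\mathbb{T}\times\mathbb{T}}\frac{\varphi(\zeta)-\varphi(\tau)}{\zeta-\tau}\,d\mathcal{E}_t(\zeta)\,(R-T)\,d\mathcal{E}_t(\tau). $$
   Context: $\mathbb{D}$ is the open unit disk, $\mathbb{T}$ the unit circle. A contraction is an operator of norm at most $1$; each $T_t$ is a contraction. $C_A$ is the disk-algebra (functions analytic in $\mathbb{D}$ and continuous on the closed disk). For $f\in C_A$ and a contraction $T$, $f(T)$ is defined by extending the polynomial calculus by continuity using von Neumann's inequality $\|f(T)\|\le\max_{|\zeta|\le1}|f(\zeta)|$. Derivatives on $[0,1]$ are one-sided at the endpoints. Besov class: let $w\ge0$ be the piecewise linear function on $\mathbb{R}$ supported in $[1/2,2]$, with $w(1)=1$ and linear on $[1/2,1]$ and on $[1,2]$. Put $W_n(z)=\sum_{k\in\mathbb{Z}}w(k/2^n)z^k$ for $n\ge1$, $W_0(z)=\bar z+1+z$, $W_n^\#=\overline{W_n}$. For $s>0$, $1\le p,q\le\infty$, $B^s_{pq}$ consists of functions $f$ on $\mathbb{T}$ with $\{2^{ns}\|f*W_n\|_{L^p}\}_{n\ge0}\in\ell^q$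 and $\{2^{ns}\|f*W_n^\#\|_{L^p}\}_{n\ge1}\in\ell^q$. $\big(B^s_{pq}\big)_+$ is the set of $f\in B^s_{pq}$ with $\hat f(k)=0$ for $k<0$; such functions are identified with their analytic extensions to $\mathbb{D}$. Semi-spectral measures: for a measurable space $(\mathcal{X},\mathcal{B})$ and a Hilbert space $\mathcal{H}$, a semi-spectral measure is a map $\mathcal{E}$ from $\mathcal{B}$ to the bounded operators on $\mathcal{H}$ with $\mathcal{E}(\Delta)\ge0$, $\mathcal{E}(\varnothing)=0$, $\mathcal{E}(\mathcal{X})=I$, countably additive in the weak operator topology. By Naimark's theorem it has a spectral dilation, i.e., a spectral measure $E$ on a Hilbert space $\mathcal{K}\supset\mathcal{H}$ with $\mathcal{E}(\Delta)=P_{\mathcal{H}}E(\Delta)|\mathcal{H}$, and $\int f\,d\mathcal{E}:=P_{\mathcal{H}}\left(\int f\,dE\right)\big|\mathcal{H}$ for bounded measurable $f$ (independent of the dilation). A semi-spectral measure of a contraction $T$ on $\mathcal{H}$ is $\mathcal{E}_T(\Delta)=P_{\mathcal{H}}E_U(\Delta)|\mathcal{H}$, $\Delta\subset\mathbb{T}$ Borel, where $E_U$ is the spectral measure of a unitary dilation $U$ of $T$ (a unitary operator on some $\mathcal{K}\supset\mathcal{H}$ with $T^n=P_{\mathcal{H}}U^n|\mathcal{H}$, $n\ge0$); thus $T^n=\int_{\mathbb{T}}\zeta^n\,d\mathcal{E}_T(\zeta)$, $n\ge0$. Double operator integrals: if $\Phi(\zeta,\tau)=\sum_{n}f_n(\zeta)g_n(\tau)$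 with $f_n,g_n\in C_A$ and $\sum_n\|f_n\|_\infty\|g_n\|_\infty<\infty$ (i.e. $\Phi$ belongs to the projective tensor product $C_A\hat\otimes C_A$), then for a bounded operator $Q$ and semi-spectral measures $\mathcal{E}_1,\mathcal{E}_2$ on $\mathbb{T}$, $\iint\Phi\,d\mathcal{E}_1\,Q\,d\mathcal{E}_2:=\sum_n\left(\int f_n\,d\mathcal{E}_1\right)Q\left(\int g_n\,d\mathcal{E}_2\right)$, which does not depend on the representation. For $\varphi\in\big(B^1_{\infty1}\big)_+$ the divided difference $\frac{\varphi(\zeta)-\varphi(\tau)}{\zeta-\tau}$ (equal to $\varphi'(\zeta)$ when $\zeta=\tau$) is known to belong to $C_A\hat\otimes C_A$. *)

(* Defs.v *)
From HB Require Import structures.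
From mathcomp Require Import all_boot all_order all_algebra.
From mathcomp Require Import complex.
From mathcomp Require Import all_classical all_reals all_analysis.

Set Implicit Arguments.
Unset Strict Implicit.
Unset Printing Implicit Defensive.

Import Order.TTheory GRing.Theory Num.Theory numFieldNormedType.Exports.

Local Open Scope classical_set_scope.
Local Open Scope ring_scope.
Local Open Scope complex_scope.

(* The complex plane. The type R[i] itself carries no canonical topology; its
   regular module R[i]^o does. *)
Notation cplx R := (R[i]^o).

(* Complex Hilbert spaces. The inner product is linear in its first argument
   and conjugate-linear in the second. Norms take their values in R[i]. *)
Record hilbertType (R : realType) := Hilbert {
  hilbert_sort :> completeNormedModType R[i] ;
  inner : {dot hilbert_sort for Num.conj} ;
  norm_inner : forall x : hilbert_sort, `|x| ^+ 2 = inner x x }.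

Arguments inner {R h}.

Section Operators.
Context {R : realType}.
Implicit Types H K : hilbertType R.

Definition opnorm_le H (A : H -> H) (M : R) : Prop :=
  forall x, `|A x| <= M%:C * `|x|.

Definition bounded_op H (A : H -> H) : Prop :=
  linear A /\ exists M, opnorm_le A M.

Definition contraction_op H (A : H -> H) : Prop := linear A /\ opnorm_le A 1.

Definition positive_op H (A : H -> H) : Prop := forall x, 0 <= inner (A x) x.

(* Convergence in the operator norm. *)
Definition op_cvg (I : Type) (G : set_system I) H (A : I -> H -> H)
    (B : H -> H) : Prop :=
  forall e : R, 0 < e -> \forall i \near G, opnorm_le (fun x => A i x - B x) e.

(* [D] is the operator-norm derivative at [t] of [F] on the set [J]; at an
   endpoint of an interval [J] it is one-sided. *)
Definition op_derivative_within (J : set R) H (F : R -> H -> H) (t : R)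
    (D : H -> H) : Prop :=
  op_cvg (within J t^')
    (fun s x => ((s - t)^-1)%:C *: (F s x - F t x)) D.

Definition unitary K (U : K -> K) : Prop :=
  [/\ linear U, forall x y, inner (U x) (U y) = inner x y
    & forall y, exists x, U x = y].

(* H is regarded as the closed subspace V(H) of K. *)
Definition embedding H K (V : H -> K) : Prop :=
  linear V /\ forall x, `|V x| = `|x|.

(* A = P_H B | H : for each x in H, V (A x) is the orthogonal projection of
   B (V x) on V(H). *)
Definition compression H K (V : H -> K) (B : K -> K) (A : H -> H) : Prop :=
  forall x y, inner (B (V x) - V (A x)) (V y) = 0.

End Operators.

Section SemiSpectral.
Context {R : realType} {d : measure_display} {X : measurableType d}.
Implicit Types H K : hilbertType R.

Definition semi_spectral_measure H (E : set X -> H -> H) : Prop :=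
  [/\ forall D, measurable D -> bounded_op (E D) /\ positive_op (E D),
      E set0 = (fun=> 0),
      E setT = id &
      forall D : (set X)^nat, (forall n, measurable (D n)) ->
        trivIset setT D -> forall x y,
        (series (fun n => inner (E (D n) x) y : cplx R)) @ \oo -->
          (inner (E (\bigcup_n D n) x) y : cplx R)].

(* The values are positive, hence self-adjoint, so that idempotent values are
   orthogonal projections. *)
Definition spectral_measure H (E : set X -> H -> H) : Prop :=
  semi_spectral_measure E /\
  forall D, measurable D -> forall x, E D (E D x) = E D x.

(* A simple function, as a finite list of coefficients and sets. *)
Definition simple_fun (s : seq (R[i] * set X)) (x : X) : R[i] :=
  \sum_(c <- s) c.1 * (\1_(c.2) x).

Definition simple_int H (E : set X -> H -> H) (s : seq (R[i] * set X))
    (x : H) : H :=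
  \sum_(c <- s) c.1 *: E c.2 x.

(* B is the integral of f for the spectral measure E: the limit of the
   integrals of simple functions converging uniformly to f. Uniform limits of
   simple functions are exactly the bounded measurable functions. *)
Definition spectral_int H (E : set X -> H -> H) (f : X -> R[i])
    (B : H -> H) : Prop :=
  exists s : nat -> seq (R[i] * set X),
  [/\ forall n c, c \in s n -> measurable c.2,
      forall e : R, 0 < e -> \forall n \near \oo,
        forall x, `|simple_fun (s n) x - f x| <= e%:C &
      op_cvg \oo (fun n => simple_int E (s n)) B].

Definition spectral_dilation H K (V : H -> K) (E : set X -> K -> K)
    (EE : set X -> H -> H) : Prop :=
  [/\ embedding V, spectral_measure E &
      forall D, measurable D -> compression V (E D) (EE D)].

(* A is the integral of f for the semi-spectral measure EE. *)
Definition semi_spectral_int H (EE : set X -> H -> H) (f : X -> R[i])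
    (A : H -> H) : Prop :=
  exists (K : hilbertType R) (V : H -> K) (E : set X -> K -> K) (B : K -> K),
  [/\ spectral_dilation V E EE, spectral_int E f B & compression V B A].

End SemiSpectral.

Section Circle.
Variable R : realType.

Definition circle_set := {z : R[i] | `|z| == 1}.

HB.instance Definition _ := Choice.on circle_set.

Fact circle1_subproof : `|1 : R[i]| == 1. Proof. by rewrite normr1. Qed.

HB.instance Definition _ :=
  isPointed.Build circle_set (exist _ 1 circle1_subproof).

Definition circle_open : set (set circle_set) :=
  [set (fun z => val z : cplx R) @^-1` U | U in [set U | open U]].

(* The unit circle with its Borel sigma-algebra. *)
Definition circle := g_sigma_algebraType circle_open.

Fact expi_subproof (x : R) : `|cos x +i* sin x| == 1.
Proof.
apply/eqP; rewrite -[LHS]/((Num.sqrt (cos x ^+ 2 + sin x ^+ 2))%:C).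
by rewrite cos2Dsin2 sqrtr1.
Qed.

(* x |-> e^(2 pi i x), which transports Lebesgue measure on [0,1] to the
   normalized Lebesgue measure m on the circle. *)
Definition circle_param (x : R) : circle :=
  exist _ (cos (2 * pi * x) +i* sin (2 * pi * x)) (expi_subproof (2 * pi * x)).

End Circle.

Section Besov.
Variable R : realType.
Notation mu := (@lebesgue_measure R).
Notation T := (circle R).
Implicit Types f g : T -> R[i].

Definition L1_circle f : Prop :=
  mu.-integrable `[0, 1] (fun x => (complex.Re (f (circle_param x)))%:E) /\
  mu.-integrable `[0, 1] (fun x => (complex.Im (f (circle_param x)))%:E).

Definition circle_int g : R[i] :=
  (\int[mu]_(x in `[0, 1]) complex.Re (g (circle_param x))) +i*
  (\int[mu]_(x in `[0, 1]) complex.Im (g (circle_param x))).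

Definition fourier f (k : int) : R[i] :=
  circle_int (fun z => f z * (val z) ^ (- k)).

Definition circle_conv f (W : R[i] -> R[i]) (z : T) : R[i] :=
  circle_int (fun t => f t * W (val z * (val t)^*)).

Definition Lp_circle (p : \bar R) g : \bar R :=
  Lnorm (mrestr mu (measurable_itv `[(0 : R), 1])) p
    (fun x => (Normc.normc (g (circle_param x)))%:E).

Definition besov_w (x : R) : R :=
  if (2^-1 <= x) && (x <= 1) then 2 * x - 1
  else if (1 <= x) && (x <= 2) then 2 - x else 0.

(* For n >= 1 the sum over all integers k reduces to 0 <= k < 2^(n+1), as w
   is supported in [1/2, 2] and w(2) = 0. *)
Definition besov_W (n : nat) (z : R[i]) : R[i] :=
  if n is 0%N then z^* + 1 + z
  else \sum_(k < (2 ^ n.+1)%N) (besov_w (k%:R / 2 ^+ n))%:C * z ^+ k.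

Definition besov_W_sharp (n : nat) (z : R[i]) : R[i] := (besov_W n z)^*.

(* B^s_pq, for s > 0 and 1 <= p, q <= oo. *)
Definition besov (s : R) (p q : \bar R) f : Prop :=
  [/\ L1_circle f,
      (Lnorm (@counting nat R) q (fun n : nat =>
         (2 `^ (n%:R * s))%:E * Lp_circle p (circle_conv f (besov_W n)))
         < +oo)%E &
      (Lnorm (@counting nat R) q (fun n : nat =>
         (2 `^ (n.+1%:R * s))%:E *
           Lp_circle p (circle_conv f (besov_W_sharp n.+1)))
         < +oo)%E].

Definition besov_plus (s : R) (p q : \bar R) f : Prop :=
  besov s p q f /\ forall k : int, k < 0 -> fourier f k = 0.

(* The analytic extension of f. For f in (B^1_oo1)_+ the series converges
   absolutely on the closed disk, and its sum on the circle is the continuous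
   function that is equal to f almost everywhere. *)
Definition analytic_ext f (z : cplx R) : cplx R :=
  limn (series (fun k : nat => (fourier f k * z ^+ k : cplx R))).

End Besov.

Section DiskAlgebra.
Context {R : realType}.
Implicit Types f g phi : cplx R -> cplx R.

Definition closed_disk : set (cplx R) := [set z | `|z| <= 1].

Definition disk_algebra f : Prop :=
  {within closed_disk, continuous f} /\
  forall z : cplx R, `|z| < 1 -> derivable f z 1.

Definition sup_norm f : R := sup [set Normc.normc (f z) | z in closed_disk].

Definition disk_derivative phi (z : cplx R) : cplx R :=
  lim ((fun w => (phi w - phi z) / (w - z)) w @[w --> within closed_disk z^']).

Definition divided_difference phi (z t : cplx R) : cplx R :=
  if z == t then disk_derivative phi z else (phi z - phi t) / (z - t).

Definition poly_calculus (H : hilbertType R) (p : {poly R[i]}) (A : H -> H)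
    (x : H) : H :=
  \sum_(i < size p) p`_i *: iter i A x.

Definition poly_approx (p : nat -> {poly R[i]}) f : Prop :=
  forall e : R, 0 < e -> \forall n \near \oo,
    forall z, closed_disk z -> `|(p n).[z] - f z| <= e%:C.

(* B = f(A): the extension by continuity of the polynomial calculus. *)
Definition disk_calculus (H : hilbertType R) f (A B : H -> H) : Prop :=
  (exists p, poly_approx p f) /\
  forall p, poly_approx p f -> op_cvg \oo (fun n => poly_calculus (p n) A) B.

(* f_n and g_n represent Phi as an element of the projective tensor product of
   the disk algebra with itself. *)
Definition tensor_rep (Phi : cplx R -> cplx R -> cplx R)
    (f g : nat -> cplx R -> cplx R) : Prop :=
  [/\ forall n, disk_algebra (f n),
      forall n, disk_algebra (g n),
      cvgn (series (fun n => sup_norm (f n) * sup_norm (g n))) &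
      forall z t : cplx R, `|z| = 1 -> `|t| = 1 ->
        series (fun n => f n z * g n t) @ \oo --> Phi z t].

Definition on_circle f (z : circle R) : R[i] := f (val z).

(* D is the double operator integral of Phi with respect to dE1 Q dE2: Phi is
   in the projective tensor product, and each of its representations gives a
   series that converges to D. *)
Definition double_op_int (H : hilbertType R)
    (Phi : cplx R -> cplx R -> cplx R)
    (E1 : set (circle R) -> H -> H) (Q : H -> H)
    (E2 : set (circle R) -> H -> H) (D : H -> H) : Prop :=
  (exists f g : nat -> cplx R -> cplx R, tensor_rep Phi f g) /\
  forall f g : nat -> cplx R -> cplx R, tensor_rep Phi f g ->
  exists F G : nat -> H -> H,
  [/\ forall n, semi_spectral_int E1 (on_circle (f n)) (F n),
      forall n, semi_spectral_int E2 (on_circle (g n)) (G n) &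
      op_cvg \oo (fun n x => \sum_(0 <= k < n) F k (Q (G k x))) D].

(* E is the spectral measure of the unitary operator U. *)
Definition spectral_measure_of (K : hilbertType R) (U : K -> K)
    (E : set (circle R) -> K -> K) : Prop :=
  spectral_measure E /\ spectral_int E (fun z => val z) U.

Definition unitary_dilation (H K : hilbertType R) (V : H -> K) (U : K -> K)
    (A : H -> H) : Prop :=
  [/\ embedding V, unitary U &
      forall n, compression V (iter n U) (iter n A)].

(* EE is a semi-spectral measure of the contraction A. *)
Definition semi_spectral_of (H : hilbertType R) (A : H -> H)
    (EE : set (circle R) -> H -> H) : Prop :=
  exists (K : hilbertType R) (V : H -> K) (U : K -> K)
    (E : set (circle R) -> K -> K),
  [/\ unitary_dilation V U A, spectral_measure_of U E &
      forall D, measurable D -> compression V (E D) (EE D)].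

Definition op_segment (H : hilbertType R) (A B : H -> H) (t : R) (x : H) : H :=
  (1 - t)%:C *: A x + t%:C *: B x.

End DiskAlgebra.

(* Main.v *)
Require Import Defs.
From HB Require Import structures.
From mathcomp Require Import all_boot all_order all_algebra.
From mathcomp Require Import complex.
From mathcomp Require Import all_classical all_reals all_analysis.
From mathcomp Require Import cyclic separable cyclotomic.
From mathcomp Require Import ess_sup_inf measurable_realfun.
From mathcomp Require Import ring lra zify.

Set Implicit Arguments.
Unset Strict Implicit.
Unset Printing Implicit Defensive.

Import Order.TTheory GRing.Theory Num.Theory numFieldNormedType.Exports.

Local Open Scope classical_set_scope.
Local Open Scope ring_scope.

(* On a block of the Littlewood-Paley decomposition phi = sum P_n, the divided
   difference of P_n is sum c_(j+k+1) z^j w^k.  Writing 1 = j/(j+k+1) + (k+1)/(j+k+1)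
   splits it into O(2^n) elementary tensors, in each of which one factor is a
   monomial and the other one arises from P_n by a Fourier multiplier
   (1 - k/m)_+, which is bounded in the sup norm uniformly in k.  Hence the
   divided difference of phi has a representation sum f_m(z) g_m(w) with
   sum |f_m| |g_m| <= C sum 2^n |P_n|.  The same algebraic identity for operators
   gives phi(T_s) - phi(T_t) = (s - t) sum f_m(T_s) (R - T) g_m(T_t), and one lets
   s tend to t under the sum, von Neumann's inequality providing the domination.
   That any other representation of the divided difference yields the same
   operator follows by replacing all functions by step functions on a fine
   partition of the circle: the resulting double sum involves only the values
   of the divided difference at the sample points. *)

(** Collecting the terms $c_{j+k+1}z^jw^k$ of a block for fixed $k$ gives a tail of $P_n$ with a
    sharp cutoff, whose sup norm can exceed that of $P_n$ by a factor of order $n$, the logarithm of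
    the degree; the resulting $\sum n2^n\|P_n\|$ need not be finite on $B^1_{\infty1}$. A weight
    that decreases to $0$ at the cutoff removes the logarithm, and two such weights with sum $1$ let
    every term be shared between the two sides. The measures $\mathcal{E}_s$ need not depend on $s$
    in any controlled way, so the limit $s\to t$ is taken only with polynomials of $T_s$; the
    measure at $t$ enters when polynomials of $T_t$ are recognized as integrals. In the difference
    quotient all right factors are taken at $T_t$, so that only left factors move, and for finitely
    many of them a Lipschitz constant depending on the degree is good enough. *)

Section LinearFunctions.
Variables (R : pzRingType) (U V : lmodType R) (L : U -> V).
Hypothesis lL : linear L.

Lemma linear_funB x y : L (x - y) = L x - L y.
Proof. by rewrite addrC -scaleN1r lL scaleN1r addrC. Qed.

Lemma linear_fun0 : L 0 = 0.
Proof. by rewrite -(subrr 0) linear_funB subrr. Qed.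

Lemma linear_funZ c x : L (c *: x) = c *: L x.
Proof. by rewrite -[c *: x]addr0 lL linear_fun0 addr0. Qed.

Lemma linear_funD x y : L (x + y) = L x + L y.
Proof. by rewrite -[x]scale1r lL !scale1r. Qed.

Lemma linear_lincomb (I : Type) (r : seq I) (c : I -> R) (y : I -> U) :
  L (\sum_(i <- r) c i *: y i) = \sum_(i <- r) c i *: L (y i).
Proof.
elim: r => [|i r IH]; first by rewrite !big_nil linear_fun0.
by rewrite !big_cons lL IH.
Qed.
End LinearFunctions.

(** * Fourier multipliers and divided differences of polynomials *)

Section FejerMultiplier.
Variable R : rcfType.
Local Notation C := (complex R).
Local Notation normc := (@Normc.normc R).

Lemma normcE (x : C) : `|x| = real_complex R (normc x).
Proof. by []. Qed.

Lemma normc_ge0 (x : C) : 0 <= normc x.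
Proof. by rewrite -ler0c -normcE. Qed.

Lemma normc_eq1 (x : C) : (`|x| = 1) <-> (normc x = 1).
Proof. by rewrite normcE; split => [[]|->]. Qed.

Lemma normcX (x : C) n : normc (x ^+ n) = normc x ^+ n.
Proof. by elim: n => [|n IH]; rewrite ?Normc.normc1 // !exprS Normc.normcM IH. Qed.

Lemma normc_real (x : R) : normc (real_complex R x) = `|x|.
Proof. by rewrite /= expr0n /= addr0 sqrtr_sqr. Qed.

Lemma normc_sum (I : Type) (r : seq I) (P : pred I) (F : I -> C) :
  normc (\sum_(i <- r | P i) F i) <= \sum_(i <- r | P i) normc (F i).
Proof.
elim/big_ind2 : _ => [|x u y v xu yv|//]; first by rewrite Normc.normc0.
exact: le_trans (le_normcD _ _) (lerD xu yv).
Qed.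

Lemma prim_root_complex n : (0 < n)%N -> exists z : C, n.-primitive_root z.
Proof.
move=> n_gt0; pose p : {poly C} := 'X^n - 1; have [r Dp] := closed_field_poly_normal p.
move: Dp; rewrite (monicP (monicXnsubC _ n_gt0)) scale1r => Dp.
have rn1 : all n.-unity_root r.
  by apply/allP=> z; rewrite -root_prod_XsubC -Dp.
have sz_r : (n < (size r).+1)%N.
  by rewrite -(size_prod_XsubC r id) -Dp size_XnsubC.
have [|z] := hasP (has_prim_root n_gt0 rn1 _ sz_r); last by exists z.
by rewrite -separable_prod_XsubC -Dp separable_Xn_sub_1 // pnatr_eq0 -lt0n.
Qed.

Lemma normc_prim_root n (w : C) : (0 < n)%N -> n.-primitive_root w -> normc w = 1.
Proof.
move=> n0 /prim_expr_order /(congr1 normc); rewrite normcX Normc.normc1.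
by move=> /eqP; rewrite pexpr_eq1 ?normc_ge0 // => /eqP.
Qed.

Lemma polar_form (z : C) : exists2 w : C, normc w = 1 & z = real_complex R (normc z) * w.
Proof.
have [r0|r0] := eqVneq (normc z) 0.
  by exists 1; [exact: Normc.normc1|rewrite r0 mul0r; exact: Normc.eq0_normc].
exists (z / real_complex R (normc z)).
  by rewrite Normc.normcM Normc.normcV normc_real ger0_norm ?normc_ge0 // mulfV.
by rewrite mulrC divfK // -(rmorph0 (real_complex R)) (inj_eq (@complexI R)).
Qed.

Lemma sum_prim_root n (w : C) k : n.-primitive_root w ->
  \sum_(i < n) (w ^+ i) ^+ k = if (n %| k)%N then n%:R else 0.
Proof.
move=> wn.
under eq_bigr => i _ do rewrite exprAC.
case: ifPn => [nk|nk].
  have -> : w ^+ k = 1 by apply/eqP; rewrite -(prim_order_dvd wn).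
  by under eq_bigr => i _ do rewrite expr1n; rewrite sumr_const card_ord.
have wk : w ^+ k - 1 != 0 by rewrite subr_eq0 -(prim_order_dvd wn).
apply: (mulfI wk); rewrite mulr0 -subrX1 exprAC (prim_expr_order wn).
by rewrite expr1n subrr.
Qed.

(* The average over the [n]-th roots of unity replaces the convolution integral
   with the Fejer kernel [|1 + w + ... + w^(t-1)|^2]. *)
Lemma fejer_sum n (w : C) t (p : {poly C}) z : n.-primitive_root w ->
  (size p + t <= n)%N ->
  \sum_(i < n) p.[z * w ^+ i] * \sum_(a < t) \sum_(b < t) (w ^+ i) ^+ (a + (n - b))
  = n%:R * \sum_(m < size p) (t - m)%:R * p`_m * z ^+ m.
Proof.
move=> wn nt.
transitivity (\sum_(m < size p) \sum_(a < t) \sum_(b < t)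
    p`_m * z ^+ m * \sum_(i < n) (w ^+ i) ^+ (m + (a + (n - b)))).
  rewrite (eq_bigr (fun i : 'I_n => \sum_(m < size p) \sum_(a < t) \sum_(b < t)
    p`_m * z ^+ m * (w ^+ i) ^+ (m + (a + (n - b))))); last first.
    move=> i _; rewrite horner_coef mulr_suml; apply: eq_bigr => m _.
    rewrite mulr_sumr; apply: eq_bigr => a _; rewrite mulr_sumr.
    apply: eq_bigr => b _.
    by rewrite exprMn [in RHS]exprD !mulrA.
  rewrite exchange_big; apply: eq_bigr => m _.
  rewrite exchange_big; apply: eq_bigr => a _.
  rewrite exchange_big; apply: eq_bigr => b _.
  by rewrite mulr_sumr.
rewrite mulr_sumr; apply: eq_bigr => m _.
under eq_bigr => a _ do under eq_bigr => b _ do rewrite (sum_prim_root _ wn).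
have dv (a b : 'I_t) : (n %| m + (a + (n - b)))%N = (m + a == b)%N.
  have := ltn_ord m; have := ltn_ord a; have := ltn_ord b => hb ha hm.
  apply/idP/eqP => [/dvdnP [q hq]|e].
    (* The exponent lies strictly between $0$ and $2n$, as $m+a<n$ and $0<n-b\le n$; here
       [size p + t <= n] excludes aliasing. *)
    have q1 : q = 1%N by nia.
    by move: hq; rewrite q1; lia.
  by have -> : (m + (a + (n - b)) = n)%N by lia.
under eq_bigr => a _ do under eq_bigr => b _ do rewrite dv.
have -> : \sum_(a < t) \sum_(b < t) p`_m * z ^+ m * (if (m + a)%N == b then n%:R else 0)
   = \sum_(a < t) (if (m + a < t)%N then p`_m * z ^+ m * n%:R else 0).
  apply: eq_bigr => a _; case: ifPn => mt.
    rewrite (bigD1 (Ordinal mt)) //= eqxx big1 ?addr0 // => b.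
    by rewrite -val_eqE /= eq_sym => /negPf ->; rewrite mulr0.
  rewrite big1 // => b _; case: eqP => [e|]; last by rewrite mulr0.
  by move: mt; rewrite e ltn_ord.
rewrite -big_mkcond /= sumr_const -(mulr_natl _ #|_|).
have -> : #|[pred a : 'I_t | (m + a < t)%N]| = (t - m)%N.
  rewrite -sum1_card (big_ord_widen_cond _ (fun a => (m + a < t)%N) (fun=> 1%N) (leqnn t)).
  rewrite (eq_bigl (fun a : 'I_t => (a < t - m)%N)); last first.
    by move=> a /=; rewrite ltn_ord andbT; lia.
  rewrite -(big_ord_widen _ (fun=> 1%N) (leq_subr m t)).
  by rewrite sum1_card card_ord.
ring.
Qed.

Definition coef_mul (lam : nat -> R) (p : {poly C}) : {poly C} :=
  \poly_(m < size p) (real_complex R (lam m) * p`_m).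

(** Only polynomials of degree below [N] are concerned, since a finite sum of Fejer multipliers
    reproduces a sequence only up to such an index. The bound obtained for [tail_weight] is
    independent of [N]. *)
Definition multiplier_le (N : nat) (lam : nat -> R) (B : R) := forall (p : {poly C}) (M : R),
  (size p <= N)%N ->
  (forall z, normc z = 1 -> normc p.[z] <= M) ->
  forall z, normc z = 1 -> normc (coef_mul lam p).[z] <= B * M.

(** The kernel in [fejer_sum] is $|D|^2\ge0$ at each root of unity, so its $L^1$ norm is its mean,
    that is, the value $t$ of the multiplier at index $0$. *)
Lemma fejer_multiplier N t : multiplier_le N (fun m => (t - m)%:R) t%:R.
Proof.
move=> p M sp pM z z1.
have M0 : 0 <= M by apply: le_trans (pM z z1); exact: normc_ge0.
have [p0|p0] := eqVneq p 0.
  by rewrite /coef_mul p0 size_poly0 poly_def big_ord0 horner0 Normc.normc0 mulr_ge0.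
have sp0 : (0 < size p)%N by rewrite size_poly_gt0.
have n0 : (0 < size p + t)%N by rewrite addn_gt0 sp0.
set n := (size p + t)%N in n0.
have [w wn] := prim_root_complex n0.
have w1 := normc_prim_root n0 wn.
have wi1 i : normc (w ^+ i) = 1 by rewrite normcX w1 expr1n.
pose D (i : 'I_n) : C := \sum_(a < t) (w ^+ i) ^+ a.
(* On the $n$-th roots of unity the exponent $n-b$ amounts to $-b$, so the double sum is
   $D\overline{D}$. *)
have DE (i : 'I_n) : \sum_(a < t) \sum_(b < t) (w ^+ i) ^+ (a + (n - b)) =
    real_complex R (normc (D i) ^+ 2).
  rewrite rmorphXn /= -normcE sqr_normc rmorph_sum /= mulr_suml; apply: eq_bigr => a _.
  rewrite mulr_sumr; apply: eq_bigr => b _; rewrite exprD; congr (_ * _).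
  have wib : (w ^+ i) ^+ b * ((w ^+ i) ^+ b)^* = 1.
    rewrite -sqr_normc normcE normcX wi1 expr1n; exact: expr1n.
  have wib0 : (w ^+ i) ^+ b != 0.
    by apply/eqP => e; move/eqP: wib; rewrite e mul0r eq_sym oner_eq0.
  apply: (mulfI wib0); rewrite wib -exprD subnKC; last first.
    by have := ltn_ord b; rewrite /n; lia.
  by rewrite exprAC (prim_expr_order wn) expr1n.
(* The mean of the kernel is read off from [fejer_sum] for the polynomial $1$. *)
have sumD : \sum_(i < n) normc (D i) ^+ 2 = n%:R * t%:R.
  have := @fejer_sum n w t 1 1 wn; rewrite size_poly1 => /(_ _).
  move=> /(_ (leq_add sp0 (leqnn t))).
  under eq_bigr => i _ do rewrite hornerC mul1r DE.
  rewrite big_ord_recl big_ord0 addr0 subn0 coef1 eqxx !expr0 !mulr1 -rmorph_sum => e.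
  by apply: (@complexI R); rewrite e rmorphM !rmorph_nat.
have := fejer_sum z wn (leqnn n).
have -> : \sum_(m < size p) (t - m)%:R * p`_m * z ^+ m = (coef_mul (fun m => (t - m)%:R) p).[z].
  rewrite /coef_mul horner_poly; apply: eq_bigr => m _.
  by rewrite rmorph_nat.
move/(congr1 normc); rewrite Normc.normcM => e.
have nR : 0 < normc n%:R.
  by rewrite -(rmorph_nat (real_complex R)) normc_real ger0_norm // ltr0n.
have nn : normc n%:R = n%:R.
  by rewrite -(rmorph_nat (real_complex R)) normc_real ger0_norm.
rewrite -(ler_pM2l nR) -e; apply: le_trans (normc_sum _ _ _) _.
apply: (@le_trans _ _ (\sum_(i < n) M * normc (D i) ^+ 2)).
  apply: ler_sum => i _; rewrite Normc.normcM DE normc_real ger0_norm ?sqr_ge0 //.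
  apply: ler_wpM2r; rewrite ?sqr_ge0 // pM // Normc.normcM z1 mul1r //.
by rewrite -mulr_sumr sumD nn mulrC mulrA.
Qed.
End FejerMultiplier.

(** * Convex multipliers and weighted tails of a polynomial *)

Section ConvexMultiplier.
Variable R : rcfType.
Local Notation C := (complex R).
Local Notation normc := (@Normc.normc R).
Local Notation coef_mul := (@coef_mul R).
Local Notation multiplier_le := (@multiplier_le R).

Lemma coef_coef_mul lam p i : (coef_mul lam p)`_i = real_complex R (lam i) * p`_i.
Proof.
by rewrite coef_poly; case: ltnP => // h; rewrite nth_default ?mulr0.
Qed.

Lemma eq_multiplier N l l' B : (forall m, (m < N)%N -> l m = l' m) ->
  multiplier_le N l B -> multiplier_le N l' B.
Proof.
move=> e h p M sp pM z z1.
suff <- : coef_mul l p = coef_mul l' p by apply: h.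
apply/polyP => i; rewrite !coef_coef_mul.
by case: (ltnP i N) => iN; [rewrite e|rewrite nth_default ?mulr0 ?(leq_trans sp)].
Qed.

Lemma multiplierD N l l' B B' : multiplier_le N l B -> multiplier_le N l' B' ->
  multiplier_le N (fun m => l m + l' m) (B + B').
Proof.
move=> h h' p M sp pM z z1.
have -> : coef_mul (fun m => l m + l' m) p = coef_mul l p + coef_mul l' p.
  by apply/polyP => i; rewrite coefD !coef_coef_mul rmorphD mulrDl.
by rewrite hornerD mulrDl (le_trans (le_normcD _ _)) // lerD ?h ?h'.
Qed.

Lemma multiplierZ N l B c : multiplier_le N l B ->
  multiplier_le N (fun m => c * l m) (`|c| * B).
Proof.
move=> h p M sp pM z z1.
have -> : coef_mul (fun m => c * l m) p = real_complex R c *: coef_mul l p.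
  by apply/polyP => i; rewrite coefZ !coef_coef_mul rmorphM mulrA.
rewrite hornerZ Normc.normcM normc_real -mulrA ler_wpM2l ?normr_ge0 //; exact: h.
Qed.

Lemma multiplier1 N : multiplier_le N (fun=> 1) 1.
Proof.
move=> p M sp pM z z1.
have -> : coef_mul (fun=> 1) p = p.
  by apply/polyP => i; rewrite coef_coef_mul mul1r.
by rewrite mul1r; apply: pM.
Qed.

Lemma multiplier_sum N n (l : nat -> nat -> R) B :
  (forall t, (t < n)%N -> multiplier_le N (l t) (B t)) ->
  multiplier_le N (fun m => \sum_(t < n) l t m) (\sum_(t < n) B t).
Proof.
elim: n => [|n IH] h.
  rewrite big_ord0; apply: (@eq_multiplier _ (fun m => 0 * 1)).
    by move=> m _; rewrite big_ord0 mul0r.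
  by have := @multiplierZ N (fun=> 1) 1 0 (@multiplier1 N); rewrite normr0 mul0r.
rewrite big_ord_recr /=; apply: (@eq_multiplier _ (fun m => \sum_(t < n) l t m + l n m)).
  by move=> m _; rewrite big_ord_recr.
by apply: multiplierD; [apply: IH => t tn; apply: h; lia|apply: h].
Qed.

(** A discrete Taylor formula about the right end [N.+1], with second differences in the remainder.
    Truncated subtraction makes [(t.+1 - m)%:R] equal to $(t+1-m)_+$, a Fejer multiplier. *)
Lemma second_difference_sum (l : nat -> R) N m : (m <= N.+1)%N ->
  l m = l N.+1 + (l N - l N.+1) * (N.+1 - m)%:R
     + \sum_(t < N) (l t - 2 * l t.+1 + l t.+2) * (t.+1 - m)%:R.
Proof.
elim: N => [|N IH].
  by rewrite big_ord0; case: m => [|[|//]] _; rewrite ?subnn ?subn0; ring.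
rewrite leq_eqVlt => /orP[/eqP ->|mN].
  rewrite subnn big1 => [|t _]; first by rewrite mulr0 !addr0.
  have tN : (t.+1 <= N.+2)%N := ltnW (ltn_ord t).
  by rewrite (eqP tN) mulr0n mulr0.
rewrite big_ord_recr /= {1}IH //.
have -> : (N.+2 - m = (N.+1 - m).+1)%N by lia.
rewrite -(natr1 (N.+1 - m)); ring.
Qed.

(* By [second_difference_sum] a convex decreasing sequence is a positive
   combination of Fejer multipliers; the norm is found by evaluating at [0]. *)
Lemma convex_multiplier N (l : nat -> R) : (forall m, 0 <= l m) ->
  (forall m, l m.+1 <= l m) -> (forall m, 0 <= l m - 2 * l m.+1 + l m.+2) ->
  multiplier_le N l (l 0%N).
Proof.
move=> l0 ld lc.
rewrite (@second_difference_sum l N 0) // subn0.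
apply: (@eq_multiplier _ (fun m => (l N.+1 * 1 + (l N - l N.+1) * (N.+1 - m)%:R)
     + \sum_(t < N) (l t - 2 * l t.+1 + l t.+2) * (t.+1 - m)%:R)).
  by move=> m mN; rewrite mulr1 -second_difference_sum // ltnW // ltnW.
apply: multiplierD; first apply: multiplierD.
- by have := @multiplierZ N (fun=> 1) 1 (l N.+1) (@multiplier1 N); rewrite ger0_norm ?mulr1.
- have := @multiplierZ N _ _ (l N - l N.+1) (@fejer_multiplier R N N.+1).
  by rewrite ger0_norm // subr_ge0.
- apply: (@multiplier_sum _ _ (fun t m => (l t - 2 * l t.+1 + l t.+2) * (t.+1 - m)%:R)
    (fun t => (l t - 2 * l t.+1 + l t.+2) * (t.+1 - 0)%:R)) => t tN.
  have := @multiplierZ N _ _ (l t - 2 * l t.+1 + l t.+2) (@fejer_multiplier R N t.+1).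
  by rewrite ger0_norm // subn0.
Qed.

(* Dilation by [r <= 1] is the convex multiplier [r ^ m]. *)
Lemma poly_max_principle (p : {poly C}) M :
  (forall z, normc z = 1 -> normc p.[z] <= M) ->
  forall z, normc z <= 1 -> normc p.[z] <= M.
Proof.
move=> pM z z1.
pose r := normc z; have r0 : 0 <= r by apply: normc_ge0.
have rX m : 0 <= r ^+ m by rewrite exprn_ge0.
have h : multiplier_le (size p) (fun m => r ^+ m) 1.
  rewrite -(expr0 r); apply: convex_multiplier => m //.
    by rewrite exprS ler_piMl.
  have -> : r ^+ m - 2 * r ^+ m.+1 + r ^+ m.+2 = r ^+ m * (1 - r) ^+ 2.
    by rewrite !exprS; ring.
  by rewrite mulr_ge0 // sqr_ge0.
have [w w1 zw] := polar_form z.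
have := h p M (leqnn _) pM w w1; rewrite mul1r; congr (normc _ <= _).
rewrite horner_poly horner_coef; apply: eq_bigr => m _.
by rewrite zw -/r exprMn rmorphXn /=; ring.
Qed.

(** The sequence $(1-k/m)_+$; the test [m <= k] also covers $m=0$. For $k=0$ its only effect is to
    remove the constant coefficient. *)
Definition tail_weight (k m : nat) : R := if (m <= k)%N then 0 else 1 - k%:R / m%:R.

(* For [0 < k] the weight is [1 - g m + (k - m)_+ / k], where [g m = k / m] for
   [k <= m], continued linearly with slope [- 1 / k] below [k], is convex. *)
Lemma tail_weight_multiplier N k : multiplier_le N (tail_weight k) 4.
Proof.
have neg l B : multiplier_le N l B -> multiplier_le N (fun m => - l m) B.
  move=> h; apply: (@eq_multiplier _ (fun m => -1 * l m)).
    by move=> m _; rewrite mulN1r.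
  by have := multiplierZ (-1) h; rewrite normrN1 mul1r.
have weaken l B B' : B <= B' -> multiplier_le N l B -> multiplier_le N l B'.
  move=> BB h p M sp pM z z1; apply: le_trans (h p M sp pM z z1) _.
  by rewrite ler_wpM2r // (le_trans _ (pM z z1)) // normc_ge0.
(* For $k=0$ the weight is $1-(1-m)_+$, of norm at most $2$. *)
case: k => [|k].
  apply: (@eq_multiplier _ (fun m => 1 + - (1 - m)%:R)).
    move=> [|m] _; rewrite /tail_weight /=; first by rewrite subn0 subrr.
    have -> : (1 - m.+1 = 0)%N by lia.
    by rewrite mul0r mulr0n !subr0.
  apply: (weaken _ (1 + 1)); first by lra.
  apply: multiplierD; first exact: multiplier1.
  by apply: neg; apply: fejer_multiplier.
have k0 : (0 : R) < k.+1%:R by rewrite ltr0n.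
(* The line $2-m/(k+1)$ is the tangent to $(k+1)/m$ at $m=k+1$, so the two pieces join to a convex
   sequence. *)
pose g m : R := if (m <= k.+1)%N then 2 - m%:R / k.+1%:R else k.+1%:R / m%:R.
apply: (@eq_multiplier _ (fun m => (1 + - g m) + k.+1%:R^-1 * (k.+1 - m)%:R)).
  move=> m _; rewrite /tail_weight /g; case: leqP => mk.
    rewrite natrB //; field; exact: lt0r_neq0.
  have e0 : (k.+1 - m = 0)%N by lia.
  by rewrite e0 mulr0n mulr0 addr0.
(* The three norms: $1$ for the constant, $g(0)=2$ for the convex part, and $1$ for the Fejer
   multiplier divided by $k+1$. *)
have -> : 4 = 1 + g 0%N + `|k.+1%:R^-1| * k.+1%:R :> R.
  rewrite /g /= ger0_norm ?invr_ge0 ?ler0n // mulVf ?lt0r_neq0 // mul0r; ring.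
apply: multiplierD; last exact: multiplierZ (fejer_multiplier _).
apply: multiplierD; first exact: multiplier1.
apply: neg; apply: convex_multiplier => m.
- rewrite /g; case: leqP => mk; last by rewrite divr_ge0.
  have : m%:R / k.+1%:R <= 1 :> R by rewrite ler_pdivrMr // mul1r ler_nat.
  by move: (_ / _) => q; lra.
- rewrite /g; case: (ltngtP m k.+1) => mk.
  + by rewrite lerD2l lerN2 ler_pM2r ?invr_gt0 // ler_nat.
  + rewrite ler_pM2l // lef_pV2 ?posrE ?ltr0n ?ler_nat //; lia.
  + rewrite mk divff ?lt0r_neq0 //.
    by rewrite ler_pdivrMr ?ltr0n //; rewrite -[k.+2%:R]natr1; lra.
- have g1 n : (n <= k.+1)%N -> g n = 2 - n%:R / k.+1%:R by rewrite /g => ->.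
  have g2 n : (k.+1 <= n)%N -> g n = k.+1%:R / n%:R.
    rewrite leq_eqVlt => /orP[/eqP <-|]; last by rewrite ltnNge /g => /negPf ->.
    by rewrite g1 // divff ?lt0r_neq0 //; lra.
  have cvx n : (0 < n)%N -> 0 <= k.+1%:R / n%:R - 2 * (k.+1%:R / n.+1%:R) + k.+1%:R / n.+2%:R :> R.
    move=> n0; have n0' : (0 : R) < n%:R by rewrite ltr0n.
    have -> : k.+1%:R / n%:R - 2 * (k.+1%:R / n.+1%:R) + k.+1%:R / n.+2%:R =
      2 * k.+1%:R / (n%:R * n.+1%:R * n.+2%:R) :> R.
      rewrite -[n.+2%:R]natr1 -[n.+1%:R]natr1; field.
      by rewrite !lt0r_neq0 //; lra.
    by rewrite divr_ge0 // !mulr_ge0.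
  case: (ltnP k m) => km.
    rewrite !g2; try lia; apply: cvx; lia.
  (* For $m=k$ the three points straddle the junction at $k+1$; for smaller $m$ they lie on the line
     and the second difference is $0$. *)
  have [mk|mk] := eqVneq m k.
    rewrite mk g1 ?leqnSn // g1 // g2; last by lia.
    have : k%:R / k.+1%:R = 1 - k.+1%:R^-1 :> R.
      rewrite -[k.+1%:R]natr1; field; rewrite natr1; exact: lt0r_neq0.
    have : k.+1%:R / k.+2%:R >= 1 - k.+1%:R^-1 :> R.
      rewrite -[k.+2%:R]natr1 -subr_ge0.
      have -> : k.+1%:R / (k.+1%:R + 1) - (1 - k.+1%:R^-1) =
         (k.+1%:R * (k.+1%:R + 1))^-1 :> R.
        by field; rewrite !lt0r_neq0 //; lra.
      by rewrite invr_ge0 mulr_ge0 // addr_ge0.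
    rewrite divff ?lt0r_neq0 // => h1 h2; move: h1 h2.
    by move: (k.+1%:R^-1) (k.+1%:R / k.+2%:R) (k%:R / k.+1%:R) => d a b h1 h2; lra.
  rewrite !g1; try lia.
  by rewrite -[m.+2%:R]natr1 -[m.+1%:R]natr1; move: (_^-1) (m%:R) => q r; lra.
Qed.

(* For [s <= k.+1], multiplication by ['X^s] turns this polynomial into
   [coef_mul (tail_weight k) p]. *)
Definition divided_coef (k s : nat) (p : {poly C}) : {poly C} :=
  \poly_(i < size p) (real_complex R (tail_weight k (i + s)) * p`_(i + s)).

(** On the circle multiplication by ['X^s] does not change the modulus, so the multiplier bound
    passes to the shifted polynomial; the maximum principle extends it to the disk. *)
Lemma divided_coef_le k s (p : {poly C}) M : (s <= k.+1)%N ->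
  (forall z, normc z = 1 -> normc p.[z] <= M) ->
  forall z, normc z <= 1 -> normc (divided_coef k s p).[z] <= 4 * M.
Proof.
move=> sk pM; apply: poly_max_principle => z z1.
have h := tail_weight_multiplier k (leqnn (size p)) pM z1.
suff e : coef_mul (tail_weight k) p = divided_coef k s p * 'X^s.
  by move: h; rewrite e hornerM hornerXn Normc.normcM normcX z1 expr1n mulr1.
apply/polyP => i; rewrite coef_coef_mul coefMXn; case: ltnP => si.
  rewrite /tail_weight; have -> : (i <= k)%N by lia.
  by rewrite mul0r.
rewrite coef_poly subnK //; case: ltnP => // h'.
by rewrite [p`_i]nth_default ?mulr0 // (leq_trans h') ?leq_subr.
Qed.

Lemma tail_weightD j k : tail_weight k.+1 (j + k.+1) + tail_weight j (k + j.+1) = 1.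
Proof.
rewrite /tail_weight; have -> : (k + j.+1 <= j)%N = false by lia.
have e : (k + j.+1 = j + k.+1)%N by lia.
case: ifPn => [h|_]; rewrite e.
  have j0 : j = 0%N by lia.
  by rewrite j0 mul0r subr0 add0r.
have h : j%:R / (j + k.+1)%:R + k.+1%:R / (j + k.+1)%:R = 1 :> R.
  by rewrite -mulrDl -natrD divff // pnatr_eq0; lia.
by move: (_ / _) (_ / _) h => a b; lra.
Qed.
End ConvexMultiplier.

(** * Differences of polynomials of two operators *)

Section PolyOperators.
Variable R : rcfType.
Local Notation C := (complex R).

(** For Hilbert space operators this is [poly_calculus]. A general module also allows [C^o] with
    multiplication by a number, which turns operator identities into identities for scalar divided
    differences. *)
Definition opoly (V : lmodType C) (p : {poly C}) (A : V -> V) (x : V) : V :=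
  \sum_(i < size p) p`_i *: iter i A x.

Lemma opoly_widen (V : lmodType C) N (p : {poly C}) (A : V -> V) x : (size p <= N)%N ->
  opoly p A x = \sum_(i < N) p`_i *: iter i A x.
Proof.
move=> pN; rewrite /opoly (big_ord_widen _ (fun i => p`_i *: iter i A x) pN) big_mkcond.
by apply: eq_bigr => i _; case: ltnP => // h; rewrite nth_default ?scale0r.
Qed.

Lemma iter_linear (V : lmodType C) (A : V -> V) j : linear A -> linear (iter j A).
Proof. by move=> lA; elim: j => [|j IH] a y z //; rewrite !iterS IH lA. Qed.

Lemma opoly_mul (p : {poly C}) z (y : C^o) : opoly p (fun y : C^o => z * y) y = p.[z] * y.
Proof.
rewrite horner_coef mulr_suml; apply: eq_bigr => i _.
rewrite -mulrA; congr (_ * _).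
by elim: (nat_of_ord i) => [|n IH]; rewrite ?mul1r //= IH exprS mulrA.
Qed.

Lemma sum_triangle (V : zmodType) (G : nat -> nat -> V) N :
  \sum_(m < N) \sum_(j < m) G j (m - j.+1)%N =
  \sum_(j < N) \sum_(k < N) (if (j + k.+1 < N)%N then G j k else 0).
Proof.
transitivity (\sum_(m < N) \sum_(j < N) if (j < m)%N then G j (m - j.+1)%N else 0).
  apply: eq_bigr => m _; rewrite -big_mkcond /=.
  by rewrite (big_ord_widen _ (fun j => G j (m - j.+1)%N) (ltnW (ltn_ord m))).
rewrite exchange_big; apply: eq_bigr => j _ /=.
rewrite -!big_mkcond /=.
rewrite -(big_mkord (fun m => (j < m)%N) (fun m => G j (m - j.+1)%N)).
rewrite -(big_mkord (fun k => (j + k.+1 < N)%N) (fun k => G j k)).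
have jN := ltn_ord j.
rewrite (@big_cat_nat _ _ _ j.+1) //= big_nat_cond big_pred0 ?add0r; last by move=> i; lia.
rewrite [RHS](@big_cat_nat _ _ _ (N - j.+1)) //=; last by lia.
rewrite [X in _ = _ + X]big_nat_cond [X in _ = _ + X]big_pred0 ?addr0; last by move=> i; lia.
rewrite -{1}(add0n j.+1) big_addn big_nat_cond [RHS]big_nat_cond.
apply: eq_big => i; first by lia.
by move=> _; rewrite addnK.
Qed.

(* Splitting the weight 1 of [A^j (A - B) B^k] as [j/(j+k+1) + (k+1)/(j+k+1)]
   leaves, for fixed [k] resp. fixed [j], polynomials that are controlled by
   the sup norm of [p]. *)
Lemma opoly_sub (V : lmodType C) (p : {poly C}) (A B : V -> V) x N :
  linear A -> linear B -> (size p <= N)%N ->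
  opoly p A x - opoly p B x =
  \sum_(k < N) opoly (divided_coef k.+1 k.+1 p) A (A (iter k B x) - B (iter k B x)) +
  \sum_(j < N) iter j A (A (opoly (divided_coef j j.+1 p) B x) -
                         B (opoly (divided_coef j j.+1 p) B x)).
Proof.
move=> lA lB pN.
have iA j : linear (iter j A) := iter_linear j lA.
pose D y := A y - B y.
have lD : linear D by move=> a y z; rewrite /D lA lB scalerBr opprD addrACA.
pose G j k := p`_(j + k.+1) *: iter j A (D (iter k B x)).
have sz k s : (size (divided_coef k s p) <= N)%N by apply: leq_trans pN; apply: size_poly.
have dc k s i : (divided_coef k s p)`_i = real_complex R (tail_weight R k (i + s)) * p`_(i + s).
  by rewrite coef_poly; case: ltnP => // h; rewrite [p`_(i + s)]nth_default ?mulr0 // (leq_trans h) ?leq_addr.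
transitivity (\sum_(j < N) \sum_(k < N) G j k).
  rewrite !(opoly_widen _ _ pN) -sumrB.
  (* Telescoping along $A^jB^{m-j}$, which keeps $A$ to the left of $B$. *)
  have tel m : iter m A x - iter m B x = \sum_(j < m) iter j A (D (iter (m - j.+1) B x)).
    pose F j := iter j A (iter (m - j) B x).
    have -> : iter m A x - iter m B x = F m - F 0%N by rewrite /F subnn subn0.
    rewrite -(telescope_sumr F (leq0n m)) big_mkord; apply: eq_bigr => j _.
    rewrite /D (linear_funB (iA j)) /F -iterSr -iterS; congr (_ - iter j A _).
    by have -> : (m - j = (m - j.+1).+1)%N by have := ltn_ord j; lia.
  transitivity (\sum_(m < N) \sum_(j < m) G j (m - j.+1)%N).
    apply: eq_bigr => m _; rewrite -scalerBr tel scaler_sumr; apply: eq_bigr => j _.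
    by rewrite /G; congr (p`_ _ *: _); have := ltn_ord j; lia.
  rewrite sum_triangle; apply: eq_bigr => j _; apply: eq_bigr => k _.
  (* Outside the triangle the coefficient of [p] vanishes, so the sum extends to the whole square,
     where the order of summation is free. *)
  case: ifPn => //; rewrite -leqNgt => h.
  by rewrite /G nth_default ?scale0r // (leq_trans pN).
rewrite [X in _ = X + _](eq_bigr (fun k : 'I_N => \sum_(j < N)
   real_complex R (tail_weight R k.+1 (j + k.+1)) *: G j k)); last first.
  move=> k _; rewrite (opoly_widen _ _ (sz _ _)); apply: eq_bigr => j _.
  by rewrite dc -scalerA.
rewrite [X in _ = X + _]exchange_big -big_split /=; apply: eq_bigr => j _.
have -> : iter j A (D (opoly (divided_coef j j.+1 p) B x)) = \sum_(k < N)
   real_complex R (tail_weight R j (k + j.+1)) *: G j k.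
  rewrite (opoly_widen _ _ (sz _ _)) (linear_lincomb lD) (linear_lincomb (iA j)); apply: eq_bigr => k _.
  by rewrite dc -scalerA /G; have -> : (k + j.+1 = j + k.+1)%N by lia.
rewrite -big_split; apply: eq_bigr => k _ /=.
by rewrite -scalerDl -rmorphD tail_weightD scale1r.
Qed.
End PolyOperators.

(** * Spectral and semi-spectral integrals *)

Section HilbertBasics.
Variable R : realType.
Local Notation C := (complex R).
Local Notation normc := (@Normc.normc R).
Local Notation cR := (real_complex R).
Implicit Types H K : hilbertType R.

(** Norms of a Hilbert space take values in [R[i]]; the real copy makes the total order and real
    arithmetic available. *)
Definition rnorm (V : normedModType C) (x : V) : R := complex.Re `|x|.

Section RealNorm.
Variable V : normedModType C.
Implicit Types x y : V.

Lemma rnormE x : `|x| = cR (rnorm x).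
Proof. by rewrite /rnorm RRe_real // ger0_real. Qed.

Lemma rnorm_ge0 x : 0 <= rnorm x.
Proof. by rewrite -ler0c -rnormE. Qed.

Lemma rnorm0 : rnorm (0 : V) = 0.
Proof. by apply: (@complexI R); rewrite -rnormE normr0. Qed.

Lemma rnorm_eq0 x : rnorm x = 0 -> x = 0.
Proof. by move=> h; apply/eqP; rewrite -normr_eq0 rnormE h. Qed.

Lemma rnormD x y : rnorm (x + y) <= rnorm x + rnorm y.
Proof. by rewrite -lecR rmorphD /= -!rnormE ler_normD. Qed.

Lemma rnormN x : rnorm (- x) = rnorm x.
Proof. by apply: (@complexI R); rewrite -!rnormE normrN. Qed.

Lemma rnormBC x y : rnorm (x - y) = rnorm (y - x).
Proof. by rewrite -rnormN opprB. Qed.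

Lemma rnormB x y : rnorm (x - y) <= rnorm x + rnorm y.
Proof. by rewrite -(rnormN y) rnormD. Qed.

Lemma rnorm_trans y x z : rnorm (x - z) <= rnorm (x - y) + rnorm (y - z).
Proof. by rewrite -{1}(subrK y x) -addrA rnormD. Qed.

Lemma rnormZ (a : C) x : rnorm (a *: x) = normc a * rnorm x.
Proof. by apply: (@complexI R); rewrite rmorphM /= -!rnormE normrZ normcE. Qed.

Lemma rnorm_sum (I : Type) (r : seq I) (P : pred I) (F : I -> V) :
  rnorm (\sum_(i <- r | P i) F i) <= \sum_(i <- r | P i) rnorm (F i).
Proof.
elim/big_ind2 : _ => [|x u y v xu yv|//]; first by rewrite rnorm0.
exact: le_trans (rnormD _ _) (lerD xu yv).
Qed.
End RealNorm.

Lemma opnorm_leP H (A : H -> H) M :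
  opnorm_le A M <-> forall x, rnorm (A x) <= M * rnorm x.
Proof.
split=> h x; first by rewrite -lecR rmorphM /= -!rnormE.
by rewrite !rnormE -rmorphM lecR.
Qed.

Section Inner.
Variable H : hilbertType R.
Implicit Types x y : H.

Lemma innerDl x y z : inner (x + y) z = inner x z + inner y z :> C.
Proof. exact: linearDl. Qed.

Lemma innerBl x y z : inner (x - y) z = inner x z - inner y z :> C.
Proof. exact: linearBl. Qed.

Lemma innerZl a x y : inner (a *: x) y = a * inner x y :> C.
Proof. exact: linearZl_LR. Qed.

Lemma innerDr x y z : inner z (x + y) = inner z x + inner z y :> C.
Proof. exact: linearDr. Qed.

Lemma innerZr a x y : inner x (a *: y) = a^* * inner x y :> C.
Proof. exact: linearZr_LR. Qed.

Lemma innerC x y : inner x y = (inner y x)^* :> C.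
Proof. by rewrite hermC expr0 mul1r. Qed.

Lemma inner0l x : inner (0 : H) x = 0 :> C.
Proof. exact: linear0l. Qed.

Lemma inner_suml I (r : seq I) (P : pred I) (F : I -> H) y :
  inner (\sum_(i <- r | P i) F i) y = \sum_(i <- r | P i) inner (F i) y :> C.
Proof. by elim/big_rec2 : _ => [|i u v _ <-]; rewrite ?inner0l // innerDl. Qed.

Lemma inner_sumr I (r : seq I) (P : pred I) (F : I -> H) y :
  inner y (\sum_(i <- r | P i) F i) = \sum_(i <- r | P i) inner y (F i) :> C.
Proof.
rewrite innerC inner_suml rmorph_sum; apply: eq_bigr => i _.
by rewrite [RHS]innerC.
Qed.

Lemma innerxx x : inner x x = cR (rnorm x ^+ 2).
Proof. by rewrite -norm_inner rnormE rmorphXn. Qed.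

Lemma inner_eq x y : (forall z, inner x z = inner y z) -> x = y.
Proof.
move=> h; apply/eqP; rewrite -subr_eq0; apply/eqP/rnorm_eq0.
have : inner (x - y) (x - y) = 0 by rewrite innerBl h subrr.
by rewrite innerxx => /eqP; rewrite (_ : 0 = cR 0) // (inj_eq (@complexI R)) sqrf_eq0 => /eqP.
Qed.

(** Pythagoras for $x=(x-y)+y$. It yields both the Cauchy-Schwarz inequality and the norm bound for
    compressions. *)
Lemma rnorm_orth x y : inner (x - y) y = 0 -> rnorm y <= rnorm x.
Proof.
move=> h; have : inner x x = inner (x - y) (x - y) + inner y y.
  have h' : inner y (x - y) = 0 by rewrite innerC h rmorph0.
  rewrite -{1 2}(subrK y x); move: (x - y) h h' => u h h'.
  by rewrite innerDl !innerDr h h' add0r addr0.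
rewrite !innerxx -rmorphD => /complexI e.
by rewrite -(@ler_pXn2r _ 2) ?nnegrE ?rnorm_ge0 // e lerDr sqr_ge0.
Qed.

Lemma cauchy_schwarz x y : normc (inner x y) <= rnorm x * rnorm y.
Proof.
have [y0|y0] := eqVneq (rnorm y) 0.
  by rewrite (rnorm_eq0 y0) innerC inner0l rmorph0 Normc.normc0 rnorm0 mulr0.
have iy : inner y y != 0.
  by rewrite innerxx (_ : 0 = cR 0) // (inj_eq (@complexI R)) sqrf_eq0.
(* [a *: y] is the orthogonal projection of [x] on the line through [y]. *)
pose a := inner x y / inner y y.
have : rnorm (a *: y) <= rnorm x.
  by apply: rnorm_orth; rewrite innerBl innerZr innerZr innerZl /a divfK // subrr.
rewrite rnormZ /a Normc.normcM Normc.normcV innerxx normc_real ger0_norm ?sqr_ge0 //.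
have y1 : 0 < rnorm y by rewrite lt_neqAle eq_sym y0 rnorm_ge0.
by rewrite expr2 invfM mulrA -mulrA mulVf // mulr1 ler_pdivrMr.
Qed.

(** Polarization: the quadratic form of [A] is real at $x$, $y$, $x+y$ and $x+iy$, and the last two
    vectors compare the imaginary and the real parts of the mixed terms. *)
Lemma positive_selfadjoint (A : H -> H) : linear A -> positive_op A ->
  forall x y, inner (A x) y = inner x (A y).
Proof.
move=> lA pA x y; rewrite [RHS]innerC.
have real z : complex.Im (inner (A z) z) = 0 by apply: ger0_Im; exact: pA.
have AD := linear_funD lA.
have := real (x + y); have := real (x + 'i%C *: y).
have AZ : A (x + 'i%C *: y) = A x + 'i%C *: A y by rewrite addrC lA addrC.
rewrite AZ AD !innerDl !innerDr !innerZl !innerZr.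
have := real x; have := real y.
case: (inner (A x) x) => a1 a2; case: (inner (A y) y) => b1 b2.
case: (inner (A x) y) => c1 c2; case: (inner (A y) x) => d1 d2 /=.
move=> -> -> /=; simpc => h1 h2.
congr (_ +i* _)%C; lra.
Qed.

End Inner.

Section Compression.
Variables (H K : hilbertType R) (V : H -> K).
Hypothesis eV : embedding V.

Lemma rnorm_embedding x : rnorm (V x) = rnorm x.
Proof. by case: eV => _ h; rewrite /rnorm h. Qed.

Lemma embedding_inner x y : inner (V x) (V y) = inner x y.
Proof.
have [lV nV] := eV.
have n2 z : inner (V z) (V z) = inner z z by rewrite !innerxx rnorm_embedding.
have VD := linear_funD lV.
have VZ u v : V (u + 'i%C *: v) = V u + 'i%C *: V v by rewrite addrC lV addrC.
have := n2 (x + y); have := n2 (x + 'i%C *: y).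
rewrite VZ VD !innerDl !innerDr !innerZl !innerZr !n2.
rewrite (innerC (V y) (V x)) (innerC y x).
case: (inner (V x) (V y)) => c1 c2; case: (inner x y) => d1 d2 /=.
case: (inner x x) => a1 a2; case: (inner y y) => b1 b2.
simpc => -[h1 h2] [h3 h4].
congr (_ +i* _)%C; lra.
Qed.

(** The relation [compression] prescribes the inner products of [A u] with all vectors; these
    determine [A], which inherits linearity from [B]. *)
Lemma compression_linear (B : K -> K) (A : H -> H) :
  linear B -> compression V B A -> linear A.
Proof.
move=> lB cBA a x y; have [lV _] := eV.
apply: inner_eq => z.
have e u : inner (A u) z = inner (B (V u)) (V z).
  by have /eqP := cBA u z; rewrite innerBl subr_eq0 => /eqP ->; rewrite embedding_inner.
by rewrite innerDl innerZl !e lV lB innerDl innerZl.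
Qed.

Lemma compression_rnorm (B : K -> K) (A : H -> H) x :
  compression V B A -> rnorm (A x) <= rnorm (B (V x)).
Proof. by move=> c; rewrite -rnorm_embedding; apply: rnorm_orth. Qed.

Lemma compression_sum (I : eqType) (r : seq I) (c : I -> C)
    (B : I -> K -> K) (A : I -> H -> H) :
  {in r, forall i, compression V (B i) (A i)} ->
  compression V (fun x => \sum_(i <- r) c i *: B i x) (fun x => \sum_(i <- r) c i *: A i x).
Proof.
move=> cBA x y; rewrite innerBl embedding_inner !inner_suml -sumrB big_seq big1 // => i ir.
rewrite !innerZl -mulrBr; have := cBA i ir x y; rewrite innerBl embedding_inner => ->.
by rewrite mulr0.
Qed.

Lemma compressionB (B D : K -> K) (B' D' : H -> H) :
  compression V B B' -> compression V D D' ->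
  compression V (fun x => B x - D x) (fun x => B' x - D' x).
Proof.
move=> cB cD x y; have := cB x y; have := cD x y.
rewrite !innerBl !embedding_inner => /eqP; rewrite subr_eq0 => /eqP -> /eqP.
by rewrite subr_eq0 => /eqP ->; rewrite innerBl subrr.
Qed.
End Compression.
End HilbertBasics.

(** * Spectral measures and integrals of simple functions *)

Section SpectralCalculus.
Context {R : realType} {d : measure_display} {X : measurableType d}.
Local Notation C := (complex R).
Local Notation normc := (@Normc.normc R).
Local Notation cR := (real_complex R).
Variable (K : hilbertType R) (E : set X -> K -> K).
Hypothesis sE : spectral_measure E.

Lemma spectral_linear D : measurable D -> linear (E D).
Proof. by move=> mD; have [[/(_ D mD)[[]]]] := sE. Qed.

Lemma spectral_set0 x : E set0 x = 0.
Proof. by have [[_ -> _ _]] := sE. Qed.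

Lemma spectral_setT x : E setT x = x.
Proof. by have [[_ _ -> _]] := sE. Qed.

Lemma spectralU A B x : measurable A -> measurable B -> A `&` B = set0 ->
  E (A `|` B) x = E A x + E B x.
Proof.
move=> mA mB AB; apply: inner_eq => y.
have [[_ _ _ sadd] _] := sE.
have mD n : measurable (bigcup2 A B n) by case: n => [|[|n]] //=.
have tD : trivIset setT (bigcup2 A B) by move: AB; rewrite trivIset_bigcup2.
have := sadd _ mD tD x y; rewrite bigcup2E => h.
have h2 : (series (fun n => inner (E (bigcup2 A B n) x) y : cplx R)) @ \oo -->
    (inner (E A x + E B x) y : cplx R).
  apply: cvg_near_cst; exists 2%N => // n /= n2.
  rewrite /series /= (big_cat_nat _ n2) //= big_nat_recr //= big_nat1 big1_seq /=.
    by rewrite addr0 innerDl.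
  move=> i; rewrite mem_index_iota => /andP[i2 _].
  by case: i i2 => [|[|i]] //= _; rewrite spectral_set0 inner0l.
exact: (cvg_unique _ h h2).
Qed.

(** For disjoint sets with values $P$, $Q$, idempotence of $P+Q$ gives $PQ+QP=0$. Multiplying by $P$
    on either side yields $PQ=-PQP=QP$, so both products vanish. In general both sets are split
    along their intersection. *)
Lemma spectralI A B x : measurable A -> measurable B -> E A (E B x) = E (A `&` B) x.
Proof.
have EE D y : measurable D -> E D (E D y) = E D y by move=> mD; have [_ /(_ D mD)] := sE.
have ED D y z : measurable D -> E D (y + z) = E D y + E D z.
  by move=> mD; exact: linear_funD (spectral_linear mD) y z.
have disj A' B' y : measurable A' -> measurable B' -> A' `&` B' = set0 -> E A' (E B' y) = 0.
  move=> mA mB AB.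
  have h z : E A' (E B' z) + E B' (E A' z) = 0.
    have := EE _ z (measurableU _ _ mA mB).
    rewrite !spectralU // ?ED // !EE // => e.
    apply: (addrI (E A' z + E B' z)); rewrite addr0 -[RHS]e.
    by rewrite addrACA [E B' (E A' z) + _]addrC.
  have E0 D : measurable D -> E D 0 = 0.
    by move=> mD; apply: (addrI (E D 0)); rewrite -ED // !addr0.
  have h1 : E A' (E B' y) + E A' (E B' (E A' y)) = 0.
    by rewrite -{1}(EE A' (E B' y)) // -ED // h E0.
  have h2 : E A' (E B' (E A' y)) + E B' (E A' y) = 0.
    by have := h (E A' y); rewrite EE.
  have h3 : E A' (E B' y) = E B' (E A' y).
    by apply: (addIr (E A' (E B' (E A' y)))); rewrite h1 addrC h2.
  have := h y; rewrite -h3 -mulr2n -scaler_nat => /eqP.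
  by rewrite scaler_eq0 pnatr_eq0 => /eqP.
move=> mA mB.
have mI : measurable (A `&` B) by apply: measurableI.
have split D D' y : measurable D -> measurable D' ->
    E D y = E (D `&` D') y + E (D `\` D') y.
  move=> mD mD'; rewrite -spectralU ?setUIDK //; first exact: measurableI.
    exact: measurableD.
  by apply/seteqP; split=> z //= [[_ zD'] [_]].
have mAB : measurable (A `\` B) by apply: measurableD.
have mBA : measurable (B `\` A) by apply: measurableD.
rewrite (split A B) // (split B A) // setIC [B `&` A]setIC !ED // EE // !disj ?addr0 //.
- by apply/seteqP; split=> z //= [[_ nB] [zB _]].
- by apply/seteqP; split=> z //= [[_ nB] [zA zB]].
- by apply/seteqP; split=> z //= [[zA zB] [_ nA]].
Qed.

Lemma spectral_selfadjoint D x y : measurable D -> inner (E D x) y = inner x (E D y).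
Proof.
move=> mD; apply: positive_selfadjoint; first exact: spectral_linear.
by have [[/(_ D mD)[_]]] := sE.
Qed.

Section Partition.
Variables (I : finType) (h : X -> I).
Hypothesis mh : forall i, measurable [set z | h z = i].

Lemma spectral_partition_seq (r : seq I) x : uniq r ->
  measurable [set z | h z \in r] /\
  E [set z | h z \in r] x = \sum_(i <- r) E [set z | h z = i] x.
Proof.
elim: r => [_|i r IH /= /andP[ir ur]].
  rewrite big_nil; have -> : [set z | h z \in [::]] = set0 by apply/seteqP; split.
  by split; [exact: measurable0|exact: spectral_set0].
have [m1 e1] := IH ur.
have -> : [set z | h z \in i :: r] = [set z | h z = i] `|` [set z | h z \in r].
  apply/seteqP; split=> z /=; rewrite inE.
    by case/orP=> [/eqP|]; [left|right].
  by case=> [->|->]; rewrite ?eqxx ?orbT.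
split; first exact: measurableU.
rewrite big_cons spectralU // ?e1 //.
by apply/seteqP; split=> z //= [->]; rewrite (negPf ir).
Qed.

Lemma spectral_partition (P : pred I) x :
  E [set z | P (h z)] x = \sum_(i | P i) E [set z | h z = i] x.
Proof.
have [_] := spectral_partition_seq x (filter_uniq P (index_enum_uniq I)).
rewrite big_filter => <-; congr (E _ x); apply/seteqP; split=> z /=;
by rewrite mem_filter mem_index_enum andbT.
Qed.

(** By [spectralI] and self-adjointness the vectors of distinct cells are orthogonal, so squared
    norms add up, both for the combination and for [x] itself. *)
Lemma partition_bound (a : I -> C) M x : (forall z, normc (a (h z)) <= M) ->
  rnorm (\sum_i a i *: E [set z | h z = i] x) <= M * rnorm x.
Proof.
move=> aM.
have M0 : 0 <= M by apply: le_trans (aM point); exact: normc_ge0.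
(* The hypothesis does not control [a i] on an empty cell; replacing it there by $0$ leaves the sum
   unchanged. *)
pose b i := if `[< exists z, h z = i >] then a i else 0.
have bM i : normc (b i) <= M.
  rewrite /b; case: asboolP => [[z hz]|_]; last by rewrite Normc.normc0.
  by rewrite -hz.
have -> : \sum_i a i *: E [set z | h z = i] x = \sum_i b i *: E [set z | h z = i] x.
  apply: eq_bigr => i _; rewrite /b; case: asboolP => // nz.
  have -> : [set z | h z = i] = set0.
    by apply/seteqP; split=> z //= hz; case: nz; exists z.
  by rewrite spectral_set0 !scaler0.
pose q i : R := rnorm (E [set z | h z = i] x) ^+ 2.
have orth i j : inner (E [set z | h z = i] x) (E [set z | h z = j] x) = if i == j then cR (q i) else 0.
  case: eqP => [<-|ij]; first by rewrite innerxx.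
  rewrite -spectral_selfadjoint // spectralI //.
  have -> : [set z | h z = j] `&` [set z | h z = i] = set0.
    by apply/seteqP; split=> z //= [-> ji]; apply: ij.
  by rewrite spectral_set0 inner0l.
have nrm (c : I -> C) : rnorm (\sum_i c i *: E [set z | h z = i] x) ^+ 2 = \sum_i normc (c i) ^+ 2 * q i.
  apply: (@complexI R); rewrite -innerxx inner_suml rmorph_sum; apply: eq_bigr => i _.
  rewrite inner_sumr (bigD1 i) //= innerZl innerZr orth eqxx big1 ?addr0.
    by rewrite mulrA -normCK normcE [RHS]rmorphM [in RHS]rmorphXn.
  by move=> j ji; rewrite innerZl innerZr orth eq_sym (negPf ji) !mulr0.
have nx : rnorm x ^+ 2 = \sum_i q i.
  have := nrm (fun=> 1); under eq_bigr => i _ do rewrite scale1r.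
  under [RHS]eq_bigr => i _ do rewrite Normc.normc1 expr1n mul1r.
  move=> <-; congr (rnorm _ ^+ 2).
  rewrite -(spectral_partition xpredT) -[LHS]spectral_setT.
  by congr (E _ x); apply/seteqP; split.
rewrite -(@ler_pXn2r _ 2) ?nnegrE ?mulr_ge0 ?rnorm_ge0 // exprMn nrm nx mulr_sumr.
apply: ler_sum => i _; rewrite ler_wpM2r ?sqr_ge0 //.
by rewrite ler_pXn2r ?nnegrE ?normc_ge0.
Qed.
End Partition.

Definition measurable_coeffs (s : seq (C * set X)) := forall c, c \in s -> measurable c.2.

(** The vector of memberships of [z]. Its fibres are the atoms of the algebra generated by the sets
    in [s], and [simple_fun s] is constant on each of them. *)
Definition atom (s : seq (C * set X)) (z : X) : {ffun 'I_(size s) -> bool} :=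
  [ffun i : 'I_(size s) => `[< (nth (0, set0) s i).2 z >] ].

Lemma measurable_atom s : measurable_coeffs s -> forall b, measurable [set z | atom s z = b].
Proof.
move=> ms b.
have -> : [set z | atom s z = b] = \bigcap_(i in [set: 'I_(size s)])
   (if b i then (nth (0, set0) s i).2 else ~` (nth (0, set0) s i).2).
  apply/seteqP; split=> z /=.
    move=> <- i _; rewrite ffunE; case: asboolP => //.
  move=> hz; apply/ffunP => i; rewrite ffunE; have := hz i I.
  by case: (b i) => hi; apply/asboolP.
apply: fin_bigcap_measurable => [|i _]; first exact: finite_finset.
have mi : measurable (nth (0, set0) s i).2 by apply: ms; apply: mem_nth.
by case: (b i) => //; exact: measurableC.
Qed.

Lemma simple_fun_atom s z : simple_fun s z = \sum_(i < size s | atom s z i) (nth (0, set0) s i).1.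
Proof.
rewrite /simple_fun (big_nth (0, set0)) big_mkord [RHS]big_mkcond; apply: eq_bigr => i _.
by rewrite ffunE indicE; case: asboolP => h; [rewrite mem_set // mulr1|rewrite memNset // mulr0].
Qed.

(** The sets in [s] may overlap, so the sum is first regrouped over the atoms, which are
    disjoint. *)
Lemma simple_int_bound s M x : measurable_coeffs s ->
  (forall z, normc (simple_fun s z) <= M) -> rnorm (simple_int E s x) <= M * rnorm x.
Proof.
move=> ms sM.
have -> : simple_int E s x = \sum_(b : {ffun 'I_(size s) -> bool})
   (\sum_(i < size s | b i) (nth (0, set0) s i).1) *: E [set z | atom s z = b] x.
  rewrite /simple_int (big_nth (0, set0)) big_mkord.
  rewrite (eq_bigr (fun i : 'I_(size s) => \sum_(b : {ffun 'I_(size s) -> bool} | b i)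
      (nth (0, set0) s i).1 *: E [set z | atom s z = b] x)); last first.
    move=> i _; rewrite -scaler_sumr -(spectral_partition (measurable_atom ms) (fun b => b i)).
    congr (_ *: E _ x); apply/seteqP; split=> z /=; rewrite ffunE => /asboolP //.
  rewrite (exchange_big_dep xpredT) //=; apply: eq_bigr => b _.
  by rewrite scaler_suml.
apply: (partition_bound (measurable_atom ms)) => z.
by rewrite -simple_fun_atom.
Qed.

End SpectralCalculus.

(** * Limits of operators in norm *)

Section OperatorLimits.
Context {R : realType}.
Local Notation C := (complex R).
Local Notation cR := (real_complex R).

Lemma near_inftyP (P : nat -> Prop) :
  (\forall n \near \oo, P n) <-> exists N, forall n, (N <= n)%N -> P n.
Proof. by split=> [[N _ h]|[N h]]; exists N. Qed.

Lemma op_cvgP (H : hilbertType R) (A : nat -> H -> H) B : op_cvg \oo A B <->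
  forall e : R, 0 < e -> exists N, forall n, (N <= n)%N ->
    forall x, rnorm (A n x - B x) <= e * rnorm x.
Proof.
split=> h e e0.
  by have /near_inftyP [N hN] := h e e0; exists N => n /hN /opnorm_leP.
by have [N hN] := h e e0; apply/near_inftyP; exists N => n /hN ?; apply/opnorm_leP.
Qed.

Lemma le_eps (a b M : R) : (forall e, 0 < e -> a <= b + e * M) -> a <= b.
Proof.
move=> h; apply/ler_addgt0Pr => e e0; apply: le_trans (h (e / (`|M| + 1)) _) _.
  by rewrite divr_gt0 // ltr_pwDr.
rewrite lerD2l -mulrA -[leRHS]mulr1 ler_pM2l //.
rewrite mulrC ler_pdivrMr ?ltr_pwDr // mul1r (le_trans (ler_norm M)) // lerDl //.
Qed.

Section Complete.
Variable V : completeNormedModType C.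

Lemma cauchy_seq_cvg (u : nat -> V) :
  (forall e : R, 0 < e -> exists N, forall n m, (N <= n)%N -> (N <= m)%N ->
     rnorm (u n - u m) <= e) ->
  exists l, forall e : R, 0 < e -> exists N, forall n, (N <= n)%N -> rnorm (u n - l) <= e.
Proof.
move=> h.
have /cauchy_cvgP /= c : cauchy (u @ \oo).
  apply/cauchy_ballP => e e0.
  have e1 : 0 < complex.Re e by move: e0; rewrite ltcE => /andP[].
  have e2 : e = cR (complex.Re e) by rewrite RRe_real // gtr0_real.
  have e3 : 0 < complex.Re e / 2 by rewrite divr_gt0.
  have [N hN] := h _ e3.
  exists (u @` [set n | (N <= n)%N], u @` [set n | (N <= n)%N]); first split.
  - by exists N => // n Nn; exists n.
  - by exists N => // n Nn; exists n.
  - move=> [x y] /= [[n Nn <-] [m Nm <-]].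
    rewrite -ball_normE /ball_ /= rnormE e2 ltcR.
    by apply: le_lt_trans (hN n m Nn Nm) _; rewrite ltr_pdivrMr // ltr_pMr // ltr1n.
exists (lim (u @ \oo)) => e e0.
have e1 : 0 < cR e by rewrite ltcR.
have /cvgrPdist_le /(_ _ e1) /near_inftyP [N hN] := c.
exists N => n /hN; rewrite rnormE lecR => h'; by rewrite rnormBC.
Qed.
End Complete.

(** The limit is formed pointwise by completeness of the space; the Cauchy estimate, uniform in [x],
    survives letting the second index grow. *)
Lemma op_cauchy_cvg (H : hilbertType R) (A : nat -> H -> H) :
  (forall e : R, 0 < e -> exists N, forall n m, (N <= n)%N -> (N <= m)%N ->
     forall x, rnorm (A n x - A m x) <= e * rnorm x) ->
  exists B, op_cvg \oo A B.
Proof.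
move=> h.
have ex x : exists l, forall e : R, 0 < e -> exists N, forall n, (N <= n)%N ->
    rnorm (A n x - l) <= e.
  apply: cauchy_seq_cvg => e e0.
  have x1 : 0 < rnorm x + 1 by rewrite ltr_wpDl ?rnorm_ge0.
  have [N hN] := h (e / (rnorm x + 1)) (divr_gt0 e0 x1).
  exists N => n m Nn Nm; apply: le_trans (hN n m Nn Nm x) _.
  by rewrite mulrAC ler_pdivrMr // ler_wpM2l ?lerDl // ltW.
have [B hB] := choice ex.
exists B; apply/op_cvgP => e e0; have [N hN] := h e e0.
exists N => n Nn x; apply: (@le_eps _ _ 1) => e' e'0; rewrite mulr1.
have [N' hN'] := hB x e' e'0.
apply: le_trans (rnorm_trans (A (maxn N N') x) _ _) _.
by apply: lerD; [apply: hN => //; exact: leq_maxl|apply: hN'; exact: leq_maxr].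
Qed.

Lemma op_cvg_unique_le (H : hilbertType R) (A : nat -> H -> H) B D M x : op_cvg \oo A B ->
  (forall n, exists2 m, (n <= m)%N & rnorm (A m x - D) <= M) -> rnorm (B x - D) <= M.
Proof.
move=> /op_cvgP AB h; apply: (@le_eps _ _ (rnorm x)) => e e0.
have [N hN] := AB e e0; have [m Nm hm] := h N.
apply: le_trans (rnorm_trans (A m x) _ _) _; rewrite addrC.
by apply: lerD => //; rewrite rnormBC; exact: hN.
Qed.
End OperatorLimits.

Section SimpleFunctions.
Context {R : realType} {d : measure_display} {X : measurableType d}.
Local Notation C := (complex R).
Implicit Type s : seq (C * set X).

Definition simple_scale (a : C) s := [seq (a * c.1, c.2) | c <- s].
Definition simple_mul s s' := [seq (c.1 * c'.1, c.2 `&` c'.2) | c <- s, c' <- s'].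

Lemma simple_fun_cat s s' z : simple_fun (s ++ s') z = simple_fun s z + simple_fun s' z.
Proof. by rewrite /simple_fun big_cat. Qed.

Lemma simple_fun_scale a s z : simple_fun (simple_scale a s) z = a * simple_fun s z.
Proof. by rewrite /simple_fun big_map mulr_sumr; apply: eq_bigr => c _; rewrite mulrA. Qed.

Lemma simple_fun_mul s s' z : simple_fun (simple_mul s s') z = simple_fun s z * simple_fun s' z.
Proof.
rewrite /simple_fun big_allpairs_dep mulr_suml; apply: eq_bigr => c _.
rewrite mulr_sumr; apply: eq_bigr => c' _ /=.
by rewrite indicI /= mulrACA.
Qed.

Lemma measurable_coeffs_cat s s' : measurable_coeffs s -> measurable_coeffs s' ->
  measurable_coeffs (s ++ s').
Proof. by move=> h h' c; rewrite mem_cat => /orP[/h|/h']. Qed.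

Lemma measurable_coeffs_scale a s : measurable_coeffs s -> measurable_coeffs (simple_scale a s).
Proof. by move=> h c /mapP[c' /h ? ->]. Qed.

Lemma measurable_coeffs_mul s s' : measurable_coeffs s -> measurable_coeffs s' ->
  measurable_coeffs (simple_mul s s').
Proof. by move=> h h' c /allpairsP[[c1 c2] /= [/h m1 /h' m2 ->]]; exact: measurableI. Qed.

Section Integral.
Variables (H : hilbertType R) (E : set X -> H -> H).

Lemma simple_int_cat s s' x : simple_int E (s ++ s') x = simple_int E s x + simple_int E s' x.
Proof. by rewrite /simple_int big_cat. Qed.

Lemma simple_int_scale a s x : simple_int E (simple_scale a s) x = a *: simple_int E s x.
Proof. by rewrite /simple_int big_map scaler_sumr; apply: eq_bigr => c _; rewrite scalerA. Qed.

Lemma simple_int_linear s : (forall D, measurable D -> linear (E D)) ->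
  measurable_coeffs s -> linear (simple_int E s).
Proof.
move=> lE ms a x y; rewrite /simple_int scaler_sumr -big_split.
rewrite big_seq [RHS]big_seq; apply: eq_bigr => c /ms mc /=.
by rewrite lE // scalerDr !scalerA mulrC.
Qed.
End Integral.
End SimpleFunctions.

(** * Integrals with respect to a spectral measure *)

Section SpectralIntegral.
Context {R : realType} {d : measure_display} {X : measurableType d}.
Local Notation C := (complex R).
Local Notation normc := (@Normc.normc R).
Variable (K : hilbertType R) (E : set X -> K -> K).
Hypothesis sE : spectral_measure E.
Implicit Type s : seq (C * set X).

Lemma simple_int_mul s s' x : measurable_coeffs s -> measurable_coeffs s' ->
  simple_int E (simple_mul s s') x = simple_int E s (simple_int E s' x).
Proof.
move=> ms ms'; rewrite /simple_int big_allpairs_dep [LHS]big_seq [RHS]big_seq.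
apply: eq_bigr => c /ms mc.
rewrite (linear_lincomb (spectral_linear sE mc)).
rewrite scaler_sumr [LHS]big_seq [RHS]big_seq; apply: eq_bigr => c' /ms' mc'.
by rewrite scalerA (spectralI sE).
Qed.

Lemma simple_int_dist s s' e x : measurable_coeffs s -> measurable_coeffs s' ->
  (forall z, normc (simple_fun s z - simple_fun s' z) <= e) ->
  rnorm (simple_int E s x - simple_int E s' x) <= e * rnorm x.
Proof.
move=> ms ms' h; rewrite -scaleN1r -simple_int_scale -simple_int_cat.
apply: (simple_int_bound sE) => [|z].
  by apply: measurable_coeffs_cat => //; exact: measurable_coeffs_scale.
by rewrite simple_fun_cat simple_fun_scale mulN1r.
Qed.

Lemma spectral_intP (f : X -> C) B : spectral_int E f B ->
  exists s : nat -> seq (C * set X), [/\ forall n, measurable_coeffs (s n),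
    forall e : R, 0 < e -> exists N, forall n, (N <= n)%N ->
      forall z, normc (simple_fun (s n) z - f z) <= e & op_cvg \oo (fun n => simple_int E (s n)) B].
Proof.
move=> [s [ms sf sB]]; exists s; split => // e e0.
have /near_inftyP [N hN] := sf e e0; exists N => n /hN h z.
by have := h z; rewrite normcE lecR.
Qed.

Lemma spectral_intI (f : X -> C) B (s : nat -> seq (C * set X)) :
  (forall n, measurable_coeffs (s n)) ->
  (forall e : R, 0 < e -> exists N, forall n, (N <= n)%N ->
      forall z, normc (simple_fun (s n) z - f z) <= e) ->
  op_cvg \oo (fun n => simple_int E (s n)) B -> spectral_int E f B.
Proof.
move=> ms sf sB; exists s; split => // e e0.
have [N hN] := sf e e0; apply/near_inftyP; exists N => n /hN h z.
by rewrite normcE lecR.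
Qed.

(** Every simple function near [f] may serve, not only those of the sequence hidden in
    [spectral_int]; hence the integral does not depend on that sequence. *)
Lemma spectral_int_dist f B s e x : spectral_int E f B -> measurable_coeffs s ->
  (forall z, normc (simple_fun s z - f z) <= e) ->
  rnorm (simple_int E s x - B x) <= e * rnorm x.
Proof.
move=> /spectral_intP [t [mt tf tB]] ms h.
apply: (@le_eps _ _ _ (rnorm x)) => e' e'0; rewrite -mulrDl.
rewrite rnormBC; apply: (op_cvg_unique_le tB) => n.
have [N hN] := tf e' e'0; exists (maxn n N); first exact: leq_maxl.
apply: simple_int_dist => // z.
have -> : simple_fun (t (maxn n N)) z - simple_fun s z =
  - (simple_fun s z - f z) + (simple_fun (t (maxn n N)) z - f z) by ring.
by apply: le_trans (le_normcD _ _) (lerD _ (hN _ (leq_maxr _ _) z)); rewrite normcN.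
Qed.

Lemma spectral_int_bound f B M x : spectral_int E f B ->
  (forall z, normc (f z) <= M) -> rnorm (B x) <= M * rnorm x.
Proof.
move=> fB h.
(* The empty list represents the simple function $0$, at distance at most [M] from [f]. *)
have := @spectral_int_dist f B [::] M x fB; rewrite /simple_int big_nil sub0r rnormN.
apply => // z; rewrite /simple_fun big_nil sub0r normcN; exact: h.
Qed.

Lemma spectral_int1 : spectral_int E (fun=> 1) id.
Proof.
have e1 x : simple_int E [:: (1, setT)] x = x.
  by rewrite /simple_int big_seq1 scale1r (spectral_setT sE).
apply: (@spectral_intI _ _ (fun=> [:: (1, setT)])).
- by move=> n c; rewrite inE => /eqP ->; exact: measurableT.
- move=> e e0; exists 0%N => n _ z.
  by rewrite /simple_fun big_seq1 /= indicT mulr1 subrr Normc.normc0 ltW.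
- by apply/op_cvgP => e e0; exists 0%N => n _ x; rewrite e1 subrr rnorm0 mulr_ge0 ?rnorm_ge0 // ltW.
Qed.

Lemma spectral_intD f g B D : spectral_int E f B -> spectral_int E g D ->
  spectral_int E (fun z => f z + g z) (fun x => B x + D x).
Proof.
move=> /spectral_intP [s [ms sf sB]] /spectral_intP [t [mt tf tB]].
apply: (@spectral_intI _ _ (fun n => s n ++ t n)).
- by move=> n; apply: measurable_coeffs_cat.
- move=> e e0; have e2 : 0 < e / 2 by rewrite divr_gt0.
  have [N hN] := sf _ e2; have [N' hN'] := tf _ e2.
  exists (maxn N N') => n; rewrite geq_max => /andP[h h'] z.
  rewrite simple_fun_cat opprD addrACA (splitr e).
  by apply: le_trans (le_normcD _ _) (lerD (hN _ h z) (hN' _ h' z)).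
- apply/op_cvgP => e e0; have e2 : 0 < e / 2 by rewrite divr_gt0.
  have [N hN] := (op_cvgP _ _).1 sB _ e2; have [N' hN'] := (op_cvgP _ _).1 tB _ e2.
  exists (maxn N N') => n; rewrite geq_max => /andP[h h'] x.
  rewrite simple_int_cat opprD addrACA (splitr e) mulrDl.
  by apply: le_trans (rnormD _ _) (lerD (hN _ h x) (hN' _ h' x)).
Qed.

Lemma spectral_intZ a f B : spectral_int E f B ->
  spectral_int E (fun z => a * f z) (fun x => a *: B x).
Proof.
move=> /spectral_intP [s [ms sf sB]].
have a1 : 0 < normc a + 1 by rewrite ltr_wpDl ?normc_ge0.
have small e : 0 < e -> normc a * (e / (normc a + 1)) <= e.
  by move=> e0; rewrite mulrCA ger_pMr // ler_pdivrMr // mul1r lerDl.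
apply: (@spectral_intI _ _ (fun n => simple_scale a (s n))).
- by move=> n; apply: measurable_coeffs_scale.
- move=> e e0; have [N hN] := sf _ (divr_gt0 e0 a1).
  exists N => n h z; rewrite simple_fun_scale -mulrBr Normc.normcM.
  by apply: le_trans (small e e0); rewrite ler_wpM2l ?normc_ge0 // hN.
- apply/op_cvgP => e e0; have [N hN] := (op_cvgP _ _).1 sB _ (divr_gt0 e0 a1).
  exists N => n h x; rewrite simple_int_scale -scalerBr rnormZ.
  apply: (@le_trans _ _ (normc a * (e / (normc a + 1)) * rnorm x)).
    by rewrite -mulrA ler_wpM2l ?normc_ge0 // hN.
  by rewrite ler_wpM2r ?rnorm_ge0 // small.
Qed.

Lemma spectral_intM f g B D M : (forall z, normc (f z) <= M) -> (forall z, normc (g z) <= M) ->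
  spectral_int E f B -> spectral_int E g D ->
  spectral_int E (fun z => f z * g z) (fun x => B (D x)).
Proof.
move=> fM gM fB gD; have M0 : 0 <= M by apply: le_trans (fM point); exact: normc_ge0.
have [s [ms sf sB]] := spectral_intP fB; have [t [mt tf tB]] := spectral_intP gD.
have M1 : 0 < M + 1 + M by rewrite -addrA ltr_wpDl // ltr_pwDl.
(* The cap at $1$ bounds the approximants of [f] by $M+1$; the error of the product is then at most
   $(M+1)e'+e'M$. *)
have small e : 0 < e -> exists e', [/\ 0 < e', e' <= 1 & (M + 1) * e' + e' * M <= e].
  move=> e0; exists (Num.min 1 (e / (M + 1 + M))).
  set q := Num.min _ _.
  have q0 : 0 < q by rewrite lt_min ltr01 divr_gt0.
  split=> //; first by rewrite ge_min lexx.
  by rewrite [q * M]mulrC -mulrDl mulrC -ler_pdivlMr // ge_min lexx orbT.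
apply: (@spectral_intI _ _ (fun n => simple_mul (s n) (t n))).
- by move=> n; apply: measurable_coeffs_mul.
- move=> e e0; have [e' [e'0 e'1 ee']] := small e e0.
  have [N hN] := sf _ e'0; have [N' hN'] := tf _ e'0.
  exists (maxn N N') => n; rewrite geq_max => /andP[h h'] z.
  rewrite simple_fun_mul; apply: le_trans ee'.
  have -> : simple_fun (s n) z * simple_fun (t n) z - f z * g z =
    simple_fun (s n) z * (simple_fun (t n) z - g z) + (simple_fun (s n) z - f z) * g z by ring.
  apply: le_trans (le_normcD _ _) _; rewrite !Normc.normcM; apply: lerD.
    apply: ler_pM; rewrite ?normc_ge0 //; last exact: hN'.
    rewrite -[simple_fun _ _](subrK (f z)) addrC.
    by apply: le_trans (le_normcD _ _) (lerD (fM z) (le_trans (hN _ h z) e'1)).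
  by apply: ler_pM; rewrite ?normc_ge0 // hN.
- apply/op_cvgP => e e0; have [e' [e'0 e'1 ee']] := small e e0.
  have [N hN] := (op_cvgP _ _).1 tB _ e'0; have [N' hN'] := (op_cvgP _ _).1 sB _ e'0.
  have [N2 hN2] := sf _ ltr01.
  exists (maxn (maxn N N') N2) => n; rewrite !geq_max => /andP[/andP[h h'] h2] x.
  rewrite simple_int_mul //.
  apply: le_trans (rnorm_trans (simple_int E (s n) (D x)) _ _) _.
  apply: (@le_trans _ _ (((M + 1) * e' + e' * M) * rnorm x)); last first.
    by rewrite ler_wpM2r ?rnorm_ge0.
  rewrite mulrDl -!mulrA; apply: lerD.
    have lin := simple_int_linear (spectral_linear sE) (ms n).
    rewrite -(linear_funB lin).
    apply: (@le_trans _ _ ((M + 1) * rnorm (simple_int E (t n) x - D x))).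
      apply: (simple_int_bound sE) => // z.
      rewrite -[simple_fun _ _](subrK (f z)) addrC.
      by apply: le_trans (le_normcD _ _) (lerD (fM z) (hN2 _ h2 z)).
    by rewrite ler_wpM2l ?hN // addr_ge0.
  apply: le_trans (hN' n h' (D x)) _.
  by rewrite ler_wpM2l ?(ltW e'0) //; apply: (spectral_int_bound _ gD gM).
Qed.

Lemma eq_spectral_int f g B D : f =1 g -> B =1 D -> spectral_int E f B -> spectral_int E g D.
Proof. by move=> /funext -> /funext ->. Qed.

Lemma spectral_int_poly f U (p : {poly C}) : (forall z, normc (f z) <= 1) ->
  spectral_int E f U -> spectral_int E (fun z => p.[f z]) (opoly p U).
Proof.
move=> f1 fU.
have pow n : spectral_int E (fun z => f z ^+ n) (iter n U).
  elim: n => [|n IH]; first exact: spectral_int1.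
  apply: (@eq_spectral_int (fun z => f z * f z ^+ n) _ (fun x => U (iter n U x))) => //.
    by move=> z; rewrite exprS.
  apply: (@spectral_intM _ _ _ _ 1) => // z.
  by rewrite normcX exprn_ile1 ?normc_ge0.
have sum n : spectral_int E (fun z => \sum_(i < n) p`_i * f z ^+ i)
     (fun x => \sum_(i < n) p`_i *: iter i U x).
  elim: n => [|n IH].
    apply: (@eq_spectral_int (fun z => 0 * 1) _ (fun x => 0 *: x)).
    - by move=> z; rewrite big_ord0 mul0r.
    - by move=> x; rewrite big_ord0 scale0r.
    - by apply: spectral_intZ; exact: spectral_int1.
  have := spectral_intD IH (spectral_intZ p`_n (pow n)); apply: eq_spectral_int => z.
    by rewrite big_ord_recr.
  by rewrite big_ord_recr.
by apply: eq_spectral_int (sum (size p)) => z //; rewrite horner_coef.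
Qed.
End SpectralIntegral.

(** * Semi-spectral measures of a contraction *)

Section SemiSpectralCalculus.
Variable R : realType.
Local Notation C := (complex R).
Local Notation normc := (@Normc.normc R).
Local Notation circle := (circle R).
Variables (H : hilbertType R) (A : H -> H) (EE : set circle -> H -> H).
Hypothesis hA : semi_spectral_of A EE.

Lemma normc_circle (z : circle) : normc (val z) = 1.
Proof. by apply/normc_eq1/eqP/(valP z). Qed.

Lemma circle_exists (z : C) : normc z = 1 -> exists w : circle, val w = z.
Proof.
move=> z1; have h : `|z| == 1 by apply/eqP/normc_eq1.
by exists (exist _ z h).
Qed.

Lemma semi_spectral_linear D : measurable D -> linear (EE D).
Proof.
move=> mD; have [K [V [U [E [[eV _ _] [sE _] cE]]]]] := hA.
exact: (compression_linear eV (spectral_linear sE mD) (cE D mD)).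
Qed.

Lemma semi_spectral_bound s M x : measurable_coeffs s ->
  (forall z, normc (simple_fun s z) <= M) -> rnorm (simple_int EE s x) <= M * rnorm x.
Proof.
move=> ms sM; have [K [V [U [E [[eV _ _] [sE _] cE]]]]] := hA.
have cs : compression V (simple_int E s) (simple_int EE s).
  by apply: compression_sum => // c /ms; exact: cE.
apply: le_trans (compression_rnorm eV x cs) _; rewrite -(rnorm_embedding eV).
exact: simple_int_bound.
Qed.

(** [opoly p A] is the compression of [opoly p U] for the unitary dilation in [hA], and the latter
    is the spectral integral of [p] over the circle. *)
Lemma von_neumann (p : {poly C}) M x : (forall z, normc z = 1 -> normc p.[z] <= M) ->
  rnorm (opoly p A x) <= M * rnorm x.
Proof.
move=> pM; have [K [V [U [E [[eV _ cU] [sE EU] cE]]]]] := hA.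
have cp : compression V (opoly p U) (opoly p A).
  by apply: compression_sum => // i _; exact: cU.
apply: le_trans (compression_rnorm eV x cp) _; rewrite -(rnorm_embedding eV).
have pE : spectral_int E (fun z => p.[val z]) (opoly p U).
  by apply: spectral_int_poly => // z; rewrite normc_circle.
apply: (spectral_int_bound sE _ pE) => z.
by rewrite pM // normc_circle.
Qed.

(** For a uniform limit [f] of simple functions this pins down the integral through [EE] alone,
    whereas [semi_spectral_int] refers to an existentially quantified dilation. *)
Definition int_approx (f : circle -> C) (B : H -> H) := forall s e, measurable_coeffs s ->
  (forall z, normc (simple_fun s z - f z) <= e) ->
  forall x, rnorm (simple_int EE s x - B x) <= e * rnorm x.

Lemma int_approx_poly (p : {poly C}) : int_approx (fun z => p.[val z]) (opoly p A).
Proof.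
move=> s e ms sp x; have [K [V [U [E [[eV _ cU] [sE EU] cE]]]]] := hA.
have cs : compression V (simple_int E s) (simple_int EE s).
  by apply: compression_sum => // c /ms; exact: cE.
have cp : compression V (opoly p U) (opoly p A).
  by apply: compression_sum => // i _; exact: cU.
apply: le_trans (compression_rnorm eV x (compressionB eV cs cp)) _.
rewrite -(rnorm_embedding eV).
have pE : spectral_int E (fun z => p.[val z]) (opoly p U).
  by apply: spectral_int_poly => // z; rewrite normc_circle.
exact: (spectral_int_dist sE _ pE ms sp).
Qed.

(** A sample point need not lie in its cell: [mesh_le] compares it with the points of the cell, so
    an empty cell may carry any sample. *)
Record circle_partition := CirclePartition {
  cell : finType;
  cell_of : circle -> cell;
  sample : cell -> circle;
  measurable_cell : forall i, measurable [set z | cell_of z = i] }.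

Definition mesh_le (P : circle_partition) (delta : R) :=
  forall z, normc (val z - val (sample (cell_of P z))) <= delta.

(** The partition comes from the spectral measure of the dilation: a simple function within
    $\delta/2$ of [val] is constant on its atoms, so two points of one atom differ by at most
    $\delta$. *)
Lemma fine_partition_exists delta : 0 < delta -> exists P, mesh_le P delta.
Proof.
move=> d0; have [K [V [U [E [_ [sE /spectral_intP [s [ms sf _]]] _]]]]] := hA.
have d2 : 0 < delta / 2 by rewrite divr_gt0.
have [N hN] := sf _ d2.
have hd := hN N (leqnn N); set t := s N in hd; have mt := ms N.
pose sam (b : {ffun 'I_(size t) -> bool}) : circle :=
  if pselect (exists z, atom t z = b) is left h then projT1 (cid h) else point.
exists (@CirclePartition _ (atom t) sam (measurable_atom mt)) => z /=.
have e : atom t (sam (atom t z)) = atom t z.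
  rewrite /sam; case: pselect => [h|[]]; last by exists z.
  exact: (projT2 (cid h)).
have e2 : simple_fun t (sam (atom t z)) = simple_fun t z.
  by rewrite !simple_fun_atom e.
have -> : val z - val (sam (atom t z)) =
   (simple_fun t (sam (atom t z)) - val (sam (atom t z))) - (simple_fun t z - val z).
  by rewrite e2; ring.
by rewrite (splitr delta) (le_trans (le_normcD _ _)) // normcN lerD.
Qed.

Section PartitionSums.
Variable P : circle_partition.

Definition sampled (f : circle -> C) : seq (C * set circle) :=
  [seq (f (sample i), [set z | cell_of P z = i]) | i <- index_enum (cell P)].

Lemma measurable_sampled f : measurable_coeffs (sampled f).
Proof. by move=> c /mapP[i _ ->]; exact: measurable_cell. Qed.

Lemma simple_fun_sampled f z : simple_fun (sampled f) z = f (sample (cell_of P z)).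
Proof.
rewrite /simple_fun /sampled big_map (bigD1 (cell_of P z)) //= indicE mem_set // mulr1.
rewrite big1 ?addr0 // => i iz; rewrite indicE memNset ?mulr0 // => /= e.
by move: iz; rewrite e eqxx.
Qed.

Lemma simple_int_sampled (E : set circle -> H -> H) f x : simple_int E (sampled f) x =
  \sum_(i : cell P) f (sample i) *: E [set z | cell_of P z = i] x.
Proof. by rewrite /simple_int /sampled big_map. Qed.
End PartitionSums.

Definition circle_unif_continuous (f : circle -> C) := forall e : R, 0 < e ->
  exists2 delta : R, 0 < delta & forall z w : circle,
    normc (val z - val w) <= delta -> normc (f z - f w) <= e.

(** Simple functions sampled on fine partitions converge uniformly to [f]. Their integrals converge
    on the dilation space by the spectral bound and on [H] by compression, and the limits are again
    related by compression. *)
Lemma semi_spectral_int_exists f : circle_unif_continuous f ->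
  exists B, semi_spectral_int EE f B /\ int_approx f B.
Proof.
move=> cf.
have ex n : exists s : seq (C * set circle), measurable_coeffs s /\
    forall z, normc (simple_fun s z - f z) <= n.+1%:R^-1.
  have [|delta d0 hd] := cf n.+1%:R^-1; first by rewrite invr_gt0.
  have [P hP] := fine_partition_exists d0.
  exists (sampled P f); split; first exact: measurable_sampled.
  by move=> z; rewrite simple_fun_sampled -normcN opprB; apply: hd; exact: hP.
have [s hs] := choice ex.
have ms n : measurable_coeffs (s n) by have [] := hs n.
have small (e : R) : 0 < e -> exists N, forall n, (N <= n)%N -> n.+1%:R^-1 <= e :> R.
  move=> e0; exists (Num.truncn e^-1) => n hn.
  rewrite invf_ple ?posrE //; apply: ltW; apply: lt_le_trans (truncnS_gt _) _.
  by rewrite ler_nat.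
have sf e : 0 < e -> exists N, forall n, (N <= n)%N -> forall z, normc (simple_fun (s n) z - f z) <= e.
  move=> /small [N hN]; exists N => n /hN h z.
  by apply: le_trans h; have [_] := hs n.
have cau e : 0 < e -> exists N, forall n m, (N <= n)%N -> (N <= m)%N ->
    forall z, normc (simple_fun (s n) z - simple_fun (s m) z) <= e.
  move=> e0; have e2 : 0 < e / 2 by rewrite divr_gt0.
  have [N hN] := sf _ e2; exists N => n m hn hm z.
  have -> : simple_fun (s n) z - simple_fun (s m) z =
   (simple_fun (s n) z - f z) - (simple_fun (s m) z - f z) by ring.
  by rewrite (splitr e) (le_trans (le_normcD _ _)) // normcN lerD ?hN.
have [K [V [U [E [[eV uU cU] [sE EU] cE]]]]] := hA.
have cs t : measurable_coeffs t -> compression V (simple_int E t) (simple_int EE t).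
  by move=> mt; apply: compression_sum => // c /mt; exact: cE.
have [B hB] : exists B, op_cvg \oo (fun n => simple_int E (s n)) B.
  apply: op_cauchy_cvg => e /cau [N hN]; exists N => n m hn hm x.
  by apply: simple_int_dist => //; exact: hN.
have [B' hB'] : exists B, op_cvg \oo (fun n => simple_int EE (s n)) B.
  apply: op_cauchy_cvg => e /cau [N hN]; exists N => n m hn hm x.
  apply: le_trans (compression_rnorm eV x (compressionB eV (cs _ (ms n)) (cs _ (ms m)))) _.
  by rewrite -(rnorm_embedding eV); apply: simple_int_dist => //; exact: hN.
have fE : spectral_int E f B by apply: spectral_intI hB.
(* The inner products that define a compression pass to the limit by Cauchy-Schwarz, with two errors
   of at most [e * rnorm x * rnorm y]. *)
have cB : compression V B B'.
  move=> x y; apply: Normc.eq0_normc; apply/eqP; rewrite eq_le normc_ge0 andbT.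
  apply: (@le_eps _ _ _ (2 * rnorm x * rnorm y)) => e e0; rewrite add0r.
  have [N hN] := (op_cvgP _ _).1 hB e e0; have [N' hN'] := (op_cvgP _ _).1 hB' e e0.
  set n := maxn N N'; have {}hN := hN n (leq_maxl _ _); have {}hN' := hN' n (leq_maxr _ _).
  have := cs _ (ms n) x y; rewrite !innerBl !embedding_inner // => /eqP.
  rewrite subr_eq0 => /eqP hn.
  have -> : inner (B (V x)) (V y) - inner (B' x) y =
     - inner (simple_int E (s n) (V x) - B (V x)) (V y) + inner (simple_int EE (s n) x - B' x) y.
    by rewrite !innerBl hn; ring.
  apply: le_trans (le_normcD _ _) _; rewrite normcN.
  apply: (@le_trans _ _ (e * rnorm x * rnorm y + e * rnorm x * rnorm y)); last first.
    by rewrite le_eqVlt; apply/orP; left; apply/eqP; ring.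
  apply: lerD; apply: le_trans (cauchy_schwarz _ _) _.
    by rewrite (rnorm_embedding eV) -(rnorm_embedding eV x) ler_wpM2r ?rnorm_ge0.
  by rewrite ler_wpM2r ?rnorm_ge0.
exists B'; split.
  by exists K, V, E, B; split=> //; split.
move=> t e mt ht x.
apply: le_trans (compression_rnorm eV x (compressionB eV (cs _ mt) cB)) _.
by rewrite -(rnorm_embedding eV); exact: (spectral_int_dist sE _ fE mt ht).
Qed.

Lemma int_approx_bound f B M x : int_approx f B ->
  (forall z, normc (f z) <= M) -> rnorm (B x) <= M * rnorm x.
Proof.
move=> fB fM; have ms : @measurable_coeffs R _ circle [::] by [].
have hf z : normc (simple_fun [::] z - f z) <= M by rewrite /simple_fun big_nil sub0r normcN.
by have := fB _ _ ms hf x; rewrite /simple_int big_nil sub0r rnormN.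
Qed.

Lemma int_approx_sampled f B e : circle_unif_continuous f -> int_approx f B -> 0 < e ->
  exists2 delta, 0 < delta & forall P, mesh_le P delta ->
    forall x, rnorm (simple_int EE (sampled P f) x - B x) <= e * rnorm x.
Proof.
move=> cf fB e0; have [delta d0 hd] := cf e e0; exists delta => // P hP x.
apply: fB; first exact: measurable_sampled.
by move=> z; rewrite simple_fun_sampled -normcN opprB; apply: hd; exact: hP.
Qed.

End SemiSpectralCalculus.

(** * Double operator integrals *)

Section Independence.
Variable R : realType.
Local Notation C := (complex R).
Local Notation normc := (@Normc.normc R).
Local Notation circle := (circle R).
Variables (H : hilbertType R) (A : H -> H) (EE : set circle -> H -> H).
Hypothesis hA : semi_spectral_of A EE.
Variables (Q : H -> H) (q : R).
Hypotheses (lQ : linear Q) (bQ : forall x, rnorm (Q x) <= q * rnorm x) (q0 : 0 <= q).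

Definition sandwich (F G : nat -> H -> H) (n : nat) (x : H) : H :=
  \sum_(0 <= k < n) F k (Q (G k x)).

Definition partition_sum (P : circle_partition R) (f g : nat -> circle -> C) n x : H :=
  sandwich (fun k => simple_int EE (sampled P (f k)))
           (fun k => simple_int EE (sampled P (g k))) n x.

(** The data by which two representations are compared: values on the circle, majorants of the
    factors with small tails, and pointwise convergence to the kernel. *)
Record circle_rep (Phi : circle -> circle -> C) (f g : nat -> circle -> C)
    (a b : nat -> R) : Prop := CircleRep {
  rep_ucl : forall k, circle_unif_continuous (f k);
  rep_ucr : forall k, circle_unif_continuous (g k);
  rep_lel : forall k z, normc (f k z) <= a k;
  rep_ler : forall k z, normc (g k z) <= b k;
  rep_tail : forall e : R, 0 < e -> exists N, forall n, (N <= n)%N ->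
    \sum_(N <= k < n) a k * b k <= e;
  rep_cvg : forall z w, forall e : R, 0 < e -> exists N, forall n, (N <= n)%N ->
    normc (\sum_(0 <= k < n) f k z * g k w - Phi z w) <= e }.

Lemma mesh_le_minl P (d d' : R) : mesh_le P (Num.min d d') -> mesh_le P d.
Proof. by move=> h z; apply: le_trans (h z) _; rewrite ge_min lexx. Qed.

Lemma mesh_le_minr P (d d' : R) : mesh_le P (Num.min d d') -> mesh_le P d'.
Proof. by move=> h z; apply: le_trans (h z) _; rewrite ge_min lexx orbT. Qed.

Section OneRep.
Variables (Phi : circle -> circle -> C) (f g : nat -> circle -> C) (a b : nat -> R).
Hypothesis rep : circle_rep Phi f g a b.
Variables (F G : nat -> H -> H).
Hypotheses (fF : forall k, int_approx EE (f k) (F k)) (gG : forall k, int_approx EE (g k) (G k)).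

Let a0 k : 0 <= a k. Proof. exact: le_trans (normc_ge0 _) (rep_lel rep k point). Qed.
Let b0 k : 0 <= b k. Proof. exact: le_trans (normc_ge0 _) (rep_ler rep k point). Qed.

Lemma sampled_bound P (h : circle -> C) M x : (forall z, normc (h z) <= M) ->
  rnorm (simple_int EE (sampled P h) x) <= M * rnorm x.
Proof.
move=> hM; apply: (semi_spectral_bound hA); first exact: measurable_sampled.
by move=> z; rewrite simple_fun_sampled.
Qed.

Lemma sampled_linear P (h : circle -> C) : linear (simple_int EE (sampled P h)).
Proof.
apply: simple_int_linear; first exact: (semi_spectral_linear hA).
exact: measurable_sampled.
Qed.

Lemma term_near_partition k e : 0 < e ->
  exists2 delta, 0 < delta & forall P, mesh_le P delta -> forall x,
    rnorm (F k (Q (G k x)) - simple_int EE (sampled P (f k)) (Q (simple_int EE (sampled P (g k)) x)))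
      <= e * rnorm x.
Proof.
(* An error in the left factor is multiplied by at most [q * b k], one in the right factor by at
   most [a k * q]; the summand $1$ keeps [M] positive. *)
move=> e0; pose M := q * (a k + b k) + 1.
have M0 : 0 < M by rewrite ltr_wpDl // mulr_ge0 // addr_ge0.
have e1 : 0 < e / M by rewrite divr_gt0.
have [d d0 hd] := int_approx_sampled (rep_ucl rep k) (@fF k) e1.
have [d' d'0 hd'] := int_approx_sampled (rep_ucr rep k) (@gG k) e1.
exists (Num.min d d'); first by rewrite lt_min d0.
move=> P hP x.
have {}hd := hd P (mesh_le_minl hP).
have {}hd' := hd' P (mesh_le_minr hP).
set Fp := simple_int EE (sampled P (f k)); set Gp := simple_int EE (sampled P (g k)).
have lFp : linear Fp := sampled_linear P (f k).
apply: le_trans (rnorm_trans (Fp (Q (G k x))) _ _) _.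
rewrite rnormBC -(linear_funB lFp) -(linear_funB lQ).
apply: (@le_trans _ _ (e / M * (q * (b k * rnorm x)) + a k * (q * (e / M * rnorm x)))).
  apply: lerD.
    apply: le_trans (hd _) _; rewrite ler_wpM2l ?(ltW e1) //.
    apply: le_trans (bQ _) _; rewrite ler_wpM2l //.
    exact: (int_approx_bound _ (@gG k) (rep_ler rep k)).
  apply: le_trans (sampled_bound P _ (rep_lel rep k)) _; rewrite ler_wpM2l //.
  apply: le_trans (bQ _) _; rewrite ler_wpM2l //.
  by rewrite rnormBC; exact: hd'.
have -> : e / M * (q * (b k * rnorm x)) + a k * (q * (e / M * rnorm x)) =
  e * (rnorm x * ((q * (a k + b k)) / M)) by ring.
rewrite ler_wpM2l ?(ltW e0) // ler_piMr ?rnorm_ge0 // ler_pdivrMr // mul1r.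
by rewrite /M lerDl.
Qed.

Lemma sum_near_partition n e : 0 < e ->
  exists2 delta, 0 < delta & forall P, mesh_le P delta -> forall x,
    rnorm (sandwich F G n x - partition_sum P f g n x) <= e * rnorm x.
Proof.
elim: n e => [|n IH] e e0.
  exists 1 => // P _ x; rewrite /partition_sum /sandwich !big_geq // subrr rnorm0.
  by rewrite mulr_ge0 ?rnorm_ge0 // ltW.
have e2 : 0 < e / 2 by rewrite divr_gt0.
have [d d0 hd] := IH _ e2; have [d' d'0 hd'] := term_near_partition n e2.
exists (Num.min d d'); first by rewrite lt_min d0.
move=> P hP x; rewrite /partition_sum /sandwich !big_nat_recr //= opprD addrACA.
rewrite (splitr e) mulrDl; apply: le_trans (rnormD _ _) _; apply: lerD.
  exact: hd _ (mesh_le_minl hP) x.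
exact: hd' _ (mesh_le_minr hP) x.
Qed.

(** The bound does not involve the mesh, so the number of terms may be raised after the partition
    has been fixed. *)
Lemma partition_sum_tail P n m eta x : (n <= m)%N -> \sum_(n <= k < m) a k * b k <= eta ->
  rnorm (partition_sum P f g n x - partition_sum P f g m x) <= q * eta * rnorm x.
Proof.
move=> nm h; rewrite rnormBC /partition_sum /sandwich (big_cat_nat (leq0n n) nm) //=.
rewrite addrAC subrr add0r; apply: le_trans (rnorm_sum _ _ _) _.
apply: (@le_trans _ _ (\sum_(n <= k < m) q * (a k * b k) * rnorm x)).
  apply: ler_sum => k _; apply: le_trans (sampled_bound P _ (rep_lel rep k)) _.
  apply: (@le_trans _ _ (a k * (q * (b k * rnorm x)))).
    rewrite ler_wpM2l //; apply: le_trans (bQ _) _; rewrite ler_wpM2l //.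
    exact: sampled_bound (rep_ler rep k).
  by rewrite le_eqVlt; apply/orP; left; apply/eqP; ring.
by rewrite -mulr_suml -mulr_sumr ler_wpM2r ?rnorm_ge0 // ler_wpM2l.
Qed.

Lemma partition_sumE P n x : partition_sum P f g n x =
  \sum_(i : cell P) \sum_(j : cell P)
     (\sum_(0 <= k < n) f k (sample i) * g k (sample j)) *:
        EE [set z | cell_of P z = i] (Q (EE [set z | cell_of P z = j] x)).
Proof.
have lE i : linear (EE [set z | cell_of P z = i]).
  by apply: (semi_spectral_linear hA); exact: measurable_cell.
rewrite /partition_sum /sandwich.
transitivity (\sum_(0 <= k < n) \sum_(i : cell P) \sum_(j : cell P)
   (f k (sample i) * g k (sample j)) *:
        EE [set z | cell_of P z = i] (Q (EE [set z | cell_of P z = j] x))).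
  apply: eq_bigr => k _; rewrite simple_int_sampled; apply: eq_bigr => i _.
  rewrite simple_int_sampled (linear_lincomb lQ) (linear_lincomb (lE i)) scaler_sumr; apply: eq_bigr => j _.
  by rewrite scalerA.
rewrite exchange_big /=; apply: eq_bigr => i _.
rewrite exchange_big /=; apply: eq_bigr => j _.
by rewrite scaler_suml.
Qed.
End OneRep.

Section TwoReps.
Variables (Phi : circle -> circle -> C) (f g f' g' : nat -> circle -> C) (a b a' b' : nat -> R).
Hypotheses (rep : circle_rep Phi f g a b) (rep' : circle_rep Phi f' g' a' b').

(** For a fixed partition only finitely many pairs of sample points occur, so pointwise convergence
    of both series to the same kernel suffices, with the number of pairs as a crude factor. *)
Lemma partition_sum_close P e : 0 < e -> exists N, forall n, (N <= n)%N -> forall x,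
  rnorm (partition_sum P f g n x - partition_sum P f' g' n x) <= e * rnorm x.
Proof.
move=> e0; pose M := (\sum_(i : cell P) \sum_(j : cell P) 1) * q + 1.
have s0 : 0 <= (\sum_(i : cell P) \sum_(j : cell P) 1 : R).
  by apply: sumr_ge0 => i _; apply: sumr_ge0.
have M0 : 0 < M by rewrite ltr_wpDl // mulr_ge0.
have e1 : 0 < e / M / 2 by rewrite !divr_gt0.
have ex (ij : cell P * cell P) : exists N, forall n, (N <= n)%N ->
   normc (\sum_(0 <= k < n) f k (sample ij.1) * g k (sample ij.2) -
          \sum_(0 <= k < n) f' k (sample ij.1) * g' k (sample ij.2)) <= e / M.
  have [N hN] := rep_cvg rep (sample ij.1) (sample ij.2) e1.
  have [N' hN'] := rep_cvg rep' (sample ij.1) (sample ij.2) e1.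
  exists (maxn N N') => n; rewrite geq_max => /andP[h h'].
  set s1 := \sum_(0 <= k < n) f _ _ * _; set s2 := \sum_(0 <= k < n) f' _ _ * _.
  have -> : s1 - s2 = (s1 - Phi (sample ij.1) (sample ij.2)) - (s2 - Phi (sample ij.1) (sample ij.2)).
    by ring.
  by rewrite (splitr (e / M)) (le_trans (le_normcD _ _)) // normcN lerD ?hN ?hN'.
have [N hN] := choice ex.
exists (\max_ij N ij)%N => n hn x.
rewrite !partition_sumE // -sumrB; apply: le_trans (rnorm_sum _ _ _) _.
apply: (@le_trans _ _ (\sum_(i : cell P) \sum_(j : cell P) e / M * (q * rnorm x))).
  apply: ler_sum => i _; rewrite -sumrB; apply: le_trans (rnorm_sum _ _ _) _.
  apply: ler_sum => j _; rewrite -scalerBl rnormZ; apply: ler_pM; rewrite ?normc_ge0 ?rnorm_ge0 //.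
    by apply: (hN (i, j)); apply: leq_trans hn; exact: leq_bigmax.
  have E1 l y : rnorm (EE [set z | cell_of P z = l] y) <= rnorm y.
    have -> : EE [set z | cell_of P z = l] y = simple_int EE [:: (1, [set z | cell_of P z = l])] y.
      by rewrite /simple_int big_seq1 scale1r.
    rewrite -[leRHS]mul1r; apply: (semi_spectral_bound hA).
      by move=> c; rewrite inE => /eqP ->; exact: measurable_cell.
    move=> z; rewrite /simple_fun big_seq1 /= indicE mul1r.
    by case: (_ \in _); rewrite ?Normc.normc1 ?Normc.normc0.
  by apply: le_trans (E1 _ _) _; apply: le_trans (bQ _) _; rewrite ler_wpM2l.
under eq_bigr => i _ do under eq_bigr => j _ do rewrite -[e / M * _]mul1r.
under eq_bigr => i _ do rewrite -mulr_suml.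
rewrite -mulr_suml.
have -> : (\sum_(i : cell P) \sum_(j : cell P) 1) * (e / M * (q * rnorm x)) =
  e * (rnorm x * (((\sum_(i : cell P) \sum_(j : cell P) 1) * q) / M)) by ring.
rewrite ler_wpM2l ?(ltW e0) // ler_piMr ?rnorm_ge0 // ler_pdivrMr // mul1r.
by rewrite /M lerDl.
Qed.

Variables (F G F' G' : nat -> H -> H).
Hypotheses (fF : forall k, int_approx EE (f k) (F k)) (gG : forall k, int_approx EE (g k) (G k)).
Hypotheses (fF' : forall k, int_approx EE (f' k) (F' k)) (gG' : forall k, int_approx EE (g' k) (G' k)).

(* The sums for both representations are compared with the sums over a fine
   partition, which depend on the representation only through the values of
   the kernel at the sample points. *)
Lemma sandwich_close n eta x :
  (forall m, (n <= m)%N -> \sum_(n <= k < m) a k * b k <= eta) ->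
  (forall m, (n <= m)%N -> \sum_(n <= k < m) a' k * b' k <= eta) ->
  rnorm (sandwich F G n x - sandwich F' G' n x) <= 2 * q * eta * rnorm x.
Proof.
(* Six sums are chained: each sandwich to its partition sum with [n] terms, that one to [m] terms,
   and the two with [m] terms to each other. This costs three errors [e] and two tails [q * eta];
   [m] is chosen after [P]. *)
move=> h h'; apply: (@le_eps _ _ _ (3 * rnorm x)) => e e0.
have [d d0 hd] := sum_near_partition rep fF gG n e0.
have [d' d'0 hd'] := sum_near_partition rep' fF' gG' n e0.
have m0 : 0 < Num.min d d' by rewrite lt_min d0.
have [P hP] := fine_partition_exists hA m0.
have {}hd := hd P (mesh_le_minl hP).
have {}hd' := hd' P (mesh_le_minr hP).
have [N hN] := partition_sum_close P e0.
pose m := maxn n N; have nm : (n <= m)%N := leq_maxl _ _.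
apply: le_trans (rnorm_trans (partition_sum P f g n x) _ _) _.
apply: le_trans (lerD (hd x) (rnorm_trans (partition_sum P f g m x) _ _)) _.
apply: le_trans (lerD (lexx _) (lerD (partition_sum_tail rep P x nm (h _ nm))
  (rnorm_trans (partition_sum P f' g' m x) _ _))) _.
have t' := partition_sum_tail rep' P x nm (h' _ nm).
have t2 := rnorm_trans (partition_sum P f' g' n x) (partition_sum P f' g' m x) (sandwich F' G' n x).
have t3 := hN m (leq_maxr _ _) x.
have t4 := hd' x.
rewrite [rnorm (partition_sum P f' g' m x - partition_sum P f' g' n x)]rnormBC in t2.
rewrite [rnorm (partition_sum P f' g' n x - sandwich F' G' n x)]rnormBC in t2.
lra.
Qed.

Lemma sandwich_cvg D : op_cvg \oo (sandwich F' G') D -> op_cvg \oo (sandwich F G) D.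
Proof.
move=> /op_cvgP hD; apply/op_cvgP => e e0.
have M0 : 0 < 2 * q + 1 by rewrite ltr_wpDl // mulr_ge0.
have e1 : 0 < e / 2 / (2 * q + 1) by rewrite !divr_gt0.
have e2 : 0 < e / 2 by rewrite divr_gt0.
have [N hN] := rep_tail rep e1; have [N' hN'] := rep_tail rep' e1.
have [N2 hN2] := hD _ e2.
have tail (u v : nat -> R) n0 n m : (forall k, 0 <= u k * v k) -> (n0 <= n)%N -> (n <= m)%N ->
    \sum_(n <= k < m) u k * v k <= \sum_(n0 <= k < m) u k * v k.
  by move=> uv h1 h2; rewrite [leRHS](big_cat_nat h1 h2) //= lerDr sumr_ge0.
have ab k : 0 <= a k * b k.
  by apply: mulr_ge0; [exact: le_trans (normc_ge0 _) (rep_lel rep k point)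
                      |exact: le_trans (normc_ge0 _) (rep_ler rep k point)].
have ab' k : 0 <= a' k * b' k.
  by apply: mulr_ge0; [exact: le_trans (normc_ge0 _) (rep_lel rep' k point)
                      |exact: le_trans (normc_ge0 _) (rep_ler rep' k point)].
exists (maxn (maxn N N') N2) => n; rewrite !geq_max => /andP[/andP[h h'] h2] x.
apply: le_trans (rnorm_trans (sandwich F' G' n x) _ _) _.
rewrite (splitr e) mulrDl; apply: lerD; last exact: hN2.
apply: le_trans (@sandwich_close n _ x _ _) _.
- by move=> m nm; apply: le_trans (tail _ _ N _ _ ab h nm) (hN _ (leq_trans h nm)).
- by move=> m nm; apply: le_trans (tail _ _ N' _ _ ab' h' nm) (hN' _ (leq_trans h' nm)).
rewrite ler_wpM2r ?rnorm_ge0 // mulrCA ler_piMr ?(ltW e2) // ler_pdivrMr // mul1r lerDl //.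
Qed.
End TwoReps.
End Independence.

(** * Fourier series of Besov functions *)

Lemma mI01 (R : realType) : measurable (`[0%R, 1%R]%classic : set (measurableTypeR R)).
Proof. exact: measurable_itv. Qed.

Section CircleFourier.
Variable R : realType.
Local Notation C := (complex R).
Local Notation normc := (@Normc.normc R).
Local Notation cR := (real_complex R).
Local Notation circle := (circle R).
Local Notation mu := (@lebesgue_measure R).
Local Notation param := (@circle_param R).
Local Notation Re := (@complex.Re R).
Local Notation Im := (@complex.Im R).

Implicit Types f g h : circle -> C.

(** The type [circle] comes with a sigma-algebra, and its integrals are integrals over $[0,1]$;
    continuity is therefore expressed after pulling back to the line. *)
Definition continuous_param (h : circle -> C) :=
  continuous (fun x : R => Re (h (param x))) /\ continuous (fun x : R => Im (h (param x))).

Lemma normc_Re (z : C) : `|Re z| <= normc z.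
Proof. by have := normc_ge_Re z; rewrite normcE lecR. Qed.

Lemma normc_Im (z : C) : `|Im z| <= normc z.
Proof.
case: z => a b; rewrite /= -sqrtr_sqr ler_sqrt; first by rewrite lerDr sqr_ge0.
by rewrite addr_ge0 ?sqr_ge0.
Qed.

Lemma L1_circleM g h : L1_circle g -> continuous_param h -> (forall z, normc (h z) <= 1) ->
  L1_circle (fun z => g z * h z).
Proof.
move=> [gR gI] [hR hI] h1.
have bnd (u : C -> R) : (forall z, `|u z| <= normc z) -> [bounded u (h (param x)) | x in `[0, 1]%classic].
  move=> hu; exists 1; split; first exact: num_real.
  by move=> M hM x _; apply: le_trans (hu _) (le_trans (h1 _) (ltW hM)).
have mR : measurable_fun (`[0, 1]%classic : set R) (fun x : R => Re (h (param x))).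
  by apply: measurable_funTS; exact: continuous_measurable_fun.
have mIm : measurable_fun (`[0, 1]%classic : set R) (fun x : R => Im (h (param x))).
  by apply: measurable_funTS; exact: continuous_measurable_fun.
have M (u v : C -> R) : mu.-integrable `[0, 1] (fun x => (u (g (param x)))%:E) ->
    measurable_fun (`[0, 1]%classic : set R) (fun x : R => v (h (param x))) ->
    (forall z, `|v z| <= normc z) ->
    mu.-integrable `[0, 1] (fun x => (u (g (param x)))%:E * (v (h (param x)))%:E)%E.
  move=> ui mv vb; apply: (integrableMl _ ui) => //.
  exact: bnd.
split.
- have := integrableB (@mI01 R) (M Re Re gR mR normc_Re) (M Im Im gI mIm normc_Im).
  apply: eq_integrable => // x _ /=; case: (g _) => a b; case: (h _) => c e //=.
- have := integrableD (@mI01 R) (M Re Im gR mIm normc_Im) (M Im Re gI mR normc_Re).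
  apply: eq_integrable => // x _ /=; case: (g _) => a b; case: (h _) => c e //=.
Qed.

Lemma L1_circleZ (a : C) g : L1_circle g -> L1_circle (fun z => a * g z).
Proof.
move=> [gR gI].
split.
- have := integrableB (@mI01 R) (integrableZl (@mI01 R) (Re a) gR) (integrableZl (@mI01 R) (Im a) gI).
  by apply: eq_integrable => // x _ /=; case: (g _) => c e; case: a.
- have := integrableD (@mI01 R) (integrableZl (@mI01 R) (Re a) gI) (integrableZl (@mI01 R) (Im a) gR).
  by apply: eq_integrable => // x _ /=; case: (g _) => c e; case: a.
Qed.

Lemma L1_circleD g h : L1_circle g -> L1_circle h -> L1_circle (fun z => g z + h z).
Proof.
move=> [gR gI] [hR hI].
split.
- have := integrableD (@mI01 R) gR hR.
  by apply: eq_integrable => // x _ /=; case: (g _) => c e; case: (h _).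
- have := integrableD (@mI01 R) gI hI.
  by apply: eq_integrable => // x _ /=; case: (g _) => c e; case: (h _).
Qed.

Lemma circle_intD g h : L1_circle g -> L1_circle h ->
  circle_int (fun z => g z + h z) = circle_int g + circle_int h.
Proof.
move=> [gR gI] [hR hI]; rewrite /circle_int; apply/eqP; rewrite eq_complex /=.
rewrite -!RintegralD //; apply/andP; split; apply/eqP; apply: eq_Rintegral => x _;
by case: (g _) => c e; case: (h _).
Qed.

Lemma circle_intZ (a : C) g : L1_circle g ->
  circle_int (fun z => a * g z) = a * circle_int g.
Proof.
move=> [gR gI]; rewrite /circle_int; apply/eqP; rewrite eq_complex.
case: a => a1 a2 /=.
rewrite -!RintegralZl //.
have Z b := (integrableZl (@mI01 R) b gR, integrableZl (@mI01 R) b gI).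
rewrite -RintegralB //; [|exact: (Z a1).1|exact: (Z a2).2].
rewrite -RintegralD //; [|exact: (Z a1).2|exact: (Z a2).1].
by apply/andP; split; apply/eqP; apply: eq_Rintegral => x _; case: (g _).
Qed.

Lemma L1_circle_sum n (g : nat -> circle -> C) : (forall k, L1_circle (g k)) ->
  L1_circle (fun z => \sum_(k < n) g k z) /\
  circle_int (fun z => \sum_(k < n) g k z) = \sum_(k < n) circle_int (g k).
Proof.
move=> hg; elim: n => [|n [IH1 IH2]].
  have e : (fun z => \sum_(k < 0) g k z) = (fun z => 0 * g 0%N z).
    by apply/funext => z; rewrite big_ord0 mul0r.
  by rewrite e big_ord0; split; [exact: L1_circleZ|rewrite circle_intZ // mul0r].
have e : (fun z => \sum_(k < n.+1) g k z) = (fun z => \sum_(k < n) g k z + g n z).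
  by apply/funext => z; rewrite big_ord_recr.
by rewrite e big_ord_recr /=; split; [exact: L1_circleD|rewrite circle_intD // IH2].
Qed.

Let continuous_arg : continuous (fun x : R => 2 * pi * x).
Proof. by move=> x; apply: cvgM; [exact: cvg_cst|exact: cvg_id]. Qed.

Lemma continuous_param_val : continuous_param (fun z => val z).
Proof.
split=> /= x.
  exact: (continuous_comp (@continuous_arg x) (@continuous_cos R _)).
exact: (continuous_comp (@continuous_arg x) (@continuous_sin R _)).
Qed.

Lemma circle_inv (z : circle) : (val z : C)^-1 = ((val z)^*)%C.
Proof. by rewrite invc_norm normcE normc_circle expr1n invr1 mul1r. Qed.

Lemma continuous_param_inv : continuous_param (fun z => (val z)^-1).
Proof.
have [cR' cI'] := continuous_param_val; split.
  by rewrite (_ : (fun x => _) = (fun x => Re (val (param x)))) //; apply/funext => x; rewrite circle_inv.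
rewrite (_ : (fun x => _) = (fun x => - Im (val (param x)))); last first.
  by apply/funext => x; rewrite circle_inv.
by move=> x; apply: continuousN; exact: cI'.
Qed.

Lemma L1_circle_pow f n : L1_circle f -> L1_circle (fun z => f z * (val z)^-1 ^+ n).
Proof.
move=> hf; elim: n => [|n IH].
  by rewrite (_ : (fun _ => _) = f) //; apply/funext => z; rewrite expr0 mulr1.
rewrite (_ : (fun _ => _) = (fun z => f z * (val z)^-1 ^+ n * (val z)^-1)); last first.
  by apply/funext => z; rewrite exprSr mulrA.
apply: L1_circleM => //; first exact: continuous_param_inv.
by move=> z; rewrite Normc.normcV normc_circle invr1.
Qed.

Lemma fourier_nat f (n : nat) : fourier f n = circle_int (fun z => f z * (val z)^-1 ^+ n).
Proof. by congr circle_int; apply/funext => z; rewrite -exprnN exprVn. Qed.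

(** The Fourier coefficients of $W_n$ at nonnegative indices. For $n=0$ this leaves out the term
    $\bar z$, which meets only $\hat f(-1)$. *)
Definition besov_coef (n k : nat) : R :=
  if n is 0%N then (k < 2)%:R else besov_w (k%:R / 2 ^+ n).

Definition besov_poly f (n : nat) : {poly C} :=
  \poly_(k < 2 ^ n.+1) (cR (besov_coef n k) * fourier f k).

Lemma circle_conv_besov f n z : L1_circle f -> fourier f (- 1) = 0 ->
  circle_conv f (besov_W n) z = (besov_poly f n).[val z].
Proof.
move=> hf f1; rewrite /circle_conv /besov_poly horner_poly.
have hL (a : nat -> C) k : L1_circle (fun t => a k * (f t * (val t)^-1 ^+ k)).
  by apply: L1_circleZ; exact: L1_circle_pow.
have cW (a : nat -> C) N : circle_int (fun t => \sum_(k < N) a k * (f t * (val t)^-1 ^+ k)) =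
    \sum_(k < N) a k * fourier f k.
  have [_ ->] := L1_circle_sum N (hL a); apply: eq_bigr => k _.
  by rewrite circle_intZ ?fourier_nat //; exact: L1_circle_pow.
case: n => [|n].
  (* The term $\bar z$ of $W_0$ contributes $\bar z\hat f(-1)=0$; it is separated from the two
     analytic terms. *)
  have -> : (fun t => f t * besov_W 0 (val z * ((val t)^*)%C)) = (fun t => (val z)^-1 * (f t * val t)
      + \sum_(k < 2) (cR (besov_coef 0 k) * val z ^+ k) * (f t * (val t)^-1 ^+ k)).
    apply/funext => t.
    rewrite -(big_mkord xpredT (fun k => cR (besov_coef 0 k) * val z ^+ k * (f t * (val t)^-1 ^+ k))).
    rewrite big_ltn // big_ltn // big_geq // addr0.
    have hz : ((val z)^*)%C = (val z)^-1 by rewrite circle_inv.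
    have ht : ((val t)^*)%C = (val t)^-1 by rewrite circle_inv.
    have e0 : cR (besov_coef 0 0) = 1 by [].
    have e1 : cR (besov_coef 0 1) = 1 by [].
    have hc : ((val z * (val t)^*)^*)%C = (val z)^-1 * val t by rewrite rmorphM /= conjcK hz.
    have hW : besov_W 0 (val z * ((val t)^*)%C) = (val z)^-1 * val t + 1 + val z * (val t)^-1.
      by rewrite -hc -ht.
    rewrite hW e0 ?e1 !expr0 !expr1; ring.
  rewrite circle_intD; last first.
  - exact: (L1_circle_sum 2 (hL (fun k => cR (besov_coef 0 k) * val z ^+ k))).1.
  - apply: L1_circleZ; apply: L1_circleM => //; first exact: continuous_param_val.
    by move=> t; rewrite normc_circle.
  rewrite circle_intZ; last first.
    apply: L1_circleM => //; first exact: continuous_param_val.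
    by move=> t; rewrite normc_circle.
  rewrite (_ : circle_int (fun t => f t * val t) = 0) ?mulr0 ?add0r; last first.
    by rewrite -f1; congr circle_int; apply/funext => t; rewrite opprK expr1z.
  by rewrite (cW (fun k => cR (besov_coef 0 k) * val z ^+ k)); apply: eq_bigr => k _; rewrite mulrAC.
have -> : (fun t => f t * besov_W n.+1 (val z * ((val t)^*)%C)) = (fun t =>
    \sum_(k < 2 ^ n.+2) (cR (besov_coef n.+1 k) * val z ^+ k) * (f t * (val t)^-1 ^+ k)).
  apply/funext => t; rewrite mulr_sumr; apply: eq_bigr => k _.
  by rewrite -circle_inv exprMn; ring.
by rewrite (cW (fun k => cR (besov_coef n.+1 k) * val z ^+ k)); apply: eq_bigr => k _; rewrite mulrAC.
Qed.

Lemma circle_param_surj (z : circle) : exists2 x : R, 0 <= x <= 1 & param x = z.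
Proof.
have z1 : normc (val z) = 1 := normc_circle z.
have vz : (Re (val z) +i* Im (val z))%C = val z by case: (val z).
have pi0 : 0 < pi :> R by exact: pi_gt0.
have p2 : 2 * pi != 0 :> R by rewrite mulf_neq0 // lt0r_neq0.
have {}z1 : Re (val z) ^+ 2 + Im (val z) ^+ 2 = 1.
  move: z1; case: (val z) => a b /= h.
  by rewrite -[LHS]sqr_sqrtr ?addr_ge0 ?sqr_ge0 // h expr1n.
have aI : -1 <= Re (val z) <= 1.
  by rewrite -ler_norml -(@ler_pXn2r _ 2) ?nnegrE // expr1n real_normK ?num_real // -z1 lerDl sqr_ge0.
have sa : sin (acos (Re (val z))) = `|Im (val z)|.
  by rewrite sin_acos // -z1 addrAC subrr add0r sqrtr_sqr.
have ca : cos (acos (Re (val z))) = Re (val z) by rewrite acosK // in_itv.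
have [a0 api] : 0 <= acos (Re (val z)) /\ acos (Re (val z)) <= pi by split; [exact: acos_ge0|exact: acos_lepi].
have [b0|b0] := leP 0 (Im (val z)).
  exists (acos (Re (val z)) / (2 * pi)).
    by rewrite divr_ge0 ?mulr_ge0 ?(ltW pi0) //= ler_pdivrMr ?mulr_gt0 //; lra.
  by apply: val_inj => /=; rewrite mulrC divfK // ca sa ger0_norm.
exists ((2 * pi - acos (Re (val z))) / (2 * pi)).
  by rewrite divr_ge0 ?mulr_ge0 ?(ltW pi0) //= ?ler_pdivrMr ?mulr_gt0 //; lra.
apply: val_inj => /=; rewrite mulrC divfK //.
have -> : 2 * pi - acos (Re (val z)) = - acos (Re (val z)) + pi + pi :> R by ring.
rewrite cosDpi sinDpi cosDpi sinDpi !opprK cosN sinN ca sa ltr0_norm // opprK.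
exact: vz.
Qed.
End CircleFourier.

(** * Sup norms of the Littlewood-Paley blocks *)

Section EssSup.
Variable R : realType.
Local Notation C := (complex R).
Local Notation normc := (@Normc.normc R).
Local Notation circle := (circle R).
Local Notation mu := (@lebesgue_measure R).
Local Notation param := (@circle_param R).
Local Notation Re := (@complex.Re R).
Local Notation Im := (@complex.Im R).

(** If [|u|] exceeded [y] at a point, it would do so on an interval of positive length inside
    $[0,1]$, which the essential supremum forbids. *)
Lemma le_Lnorm_oo_continuous (u : R -> R) (y : R) : continuous u ->
  Lnorm (mrestr mu (measurable_itv `[(0 : R), 1])) +oo%E (fun x => (u x)%:E) = y%:E ->
  forall x, 0 <= x <= 1 -> `|u x| <= y.
Proof.
move=> cu; rewrite unlock.
case: ifPn => [_ e x0 /andP[x00 x01]|]; last first.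
  rewrite -leNgt => h; have : (mu (setT `&` `[0%R, 1%R]) <= 0)%E := h.
  by rewrite setTI lebesgue_measure_itv /= lte_fin ltr01 oppr0 adde0 lee_fin ler10.
rewrite leNgt; apply/negP => yx.
have [N [mN N0 sN]] := ess_sup_ge (mrestr mu (measurable_itv `[(0 : R), 1])) (abse \o (fun x => (u x)%:E)).
have : \forall x \near x0, y < `|u x|.
  have cn : (fun x => `|u x| : R) @ x0 --> (`|u x0| : R).
    by apply: (@cvg_norm _ R^o _ _ _ u _ (cu x0)).
  have hh := @cvgr_gt _ _ _ _ _ _ cn _ yx. exact: (hh (nbhs_filter x0)).
move=> /nbhs_ballP [/= d d0 hd].
(* Clipping keeps the interval inside $[0,1]$ when [x0] is near an endpoint. *)
pose a := Num.max 0 (x0 - d / 2); pose b := Num.min 1 (x0 + d / 2).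
have d2 : 0 < d / 2 by rewrite divr_gt0.
have ab : a < b.
  by rewrite /a /b gt_max !lt_min; apply/andP; split; apply/andP; split; lra.
have sub : `[a, b]%classic `<=` N `&` `[0, 1]%classic.
  move=> x /=; rewrite !in_itv /= => /andP[]; rewrite /a /b ge_max le_min => /andP[xa1 xa2] /andP[xb1 xb2].
  split; last by rewrite xa1 xb1.
  apply: sN => /=; rewrite e lee_fin; apply/negP; rewrite -ltNge.
  apply: hd; rewrite /ball /= distrC ltr_norml; apply/andP; split; lra.
have : (mu `[a, b]%classic <= mu (N `&` `[0%R, 1%R]%classic))%E.
  apply: le_measure => //; rewrite inE; first exact: measurable_itv.
  by apply: measurableI => //; exact: measurable_itv.
have N1 : mu (N `&` `[0%R, 1%R]%classic) = 0%E := N0; rewrite N1.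
by rewrite lebesgue_measure_itv /= lte_fin ab -EFinB lee_fin; lra.
Qed.

Implicit Types f g h : circle -> C.

Lemma continuous_paramM g h : continuous_param g -> continuous_param h ->
  continuous_param (fun z => g z * h z).
Proof.
move=> [gR gI] [hR hI]; split=> x.
  rewrite (_ : (fun _ => _) = (fun x => Re (g (param x)) * Re (h (param x)) - Im (g (param x)) * Im (h (param x)))).
    apply: (@cvgB _ R^o).
      exact: (cvgM (gR x) (hR x)).
    exact: (cvgM (gI x) (hI x)).
  by apply/funext => y; case: (g _) => a b; case: (h _).
rewrite (_ : (fun _ => _) = (fun x => Re (g (param x)) * Im (h (param x)) + Im (g (param x)) * Re (h (param x)))).
  apply: (@cvgD _ R^o).
    exact: (cvgM (gR x) (hI x)).
  exact: (cvgM (gI x) (hR x)).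
by apply/funext => y; case: (g _) => a b; case: (h _).
Qed.

Lemma continuous_paramD g h : continuous_param g -> continuous_param h ->
  continuous_param (fun z => g z + h z).
Proof.
move=> [gR gI] [hR hI]; split=> x.
  rewrite (_ : (fun _ => _) = (fun x => Re (g (param x)) + Re (h (param x)))).
    exact: (@cvgD _ R^o _ _ _ _ _ _ _ (gR x) (hR x)).
  by apply/funext => y; case: (g _) => a b; case: (h _).
rewrite (_ : (fun _ => _) = (fun x => Im (g (param x)) + Im (h (param x)))).
  exact: (@cvgD _ R^o _ _ _ _ _ _ _ (gI x) (hI x)).
by apply/funext => y; case: (g _) => a b; case: (h _).
Qed.

Lemma continuous_param_cst (c : C) : continuous_param (fun=> c).
Proof. by split=> x; exact: cvg_cst. Qed.

Lemma continuous_param_poly (p : {poly C}) : continuous_param (fun z => p.[val z]).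
Proof.
elim/poly_ind: p => [|p c IH].
  rewrite (_ : (fun _ => _) = (fun=> 0)); first exact: continuous_param_cst.
  by apply/funext => z; rewrite horner0.
rewrite (_ : (fun _ => _) = (fun z : circle => p.[val z] * val z + c)).
  apply: continuous_paramD; last exact: continuous_param_cst.
  by apply: continuous_paramM => //; exact: continuous_param_val.
by apply/funext => z; rewrite hornerMXaddC.
Qed.

Lemma continuous_normc_param g : continuous_param g ->
  continuous (fun x : R => normc (g (param x))).
Proof.
move=> [gR gI].
rewrite (_ : (fun _ => _) = (fun x => Num.sqrt (Re (g (param x)) * Re (g (param x)) + Im (g (param x)) * Im (g (param x))))).
  move=> x; apply: (@continuous_comp _ _ _
     (fun x => Re (g (param x)) * Re (g (param x)) + Im (g (param x)) * Im (g (param x))) (@Num.sqrt R)).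
    apply: (@cvgD _ R^o).
      exact: (cvgM (gR x) (gR x)).
    exact: (cvgM (gI x) (gI x)).
  exact: sqrt_continuous.
by apply/funext => x; case: (g _) => a b /=; rewrite !expr2.
Qed.

(** Each $f*W_n$ is a polynomial on the circle, so its essential supremum bounds it everywhere; with
    $q=1$ the norm over $n$ is the sum of the weighted suprema. *)
Lemma besov_bounds f : besov_plus 1 +oo%E 1%:E f -> exists a : nat -> R,
  (forall n z, normc z = 1 -> normc (besov_poly f n).[z] <= a n) /\
  exists S, forall N, \sum_(n < N) 2 ^+ n * a n <= S.
Proof.
move=> [[Lf Bf _] f0].
pose A n := Lp_circle +oo%E (fun z => (besov_poly f n).[val z]).
have A0 n : (0 <= A n)%E by exact: Lnorm_ge0.
have eA n : Lp_circle +oo%E (circle_conv f (besov_W n)) = A n.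
  by congr Lp_circle; apply/funext => z; apply: circle_conv_besov => //; apply: f0.
have t0 k : (0 <= (2 ^+ k)%:E * A k)%E by rewrite mule_ge0 // lee_fin exprn_ge0.
have {}Bf : (\sum_(k <oo) ((2 ^+ k)%:E * A k) < +oo)%E.
  move: Bf; rewrite Lnorm_counting // invr1 poweRe1; last first.
    by apply: nneseries_ge0 => k _ _; exact: poweR_ge0.
  apply: le_lt_trans; apply: lee_nneseries => [k _ *|k _]; first exact: t0.
  rewrite eA mulr1 powR_mulrn // poweRe1 ?abse_ge0 // gee0_abs //.
have part N : (\sum_(0 <= k < N) ((2 ^+ k)%:E * A k) <= \sum_(k <oo) ((2 ^+ k)%:E * A k))%E.
  exact: nneseries_lim_ge.
(* A single infinite block norm would make the weighted sum infinite. *)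
have Afin n : A n = (fine (A n))%:E.
  rewrite fineK // ge0_fin_numE // ltNge; apply/negP; rewrite leye_eq => /eqP An.
  have := part n.+1; rewrite big_nat_recr //= An gt0_muley ?lte_fin ?exprn_gt0 //.
  rewrite addey ?leye_eq; first by move=> /eqP e; rewrite e in Bf.
  by rewrite gt_eqF // (lt_le_trans _ (sume_ge0 _ _)).
exists (fun n => fine (A n)); split.
  move=> n z z1; have [w wz] := circle_exists z1; have [x x01 xw] := circle_param_surj w.
  rewrite -wz -xw.
  have := le_Lnorm_oo_continuous (continuous_normc_param (continuous_param_poly (besov_poly f n))) (Afin n) x01.
  by rewrite ger0_norm ?normc_ge0.
exists (fine (\sum_(k <oo) ((2 ^+ k)%:E * A k))) => N.
have Sfin : (\sum_(k <oo) ((2 ^+ k)%:E * A k))%E \is a fin_num.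
  by rewrite ge0_fin_numE // nneseries_ge0.
rewrite -lee_fin fineK //; apply: le_trans (part N).
rewrite big_mkord -sumEFin; apply: lee_sum => k _.
by rewrite EFinM -Afin.
Qed.
End EssSup.

(** * Scalar series and the summation of the blocks *)

Section ScalarSequences.
Variable R : realType.
Local Notation C := (complex R).
Local Notation normc := (@Normc.normc R).
Local Notation cR := (real_complex R).

Lemma cauchy_seq_real (u : nat -> R) :
  (forall e : R, 0 < e -> exists N, forall n m, (N <= n)%N -> (N <= m)%N -> `|u n - u m| <= e) ->
  exists l, forall e : R, 0 < e -> exists N, forall n, (N <= n)%N -> `|u n - l| <= e.
Proof.
move=> h.
have /cauchy_cvgP /= c : cauchy ((u : nat -> R^o) @ \oo).
  apply/cauchy_ballP => e e0.
  have e3 : 0 < e / 2 by rewrite divr_gt0.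
  have [N hN] := h _ e3.
  exists (u @` [set n | (N <= n)%N], u @` [set n | (N <= n)%N]); first split.
  - by exists N => // n Nn; exists n.
  - by exists N => // n Nn; exists n.
  - move=> [x y] /= [[n Nn <-] [m Nm <-]].
    rewrite -ball_normE /ball_ /=.
    by apply: le_lt_trans (hN n m Nn Nm) _; rewrite ltr_pdivrMr // ltr_pMr // ltr1n.
exists (lim ((u : nat -> R^o) @ \oo)) => e e0.
have /cvgrPdist_le /(_ _ e0) /near_inftyP [N hN] := c.
by exists N => n /hN; rewrite distrC.
Qed.

Lemma cauchy_seq_complex (u : nat -> C) :
  (forall e : R, 0 < e -> exists N, forall n m, (N <= n)%N -> (N <= m)%N -> normc (u n - u m) <= e) ->
  exists l, forall e : R, 0 < e -> exists N, forall n, (N <= n)%N -> normc (u n - l) <= e.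
Proof.
move=> h.
have ReB (x y : C) : complex.Re (x - y) = complex.Re x - complex.Re y by case: x; case: y.
have ImB (x y : C) : complex.Im (x - y) = complex.Im x - complex.Im y by case: x; case: y.
have [|a ha] := @cauchy_seq_real (fun n => complex.Re (u n)).
  move=> e /h [N hN]; exists N => n m Nn Nm.
  by rewrite -ReB; apply: le_trans (normc_Re _) (hN _ _ Nn Nm).
have [|b hb] := @cauchy_seq_real (fun n => complex.Im (u n)).
  move=> e /h [N hN]; exists N => n m Nn Nm.
  by rewrite -ImB; apply: le_trans (normc_Im _) (hN _ _ Nn Nm).
exists (a +i* b)%C => e e0.
have e2 : 0 < e / 2 by rewrite divr_gt0.
have [N hN] := ha _ e2; have [N' hN'] := hb _ e2.
exists (maxn N N') => n; rewrite geq_max => /andP[/hN {}hN /hN' {}hN'].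
have -> : u n - (a +i* b)%C = cR (complex.Re (u n) - a) + 'i%C * cR (complex.Im (u n) - b).
  by move: (u n) => [x y]; simpc.
rewrite (splitr e); apply: le_trans (le_normcD _ _) _.
apply: lerD; first by rewrite normc_real.
rewrite Normc.normcM normc_real (_ : normc _ = 1) ?mul1r //.
by rewrite /= expr0n expr1n add0r sqrtr1.
Qed.

Lemma bounded_series_tail (a : nat -> R) S : (forall k, 0 <= a k) ->
  (forall n, \sum_(k < n) a k <= S) ->
  forall e : R, 0 < e -> exists N, forall n, (N <= n)%N -> \sum_(N <= k < n) a k <= e.
Proof.
move=> a0 aS e e0.
have sup0 : has_sup [set \sum_(k < n) a k | n in [set: nat]].
  split; first by exists (\sum_(k < 0) a k); exists 0%N.
  by exists S => _ [n _ <-].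
have [_ [N _ <-] hN] := sup_adherent e0 sup0.
exists N => n Nn.
have : \sum_(k < n) a k <= sup [set \sum_(k < n) a k | n in [set: nat]].
  by apply: ub_le_sup; [case: sup0|exists n].
rewrite -(big_mkord xpredT) (big_cat_nat (leq0n N) Nn) /= big_mkord; lra.
Qed.

(** With $n$ the size of $p$, the coefficient is the mean of $p(w^i)w^{-im}$ over the $n$-th roots
    of unity; [n - m] stands for the exponent $-m$. *)
Lemma normc_coef_le (p : {poly C}) M m : (forall z, normc z = 1 -> normc p.[z] <= M) ->
  normc p`_m <= M.
Proof.
move=> pM; have M0 : 0 <= M by apply: le_trans (normc_ge0 _) (pM 1 (Normc.normc1 _)).
have [mp|pm] := ltnP m (size p); last by rewrite nth_default // Normc.normc0.
set n := size p in mp; have n0 : (0 < n)%N by apply: leq_trans mp.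
have [w wn] := prim_root_complex R n0.
have w1 := normc_prim_root n0 wn.
have e : \sum_(i < n) p.[w ^+ i] * (w ^+ i) ^+ (n - m) = n%:R * p`_m.
  transitivity (\sum_(j < n) p`_j * \sum_(i < n) (w ^+ i) ^+ (j + (n - m))).
    under eq_bigr => i _ do rewrite horner_coef mulr_suml.
    rewrite exchange_big; apply: eq_bigr => j _; rewrite mulr_sumr; apply: eq_bigr => i _.
    by rewrite -mulrA -exprD.
  rewrite (bigD1 (Ordinal mp)) //= [X in _ + X]big1 ?addr0 => [|j].
    by rewrite (sum_prim_root _ wn) subnKC ?(ltnW mp) // dvdnn mulrC.
  rewrite -val_eqE /= => jm; rewrite (sum_prim_root _ wn); case: ifPn; rewrite ?mulr0 //.
  have jn := ltn_ord j; move=> /dvdnP [q hq]; case/eqP: jm.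
  have q1 : q = 1%N by nia.
  by move: hq; rewrite q1; lia.
have nn : normc n%:R = n%:R :> R.
  by rewrite -(rmorph_nat cR) normc_real ger0_norm.
have nR : (0 : R) < n%:R by rewrite ltr0n.
rewrite -(ler_pM2l nR) -{1}nn -Normc.normcM -e.
apply: le_trans (normc_sum _ _ _) _.
apply: (@le_trans _ _ (\sum_(i < n) M)); last by rewrite sumr_const card_ord mulr_natl.
apply: ler_sum => i _; rewrite Normc.normcM !normcX w1 !expr1n mulr1; apply: pM.
by rewrite normcX w1 expr1n.
Qed.

(** The Fourier multiplier of a de la Vallee Poussin kernel. *)
Definition trapezoid (N k : nat) : R :=
  if (k <= 2 ^ N)%N then 1 else if (k <= 2 ^ N.+1)%N then 2 - k%:R / 2 ^+ N else 0.

(** Between consecutive peaks the falling edge of one hat and the rising edge of the next add up to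
    $1$; only the falling edge of the last hat remains. *)
Lemma sum_besov_coef N k : \sum_(n < N.+1) besov_coef R n k = trapezoid N k.
Proof.
elim: N => [|N IH].
  rewrite big_ord_recl big_ord0 addr0 /trapezoid /besov_coef expn0 expn1 expr0 divr1.
  by case: k => [|[|[|k]]] //=; rewrite subrr.
rewrite big_ord_recr IH /= /trapezoid /besov_w.
have P0 : (0 : R) < 2 ^+ N by rewrite exprn_gt0.
have P1 : (0 : R) < 2 ^+ N.+1 by rewrite exprn_gt0.
have x1 : (2^-1 <= k%:R / 2 ^+ N.+1 :> R) = (2 ^ N <= k)%N.
  by rewrite ler_pdivlMr // exprS mulrA mulVf // mul1r -natrX ler_nat.
have x2 : (k%:R / 2 ^+ N.+1 <= 1 :> R) = (k <= 2 ^ N.+1)%N.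
  by rewrite ler_pdivrMr // mul1r -natrX ler_nat.
have x3 : (1 <= k%:R / 2 ^+ N.+1 :> R) = (2 ^ N.+1 <= k)%N.
  by rewrite ler_pdivlMr // mul1r -natrX ler_nat.
have x4 : (k%:R / 2 ^+ N.+1 <= 2 :> R) = (k <= 2 ^ N.+2)%N.
  by rewrite ler_pdivrMr // -exprS -natrX ler_nat.
have e1 : k%:R / 2 ^+ N = 2 * (k%:R / 2 ^+ N.+1) :> R.
  by rewrite exprS; field; exact: lt0r_neq0.
have eqx j : (k = 2 ^ j)%N -> k%:R = 2 ^+ j :> R by move=> ->; rewrite natrX.
have := expnS 2 N; have := expnS 2 N.+1; have := expn_gt0 2 N.
rewrite x1 x2 x3 x4 e1 => /= p0 h2 h1.
case: (ltngtP k (2 ^ N)%N) => kN /=.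
- have -> : (k <= 2 ^ N.+1)%N by lia.
  have -> : (2 ^ N.+1 <= k)%N = false by lia.
  by rewrite addr0.
- case: (ltngtP k (2 ^ N.+1)%N) => kN1 /=.
  + lra.
  + case: leqP => _; lra.
  + lra.
- have -> : (k <= 2 ^ N.+1)%N by lia.
  have -> : k%:R / 2 ^+ N.+1 = 2^-1 :> R.
    by rewrite (eqx _ kN) exprS; field; exact: lt0r_neq0.
  lra.
Qed.

Lemma sum_cutoff (b : R) m K :
  \sum_(k < K) (if (k < m)%N then b else 0) = (minn K m)%:R * b.
Proof.
elim: K => [|K IH]; first by rewrite big_ord0 min0n mul0r.
rewrite big_ord_recr /= IH; case: ltnP => h.
  have -> : minn K.+1 m = K.+1 by lia.
  by rewrite -natr1 mulrDl mul1r.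
by rewrite addr0; have -> : minn K.+1 m = m by lia.
Qed.

Lemma besov_coef_eq0 n k : (2 ^ n.+1 <= k)%N -> besov_coef R n k = 0.
Proof.
case: n => [|n] h /=; first by rewrite ltnNge h.
have P1 : (0 : R) < 2 ^+ n.+1 by rewrite exprn_gt0.
have x2 : 2 <= k%:R / 2 ^+ n.+1 :> R.
  by rewrite ler_pdivlMr // -exprS -natrX ler_nat.
rewrite /besov_w; move: (_ / _) x2 => x x2; case: ifPn => [/andP[_ ?]|_]; first lra.
by case: ifPn => // /andP[_ ?]; lra.
Qed.

Local Notation circle := (circle R).
Implicit Type f : circle -> C.

Lemma coef_besov_poly f n k : (besov_poly f n)`_k = cR (besov_coef R n k) * fourier f k.
Proof.
by rewrite coef_poly; case: ltnP => // h; rewrite besov_coef_eq0 // mul0r.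
Qed.

(* For [2 ^ N <= K] the partial sum of length [K] of the Fourier series
   differs from the sum of the first [N] blocks only by parts of later blocks. *)
Lemma analytic_ext_blocks f (a : nat -> R) S :
  (forall n z, normc z = 1 -> normc (besov_poly f n).[z] <= a n) ->
  (forall N, \sum_(n < N) 2 ^+ n * a n <= S) ->
  forall z, normc z <= 1 -> forall e : R, 0 < e -> exists N, forall n, (N <= n)%N ->
    normc (\sum_(k < n) (besov_poly f k).[z] - analytic_ext f z) <= e.
Proof.
move=> fa aS z z1.
have a0 n : 0 <= a n by apply: le_trans (normc_ge0 _) (fa n 1 (Normc.normc1 _)).
have b0 n : 0 <= 2 ^+ n * a n by rewrite mulr_ge0 // exprn_ge0.
have tail := bounded_series_tail b0 aS.
have le_a n : a n <= 2 ^+ n * a n by rewrite ler_peMl // exprn_ege1 // ler1n.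
have Pz n : normc (besov_poly f n).[z] <= 2 ^+ n * a n.
  by apply: le_trans (le_a n); apply: poly_max_principle z1; exact: fa.
have cat (u : nat -> C) N n : (N <= n)%N -> \sum_(k < n) u k - \sum_(k < N) u k = \sum_(N <= k < n) u k.
  move=> Nn; rewrite -!(big_mkord xpredT) (big_cat_nat (leq0n N) Nn) /=.
  by rewrite addrAC subrr add0r.
have [|L hL] := @cauchy_seq_complex (fun n => \sum_(k < n) (besov_poly f k).[z]).
  move=> e e0; have [N hN] := tail _ e0; exists N.
  have wl n m : (N <= n)%N -> (n <= m)%N ->
     normc (\sum_(k < m) (besov_poly f k).[z] - \sum_(k < n) (besov_poly f k).[z]) <= e.
    move=> Nn nm; rewrite (cat (fun k => (besov_poly f k).[z])) //; apply: le_trans (normc_sum _ _ _) _.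
    apply: (@le_trans _ _ (\sum_(n <= k < m) 2 ^+ k * a k)).
      by apply: ler_sum => k _; exact: Pz.
    apply: le_trans (hN m (leq_trans Nn nm)).
    by rewrite [leRHS](big_cat_nat Nn nm) /= lerDr sumr_ge0.
  move=> n m Nn Nm; case/orP: (leq_total n m) => h; last exact: wl.
  by rewrite -normcN opprB wl.
have part N K : (2 ^ N <= K)%N -> exists M,  (N <= M)%N /\
   normc (\sum_(k < K) fourier f k * z ^+ k - \sum_(n < N) (besov_poly f n).[z]) <=
   2 * \sum_(N <= n < M) 2 ^+ n * a n.
  (* Every index $k<K$ is at most $2^K$, so the blocks up to $K$ recover its coefficient in full. *)
  move=> NK; exists K.+1.
  have NK' : (N <= K.+1)%N by apply: leqW; apply: leq_trans NK; exact: ltnW (ltn_expl _ _).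
  split => //.
  have -> : \sum_(k < K) fourier f k * z ^+ k =
     \sum_(n < K.+1) \sum_(k < K) (besov_poly f n)`_k * z ^+ k.
    rewrite exchange_big; apply: eq_bigr => k _ /=; rewrite -mulr_suml; congr (_ * _).
    under eq_bigr => n _ do rewrite coef_besov_poly.
    rewrite -mulr_suml -rmorph_sum sum_besov_coef /trapezoid.
    have -> : (k <= 2 ^ K)%N by apply: leq_trans (ltnW (ltn_ord k)) (ltnW (ltn_expl _ _)).
    by rewrite rmorph1 mul1r.
  have -> : \sum_(n < N) (besov_poly f n).[z] = \sum_(n < N) \sum_(k < K) (besov_poly f n)`_k * z ^+ k.
    apply: eq_bigr => n _; apply: horner_coef_wide; apply: leq_trans (size_poly _ _) _.
    by apply: leq_trans NK; rewrite leq_exp2l.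
  rewrite (cat (fun n => \sum_(k < K) (besov_poly f n)`_k * z ^+ k)) // mulr_sumr.
  apply: le_trans (normc_sum _ _ _) _; apply: ler_sum => n _.
  (* Part of a block has at most $2^{n+1}$ coefficients, each at most [a n]; the weight $2^n$ pays
     for this crude count. *)
  have fin : normc (\sum_(k < K) (besov_poly f n)`_k * z ^+ k) <=
       \sum_(k < K) if (k < 2 ^ n.+1)%N then a n else 0.
    apply: le_trans (normc_sum _ _ _) _; apply: ler_sum => k _.
    case: ltnP => kn; last by rewrite coef_besov_poly besov_coef_eq0 // !mul0r Normc.normc0.
    rewrite Normc.normcM normcX -[leRHS]mulr1; apply: ler_pM; rewrite ?normc_ge0 ?exprn_ge0 ?normc_ge0 //.
      by apply: normc_coef_le; exact: fa.
    by rewrite exprn_ile1 // normc_ge0.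
  apply: le_trans fin _.
  by rewrite sum_cutoff mulrA -exprS ler_wpM2r // -natrX ler_nat geq_minr.
have -> : analytic_ext f z = L.
  apply: cvg_lim; first exact: norm_hausdorff.
  apply/cvgrPdist_le => e e0.
  have e1 : 0 < complex.Re e by move: e0; rewrite ltcE => /andP[].
  have e2 : e = cR (complex.Re e) by rewrite RRe_real // gtr0_real.
  move: (complex.Re e) e1 e2 => r r0 ->.
  have r4 : 0 < r / 4 by rewrite divr_gt0.
  have r2 : 0 < r / 2 by rewrite divr_gt0.
  have [N hN] := tail _ r4; have [N' hN'] := hL _ r2.
  apply/near_inftyP; exists (2 ^ (maxn N N'))%N => n hn.
  have [M [NM hM]] := part _ _ hn.
  rewrite normcE lecR -normcN opprB /series /= big_mkord.
  rewrite -(subrKA (\sum_(k < maxn N N') (besov_poly f k).[z])) (splitr r).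
  apply: le_trans (le_normcD _ _) (lerD (le_trans hM _) (hN' _ (leq_maxr _ _))).
  have : \sum_(maxn N N' <= k < M) 2 ^+ k * a k <= r / 4.
    apply: le_trans (hN M (leq_trans (leq_maxl _ _) NM)).
    by rewrite [leRHS](big_cat_nat (leq_maxl N N') NM) /= lerDr sumr_ge0.
  lra.
exact: hL.
Qed.
End ScalarSequences.

(** * The disk algebra *)

Section DiskTopology.
Variable R : realType.
Local Notation C := (complex R).
Local Notation normc := (@Normc.normc R).
Local Notation cR := (real_complex R).
Local Notation circle := (circle R).
Local Notation disk := (@closed_disk R).

Lemma closed_diskP (z : C) : disk z <-> normc z <= 1.
Proof. by rewrite /closed_disk /= normcE lecR. Qed.

Lemma nbhs_cplxP (z : cplx R) (P : set (cplx R)) : nbhs z P <->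
  exists2 d : R, 0 < d & forall w : C, normc (z - w) < d -> P w.
Proof.
split.
  move=> /nbhs_ballP [/= e e0 he].
  have e1 : 0 < complex.Re e by move: e0; rewrite ltcE => /andP[].
  have e2 : e = cR (complex.Re e) by rewrite RRe_real // gtr0_real.
  exists (complex.Re e) => // w hw; apply: he.
  by rewrite -ball_normE /ball_ /= e2 normcE ltcR.
move=> [d d0 hd]; apply/nbhs_ballP; exists (cR d); first by rewrite /= ltcR.
by move=> w; rewrite -ball_normE /ball_ /= normcE ltcR; exact: hd.
Qed.

Lemma cvg_cplxP (I : Type) (F : set_system I) {FF : Filter F} (u : I -> cplx R) (l : cplx R) :
  u @ F --> l <-> forall e : R, 0 < e -> \forall i \near F, normc (u i - l) <= e.
Proof.
split.
  move=> /cvgrPdist_le h e e0; have e1 : 0 < cR e by rewrite ltcR.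
  by apply: filterS (h _ e1) => i; rewrite normcE lecR -normcN opprB.
move=> h; apply/cvgrPdist_le => e e0.
have e1 : 0 < complex.Re e by move: e0; rewrite ltcE => /andP[].
have e2 : e = cR (complex.Re e) by rewrite RRe_real // gtr0_real.
by apply: filterS (h _ e1) => i; rewrite e2 normcE lecR -normcN opprB.
Qed.

Lemma cvg_seq_cplxP (u : nat -> cplx R) (l : cplx R) :
  u @ \oo --> l <-> forall e : R, 0 < e -> exists N, forall n, (N <= n)%N -> normc (u n - l) <= e.
Proof.
split=> [/cvg_cplxP h e /h /near_inftyP //|h].
by apply/cvg_cplxP => e /h ?; apply/near_inftyP.
Qed.

(** Polar coordinates exhibit the disk as a continuous image of the square $[0,1]^2$. *)
Lemma compact_closed_disk : compact disk.
Proof.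
pose h (u : R * R) : cplx R := cR u.1 * val (circle_param u.2).
have -> : disk = h @` (`[0, 1]%classic `*` `[0, 1]%classic).
  apply/seteqP; split=> z.
    move=> /closed_diskP z1; have [w w1 zw] := polar_form z.
    have [w' ww'] := circle_exists w1; have [x x01 xw] := circle_param_surj w'.
    exists (normc z, x); first by split; rewrite /= in_itv /= ?normc_ge0.
    by rewrite -[LHS]/(cR (normc z) * val (circle_param x)) xw ww' -zw.
  move=> [[r x] [/= + _] <-]; rewrite in_itv /= => /andP[r0 r1].
  by apply/closed_diskP; rewrite /h Normc.normcM normc_real normc_circle mulr1 ger0_norm.
apply: continuous_compact; last by apply: compact_setX; exact: segment_compact.
apply: continuous_subspaceT => u.
have [cRe cIm] := @continuous_param_val R.
have c1 : (fun u : R * R => u.1 * complex.Re (val (circle_param u.2))) @ u -->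
    (u.1 * complex.Re (val (circle_param u.2)) : R^o).
  apply: (@cvgM _ _ _ _ (fun u : R * R => u.1) (fun u => complex.Re (val (circle_param u.2)))).
    exact: cvg_fst.
  exact: (@continuous_comp _ _ _ (fun u : R * R => u.2) _ u cvg_snd (cRe u.2)).
have c2 : (fun u : R * R => u.1 * complex.Im (val (circle_param u.2))) @ u -->
    (u.1 * complex.Im (val (circle_param u.2)) : R^o).
  apply: (@cvgM _ _ _ _ (fun u : R * R => u.1) (fun u => complex.Im (val (circle_param u.2)))).
    exact: cvg_fst.
  exact: (@continuous_comp _ _ _ (fun u : R * R => u.2) _ u cvg_snd (cIm u.2)).
apply/cvg_cplxP => e e0; have e2 : 0 < e / 2 by rewrite divr_gt0.
have /cvgrPdist_le /(_ _ e2) n1 := c1; have /cvgrPdist_le /(_ _ e2) n2 := c2.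
apply: filterS2 n1 n2 => v h1 h2.
have -> : h v - h u =
   - cR (u.1 * complex.Re (val (circle_param u.2)) - v.1 * complex.Re (val (circle_param v.2)))
   - 'i%C * cR (u.1 * complex.Im (val (circle_param u.2)) - v.1 * complex.Im (val (circle_param v.2))).
  rewrite /h; case: (val (circle_param u.2)) => a b; case: (val (circle_param v.2)) => a' b'.
  by simpc; congr (_ +i* _)%C; ring.
rewrite (splitr e); apply: le_trans (le_normcD _ _) _; rewrite !normcN.
apply: lerD; first by rewrite normc_real.
rewrite Normc.normcM normc_real (_ : normc _ = 1) ?mul1r //.
by rewrite /= expr0n expr1n add0r sqrtr1.
Qed.

(** A Lebesgue number argument: for a property that persists as [d] decreases, compactness turns
    locally valid radii into a common one. *)
Lemma disk_uniform (P : R -> C -> Prop) :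
  (forall d d' z, 0 < d' -> d' <= d -> P d z -> P d' z) ->
  (forall z, normc z <= 1 -> exists2 d, 0 < d &
     forall w, normc w <= 1 -> normc (z - w) < d -> P d w) ->
  exists2 d, 0 < d & forall z, normc z <= 1 -> P d z.
Proof.
move=> mono loc.
have /compact_near_coveringP/near_covering_withinP cov := compact_closed_disk.
have nr : \forall d \near (0 : R)^'+, disk `<=` P d.
  apply: cov => z /closed_diskP z1; have [d d0 hd] := loc z z1.
  exists ([set w : cplx R | normc (z - w) < d], [set d' | 0 < d' <= d]) => /=.
    split; first by apply/nbhs_cplxP; exists d.
    by near=> t; apply/andP; split; near: t; [exact: nbhs_right_gt|exact: nbhs_right_le].
  move=> [w d'] /= [zw /andP[d'0 d'd]] /closed_diskP w1; apply: (mono d) => //; exact: hd.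
have [d [hd d0]] : exists d : R, (disk `<=` P d) /\ 0 < d.
  by near (0 : R)^'+ => d; exists d; split; near: d => //; exact: nbhs_right_gt.
by exists d => // z /closed_diskP; exact: hd.
Unshelve. all: by end_near. Qed.

Section DiskAlgebraFunctions.
Variable f : cplx R -> cplx R.
Hypothesis cf : {within disk, continuous f}.

Lemma disk_continuous z e : normc z <= 1 -> 0 < e ->
  exists2 d, 0 < d & forall w, normc w <= 1 -> normc (z - w) < d -> normc (f w - f z) <= e.
Proof.
move=> /closed_diskP z1 e0.
have /cvg_cplxP /(_ e e0) /nbhs_cplxP [d d0 hd] := (subspace_continuousP _ _).1 cf z z1.
by exists d => // w /closed_diskP w1 h; exact: hd.
Qed.

Lemma disk_unif_continuous e : 0 < e -> exists2 d, 0 < d &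
  forall z w, normc z <= 1 -> normc w <= 1 -> normc (z - w) < d -> normc (f z - f w) <= e.
Proof.
move=> e0.
have [||d d0 hd] := @disk_uniform (fun d z => forall w, normc w <= 1 -> normc (z - w) < d -> normc (f z - f w) <= e).
- by move=> d d' z d'0 dd' h w w1 zw; apply: h => //; exact: lt_le_trans dd'.
- move=> z z1; have e2 : 0 < e / 2 by rewrite divr_gt0.
  have [d d0 hd] := disk_continuous z1 e2; have d2 : 0 < d / 2 by rewrite divr_gt0.
  exists (d / 2) => // w w1 zw v v1 wv.
  have -> : f w - f v = (f w - f z) - (f v - f z) by ring.
  rewrite (splitr e); apply: le_trans (le_normcD _ _) _; rewrite normcN; apply: lerD; apply: hd => //.
    by apply: lt_le_trans zw _; rewrite ler_pdivrMr // ler_peMr ?(ltW d0) // ler1n.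
  have -> : z - v = (z - w) + (w - v) by ring.
  by rewrite (splitr d); apply: le_lt_trans (le_normcD _ _) (ltrD zw wv).
by exists d => // z w z1 w1; exact: hd.
Qed.

Lemma disk_bounded : exists M, forall z, normc z <= 1 -> normc (f z) <= M.
Proof.
(* Writing the bound as [d^-1] gives the property the monotonicity that [disk_uniform] asks for. *)
have [||d d0 hd] := @disk_uniform (fun d z => normc (f z) <= d^-1).
- by move=> d d' z d'0 dd' h; apply: le_trans h _; rewrite lef_pV2 ?posrE // (lt_le_trans d'0).
- move=> z z1; have [d d0 hd] := disk_continuous z1 ltr01.
  pose M := normc (f z) + 1; have M0 : 0 < M by rewrite ltr_wpDl ?normc_ge0.
  exists (Num.min d M^-1); first by rewrite lt_min d0 invr_gt0.
  move=> w w1; rewrite lt_min => /andP[zw _].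
  apply: (@le_trans _ _ M).
    by rewrite -[f w](subrK (f z)) addrC; apply: le_trans (le_normcD _ _) _; rewrite lerD2l hd.
  by rewrite -[leLHS]invrK lef_pV2 ?posrE ?lt_min ?invr_gt0 ?d0 // ge_min lexx orbT.
by exists d^-1.
Qed.

Lemma le_sup_norm z : normc z <= 1 -> normc (f z) <= sup_norm f.
Proof.
move=> z1; have [M hM] := disk_bounded.
apply: ub_le_sup; last by exists z => //; exact/closed_diskP.
by exists M => _ [w /closed_diskP w1 <-]; exact: hM.
Qed.

Lemma on_circle_unif_continuous : circle_unif_continuous (on_circle f).
Proof.
move=> e /disk_unif_continuous [d d0 hd]; exists (d / 2); first by rewrite divr_gt0.
move=> z w zw; apply: hd; rewrite ?normc_circle //.
by apply: le_lt_trans zw _; rewrite ltr_pdivrMr // ltr_pMr // ltr1n.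
Qed.
End DiskAlgebraFunctions.

Lemma sup_norm_le (f : cplx R -> cplx R) M : (forall z, normc z <= 1 -> normc (f z) <= M) ->
  sup_norm f <= M.
Proof.
move=> fM; apply: ge_sup; first by exists (normc (f 0)), 0 => //; apply/closed_diskP; rewrite Normc.normc0.
by move=> _ [z /closed_diskP z1 <-]; exact: fM.
Qed.

Lemma disk_algebra_poly (p : {poly C}) : disk_algebra (fun z : cplx R => (p.[z] : cplx R)).
Proof.
elim/poly_ind: p => [|p c [cp dp]].
  rewrite (_ : (fun _ => _) = (cst 0 : cplx R -> cplx R)); last first.
    by apply/funext => z; rewrite horner0.
  split=> [|z _]; last exact: derivable_cst.
  by apply: continuous_subspaceT; exact: cst_continuous.
rewrite (_ : (fun _ => _) = (fun z : cplx R => (p.[z] : cplx R) * z + (c : cplx R))); last first.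
  by apply/funext => z; rewrite hornerMXaddC.
split=> [|z z1].
  move=> z; apply: (@cvgD _ (cplx R)); last exact: cvg_cst.
  apply: cvgM; first exact: cp.
  exact: (continuous_subspaceT (fun=> cvg_id)).
apply: derivableD; last exact: derivable_cst.
by apply: derivableM; [exact: dp|exact: derivable_id].
Qed.

Lemma tensor_rep_circle (Phi : cplx R -> cplx R -> cplx R) f g : tensor_rep Phi f g ->
  circle_rep (fun z w : circle => Phi (val z) (val w)) (fun n => on_circle (f n))
    (fun n => on_circle (g n)) (fun n => sup_norm (f n)) (fun n => sup_norm (g n)).
Proof.
move=> [df dg fg fgP].
have f1 n z : normc z <= 1 -> normc (f n z) <= sup_norm (f n) by apply: le_sup_norm; case: (df n).
have g1 n z : normc z <= 1 -> normc (g n z) <= sup_norm (g n) by apply: le_sup_norm; case: (dg n).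
have f0 n : 0 <= sup_norm (f n).
  by apply: le_trans (f1 n 0 _); rewrite ?normc_ge0 // Normc.normc0.
have g0 n : 0 <= sup_norm (g n).
  by apply: le_trans (g1 n 0 _); rewrite ?normc_ge0 // Normc.normc0.
have fg0 n : 0 <= sup_norm (f n) * sup_norm (g n) by rewrite mulr_ge0.
split.
- by move=> n; apply: on_circle_unif_continuous; case: (df n).
- by move=> n; apply: on_circle_unif_continuous; case: (dg n).
- by move=> n z; apply: f1; rewrite normc_circle.
- by move=> n z; apply: g1; rewrite normc_circle.
- apply: (@bounded_series_tail _ _ (limn (series (fun n => sup_norm (f n) * sup_norm (g n))))) => // n.
  have := nondecreasing_cvgn_le _ fg n; rewrite /series /= big_mkord; apply.
  by apply/nondecreasing_seqP => m; rewrite /series /= big_nat_recr //= lerDl.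
- move=> z w; apply/cvg_seq_cplxP.
  by apply: fgP; apply/normc_eq1; rewrite normc_circle.
Qed.
End DiskTopology.

(** * A tensor representation of the divided difference *)

Lemma leq_pred_exp2 n : (n <= 2 ^ n - 1)%N.
Proof. by have := ltn_expl n (isT : 1 < 2)%N; lia. Qed.

(* Block [i] consists of the [2 ^ i] indices [m] with [2 ^ i <= m.+1 < 2 ^ i.+1]. *)
Definition dyadic_block (m : nat) : nat := trunc_log 2 m.+1.
Definition dyadic_offset (m : nat) : nat := (m.+1 - 2 ^ dyadic_block m)%N.

(** A tensor representation is indexed by one natural number; over full blocks this returns to block
    and offset, $2^n-1$ being $1+2+\dots+2^{n-1}$. *)
Lemma sum_dyadic (V : zmodType) (G : nat -> nat -> V) n :
  \sum_(m < 2 ^ n - 1) G (dyadic_block m) (dyadic_offset m) =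
  \sum_(i < n) \sum_(r < 2 ^ i) G i r.
Proof.
elim: n => [|n IH]; first by rewrite !big_ord0.
have p := expn_gt0 2 n.
rewrite big_ord_recr /= -IH -(big_mkord xpredT (fun m => G (dyadic_block m) (dyadic_offset m))).
rewrite (@big_cat_nat _ _ _ (2 ^ n - 1)) //=; last by rewrite expnS; lia.
rewrite big_mkord; congr (_ + _).
have -> : (2 ^ n.+1 - 1 = 2 ^ n + (2 ^ n - 1))%N by rewrite expnS; lia.
rewrite -{1}[(2 ^ n - 1)%N]add0n big_addn addnK big_mkord; apply: eq_bigr => r _.
have rn := ltn_ord r.
have e : dyadic_block (r + (2 ^ n - 1)) = n.
  by apply: trunc_log_eq => //; rewrite expnS; lia.
by rewrite /dyadic_offset e; congr (G _ _); lia.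
Qed.

Lemma opoly_Xn (R : rcfType) (V : lmodType (complex R)) n (A : V -> V) x : opoly 'X^n A x = iter n A x.
Proof.
rewrite (@opoly_widen _ _ n.+1) ?size_polyXn // big_ord_recr /= coefXn eqxx scale1r big1 ?add0r // => i _.
by rewrite coefXn ltn_eqF // scale0r.
Qed.

Section BlockRepresentation.
Variable R : realType.
Local Notation C := (complex R).
Local Notation normc := (@Normc.normc R).
Local Notation cR := (real_complex R).
Local Notation disk := (@closed_disk R).
Variables (P : nat -> {poly C}) (a : nat -> R) (S : R) (phi : C -> C).
Hypotheses (sP : forall i, (size (P i) <= 2 ^ i %/ 2)%N)
  (Pa : forall i z, normc z = 1 -> normc (P i).[z] <= a i)
  (aS : forall n, \sum_(i < n) 2 ^+ i * a i <= S)
  (Pphi : forall z, normc z <= 1 -> forall e, 0 < e -> exists N, forall n, (N <= n)%N ->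
     normc (\sum_(i < n) (P i).[z] - phi z) <= e).

(* The first half of block [i] carries the tensors of [opoly_sub] with a monomial
   on the right, the second half those with a monomial on the left. *)
Definition block_left (i r : nat) : {poly C} :=
  let N := (2 ^ i %/ 2)%N in
  if (r < N)%N then divided_coef r.+1 r.+1 (P i) else 'X^(r - N).

Definition block_right (i r : nat) : {poly C} :=
  let N := (2 ^ i %/ 2)%N in
  if (r < N)%N then 'X^r else divided_coef (r - N) (r - N).+1 (P i).

Definition rep_left m := block_left (dyadic_block m) (dyadic_offset m).
Definition rep_right m := block_right (dyadic_block m) (dyadic_offset m).
(** The factor [4] is that of [divided_coef_le]; in either half of block $i$ the product with
    [bound_right] is [4 * a i]. *)
Definition bound_left m : R :=
  if (dyadic_offset m < 2 ^ dyadic_block m %/ 2)%N then 4 * a (dyadic_block m) else 1.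
Definition bound_right m : R :=
  if (dyadic_offset m < 2 ^ dyadic_block m %/ 2)%N then 1 else 4 * a (dyadic_block m).

Let a0 i : 0 <= a i.
Proof. exact: le_trans (normc_ge0 _) (Pa i (Normc.normc1 _)). Qed.

Let Xn_le1 n z : normc z <= 1 -> normc ('X^n : {poly C}).[z] <= 1.
Proof. by move=> z1; rewrite hornerXn normcX exprn_ile1 ?normc_ge0. Qed.

Lemma rep_left_le m z : normc z <= 1 -> normc (rep_left m).[z] <= bound_left m.
Proof.
rewrite /rep_left /block_left /bound_left; case: ifP => _ z1; last exact: Xn_le1.
by apply: divided_coef_le z1 => //; exact: Pa.
Qed.

Lemma rep_right_le m z : normc z <= 1 -> normc (rep_right m).[z] <= bound_right m.
Proof.
rewrite /rep_right /block_right /bound_right; case: ifP => _ z1; first exact: Xn_le1.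
by apply: divided_coef_le z1 => //; exact: Pa.
Qed.

Lemma bound_left_ge0 m : 0 <= bound_left m.
Proof. by rewrite /bound_left; case: ifP => _; rewrite ?mulr_ge0. Qed.

Lemma bound_right_ge0 m : 0 <= bound_right m.
Proof. by rewrite /bound_right; case: ifP => _; rewrite ?mulr_ge0. Qed.

(** After enlarging the partial sum to full blocks, block $i$ contributes $2^i$ equal products. *)
Lemma bound_sum n : \sum_(m < n) bound_left m * bound_right m <= 4 * S.
Proof.
have e m : bound_left m * bound_right m = 4 * a (dyadic_block m).
  by rewrite /bound_left /bound_right; case: ifP => _; rewrite ?mulr1 ?mul1r.
under eq_bigr => m _ do rewrite e.
have nn := leq_pred_exp2 n.
apply: (@le_trans _ _ (\sum_(m < 2 ^ n - 1) 4 * a (dyadic_block m))).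
  rewrite -!(big_mkord xpredT (fun m => 4 * a (dyadic_block m))) (big_cat_nat (leq0n n) nn) /=.
  by rewrite lerDl sumr_ge0 // => i _; rewrite mulr_ge0.
rewrite (sum_dyadic (fun i _ => 4 * a i)).
under eq_bigr => i _ do rewrite sumr_const card_ord -[_ *+ (2 ^ i)%N]mulr_natl natrX mulrCA.
by rewrite -mulr_sumr ler_wpM2l.
Qed.

Lemma bound_tail e : 0 < e -> exists N, forall n, (N <= n)%N ->
  \sum_(N <= m < n) bound_left m * bound_right m <= e.
Proof.
apply: bounded_series_tail bound_sum e => m.
by rewrite mulr_ge0 ?bound_left_ge0 ?bound_right_ge0.
Qed.

Lemma rep_opoly_sub (V : lmodType C) (A B : V -> V) x n : linear A -> linear B ->
  \sum_(m < 2 ^ n - 1) opoly (rep_left m) A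
      (A (opoly (rep_right m) B x) - B (opoly (rep_right m) B x)) =
  \sum_(i < n) (opoly (P i) A x - opoly (P i) B x).
Proof.
move=> lA lB.
rewrite (sum_dyadic (fun i r => opoly (block_left i r) A
      (A (opoly (block_right i r) B x) - B (opoly (block_right i r) B x)))).
apply: eq_bigr => i _; set N := (2 ^ i %/ 2)%N.
rewrite (opoly_sub x lA lB (sP i)) -/N.
(* Block $0$ has a single index and no halves; the size condition forces [P 0 = 0], so its one term
   vanishes. *)
have [i0|i0] := posnP i.
  have N0 : N = 0%N by rewrite /N i0.
  have P0 : P i = 0 by apply/eqP; rewrite -size_poly_eq0 -leqn0 -N0; exact: sP.
  rewrite N0 !big_ord0 addr0 i0 expn0 big_ord1 /block_left /block_right.
  have -> : (0 < 2 ^ 0 %/ 2)%N = false by [].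
  rewrite -i0 P0 /divided_coef size_poly0 poly_def big_ord0.
  have o0 (D : V -> V) y : opoly (0 : {poly C}) D y = 0 by rewrite /opoly size_poly0 big_ord0.
  rewrite !o0 opoly_Xn /=.
  by rewrite (linear_fun0 lA) (linear_fun0 lB) subrr.
have NN : (2 ^ i = N + N)%N.
  by rewrite /N -(prednK i0) expnS mulKn //; lia.
rewrite NN big_split_ord /=; congr (_ + _); apply: eq_bigr => k _.
  by rewrite /block_left /block_right -/N ltn_ord opoly_Xn.
by rewrite /block_left /block_right -/N ltnNge leq_addr /= addKn opoly_Xn.
Qed.

Definition rep_partial n z w : C := \sum_(m < n) (rep_left m).[z] * (rep_right m).[w].

(** This is [rep_opoly_sub] for the multiplications by [z] and [w] on [C^o]. *)
Lemma rep_partial_sub n z w :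
  rep_partial (2 ^ n - 1) z w * (z - w) = \sum_(i < n) (P i).[z] - \sum_(i < n) (P i).[w].
Proof.
have lin (c : C) : linear (fun y : C^o => c * y : C^o).
  by move=> b u v; rewrite mulrDr mulrCA.
have := rep_opoly_sub (1 : C^o) n (lin z) (lin w).
rewrite sumrB; under [X in _ = X - _ -> _]eq_bigr => i _ do rewrite opoly_mul mulr1.
under [X in _ = _ - X -> _]eq_bigr => i _ do rewrite opoly_mul mulr1.
move=> <-; rewrite /rep_partial mulr_suml; apply: eq_bigr => m _.
by rewrite !opoly_mul mulr1 -mulrBl; ring.
Qed.

Lemma rep_partial_tail N n z w e : (forall n, (N <= n)%N ->
   \sum_(N <= m < n) bound_left m * bound_right m <= e) ->
  normc z <= 1 -> normc w <= 1 -> (N <= n)%N -> normc (rep_partial n z w - rep_partial N z w) <= e.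
Proof.
move=> hN z1 w1 Nn; rewrite /rep_partial.
rewrite -!(big_mkord xpredT (fun m => (rep_left m).[z] * (rep_right m).[w])) (big_cat_nat (leq0n N) Nn) /=.
rewrite addrAC subrr add0r; apply: le_trans (normc_sum _ _ _) _; apply: le_trans (hN n Nn).
apply: ler_sum => m _; rewrite Normc.normcM; apply: ler_pM; rewrite ?normc_ge0 //.
  exact: rep_left_le.
exact: rep_right_le.
Qed.

(** Convergence is wanted uniformly on the closed bidisk, not only on the torus, because
    [disk_derivative] is a limit over points of the disk. *)
Lemma rep_limit : exists Psi : C -> C -> C, forall e, 0 < e -> exists N, forall n, (N <= n)%N ->
  forall z w, normc z <= 1 -> normc w <= 1 -> normc (rep_partial n z w - Psi z w) <= e.
Proof.
have ex (zw : C * C) : exists l, normc zw.1 <= 1 -> normc zw.2 <= 1 ->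
    forall e, 0 < e -> exists N, forall n, (N <= n)%N -> normc (rep_partial n zw.1 zw.2 - l) <= e.
  have [[z1 w1]|nz] := pselect (normc zw.1 <= 1 /\ normc zw.2 <= 1); last first.
    by exists 0 => z1 w1; case: nz.
  have [|l hl] := @cauchy_seq_complex _ (fun n => rep_partial n zw.1 zw.2); last by exists l.
  move=> e e0; have e2 : 0 < e / 2 by rewrite divr_gt0.
  have [N hN] := bound_tail e2; exists N => n m Nn Nm.
  have -> : rep_partial n zw.1 zw.2 - rep_partial m zw.1 zw.2 =
    (rep_partial n zw.1 zw.2 - rep_partial N zw.1 zw.2) - (rep_partial m zw.1 zw.2 - rep_partial N zw.1 zw.2).
    by ring.
  rewrite (splitr e); apply: le_trans (le_normcD _ _) _; rewrite normcN.
  by apply: lerD; apply: rep_partial_tail.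
have [L hL] := choice ex.
exists (fun z w => L (z, w)) => e e0; have e2 : 0 < e / 2 by rewrite divr_gt0.
have [N hN] := bound_tail e2; exists N => n Nn z w z1 w1.
apply: (@le_eps _ _ _ 1) => d d0; rewrite mulr1.
have [M hM] := hL (z, w) z1 w1 d d0.
have := hM (maxn N M) (leq_maxr _ _).
have h1 := rep_partial_tail hN z1 w1 Nn.
have h2 := rep_partial_tail hN z1 w1 (leq_maxl N M).
move=> /= h3.
have -> : rep_partial n z w - L (z, w) = (rep_partial n z w - rep_partial N z w)
   - (rep_partial (maxn N M) z w - rep_partial N z w) + (rep_partial (maxn N M) z w - L (z, w)) by ring.
apply: le_trans (le_normcD _ _) _; apply: lerD => //.
by rewrite (splitr e); apply: le_trans (le_normcD _ _) _; rewrite normcN lerD.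
Qed.

Lemma le_eps_eq (x y : C) (M : R) : (forall e : R, 0 < e -> normc (x - y) <= e * M) -> x = y.
Proof.
move=> h; apply/eqP; rewrite -subr_eq0; apply/eqP/Normc.eq0_normc/eqP.
by rewrite eq_le normc_ge0 andbT; apply: (@le_eps _ _ _ M) => e /h; rewrite add0r.
Qed.

(** Properness makes the limit in [disk_derivative] unique; the points $(1-t)z$ of the radius
    approach [z] inside the disk. *)
Lemma proper_within_disk (z : cplx R) : normc z = 1 -> ProperFilter (within disk z^').
Proof.
move=> z1; apply: Build_ProperFilter_ex => D.
move=> /nbhs_cplxP [d d0 hd].
pose t := Num.min d 1 / 2.
have m0 : 0 < Num.min d 1 by rewrite lt_min d0 ltr01.
have t0 : 0 < t by rewrite divr_gt0.
have td : t < d by rewrite /t ltr_pdivrMr // gt_min; apply/orP; left; lra.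
have t1 : t < 1 by rewrite /t ltr_pdivrMr // gt_min; apply/orP; right; lra.
exists (cR (1 - t) * z); apply: hd.
- have -> : z - cR (1 - t) * z = cR t * z by rewrite rmorphB rmorph1; ring.
  by rewrite Normc.normcM z1 mulr1 normc_real gtr0_norm.
- apply/eqP => e; have : cR t * z = z - cR (1 - t) * z by rewrite rmorphB rmorph1; ring.
  by rewrite e subrr => /(congr1 normc); rewrite Normc.normcM z1 mulr1 normc_real gtr0_norm // Normc.normc0; lra.
- by apply/closed_diskP; rewrite Normc.normcM z1 mulr1 normc_real ger0_norm; lra.
Qed.

(** Off the diagonal [rep_partial_sub] passes to the limit. On it the difference quotients are
    $\Psi(u,z)$, and $\Psi(\cdot,z)$ is continuous as a uniform limit of polynomials. *)
Lemma divided_difference_limit Psi : (forall e, 0 < e -> exists N, forall n, (N <= n)%N ->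
  forall z w, normc z <= 1 -> normc w <= 1 -> normc (rep_partial n z w - Psi z w) <= e) ->
  forall z w, normc z = 1 -> normc w = 1 -> divided_difference phi z w = Psi z w.
Proof.
move=> hPsi.
have quot z w : normc z <= 1 -> normc w <= 1 -> z != w -> (phi z - phi w) / (z - w) = Psi z w.
  move=> z1 w1 zw; have zw0 : z - w != 0 by rewrite subr_eq0.
  apply: (mulIf zw0); rewrite divfK //; apply: (@le_eps_eq _ _ (2 + normc (z - w))) => e e0.
  have [N hN] := hPsi e e0; have [N1 hN1] := Pphi z1 e0; have [N2 hN2] := Pphi w1 e0.
  pose n := maxn N (maxn N1 N2).
  have h1 := hN1 n (leq_trans (leq_maxl _ _) (leq_maxr _ _)).
  have h2 := hN2 n (leq_trans (leq_maxr _ _) (leq_maxr _ _)).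
  have nn : (N <= 2 ^ n - 1)%N := leq_trans (leq_maxl _ _) (leq_pred_exp2 n).
  have h3 := hN _ nn z w z1 w1.
  have -> : phi z - phi w - Psi z w * (z - w) =
     - (\sum_(i < n) (P i).[z] - phi z) + (\sum_(i < n) (P i).[w] - phi w)
     + (rep_partial (2 ^ n - 1) z w - Psi z w) * (z - w).
    by rewrite [in RHS]mulrBl rep_partial_sub; ring.
  have -> : e * (2 + normc (z - w)) = (e + e) + e * normc (z - w) by ring.
  apply: le_trans (le_normcD _ _) _; apply: lerD.
    by apply: le_trans (le_normcD _ _) _; rewrite normcN lerD.
  by rewrite Normc.normcM ler_wpM2r ?normc_ge0.
move=> z w z1 w1; rewrite /divided_difference; case: eqP => [<-|/eqP zw]; last first.
  by apply: quot; rewrite ?z1 ?w1.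
have PF := proper_within_disk z1.
apply: cvg_lim; first exact: norm_hausdorff.
apply/cvg_cplxP => e e0; have e4 : 0 < e / 4 by rewrite divr_gt0.
have e2 : 0 < e / 2 by rewrite divr_gt0.
have [N hN] := hPsi _ e4; have {}hN := hN N (leqnn N).
pose p : {poly C} := \sum_(m < N) (rep_right m).[z] *: rep_left m.
have pE u : p.[u] = rep_partial N u z.
  by rewrite horner_sum; apply: eq_bigr => m _; rewrite hornerZ mulrC.
have z1' : normc z <= 1 by rewrite z1.
have [d d0 hd] := disk_continuous (disk_algebra_poly p).1 z1' e2.
apply/nbhs_cplxP; exists d => // u zu uz /closed_diskP u1.
rewrite /= quot //.
have := hd u u1 zu; rewrite !pE => h1; have h2 := hN u z u1 z1'; have h3 := hN z z z1' z1'.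
have -> : Psi u z - Psi z z = - (rep_partial N u z - Psi u z) + (rep_partial N z z - Psi z z)
   + (rep_partial N u z - rep_partial N z z) by ring.
apply: le_trans (le_normcD _ _) _; rewrite (splitr e); apply: lerD => //.
have -> : e / 2 = e / 4 + e / 4 by lra.
by apply: le_trans (le_normcD _ _) _; rewrite normcN lerD.
Qed.

Lemma tensor_rep_blocks : tensor_rep (divided_difference phi)
  (fun m (z : cplx R) => (rep_left m).[z] : cplx R) (fun m (z : cplx R) => (rep_right m).[z] : cplx R).
Proof.
split=> [n|n||z w].
- exact: disk_algebra_poly.
- exact: disk_algebra_poly.
- have n0 (p : {poly C}) : 0 <= sup_norm (fun z : cplx R => p.[z] : cplx R).
    apply: le_trans (le_sup_norm (disk_algebra_poly p).1 (z := 0) _); rewrite ?normc_ge0 //.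
    by rewrite Normc.normc0.
  apply: nondecreasing_is_cvgn.
    by apply/nondecreasing_seqP => m; rewrite /series /= big_nat_recr //= lerDl mulr_ge0.
  exists (4 * S) => _ [n _ <-]; rewrite /series /= big_mkord; apply: le_trans (bound_sum n).
  apply: ler_sum => m _; apply: ler_pM => //; apply: sup_norm_le => z.
    exact: rep_left_le.
  exact: rep_right_le.
- move=> /normc_eq1 z1 /normc_eq1 w1; have [Psi hPsi] := rep_limit.
  rewrite (divided_difference_limit hPsi) //; apply/cvg_seq_cplxP => e /hPsi [N hN].
  by exists N => n Nn; rewrite /series /= big_mkord; apply: hN; rewrite ?z1 ?w1.
Qed.
End BlockRepresentation.

Section OpolyLinear.
Variables (R : rcfType) (V : lmodType (complex R)).
Local Notation C := (complex R).
Implicit Types p q : {poly C}.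

Lemma opolyB p q (A : V -> V) x : opoly (p - q) A x = opoly p A x - opoly q A x.
Proof.
pose N := maxn (size p) (size q).
have hpq : (size (p - q)%R <= N)%N.
  by apply: leq_trans (size_polyD _ _) _; rewrite size_polyN.
rewrite (opoly_widen A x hpq) (opoly_widen A x (leq_maxl _ _ : (size p <= N)%N)).
rewrite (opoly_widen A x (leq_maxr _ _ : (size q <= N)%N)) -sumrB.
by apply: eq_bigr => i _; rewrite coefB scalerBl.
Qed.

Lemma opoly_sum n (P : nat -> {poly C}) (A : V -> V) x :
  opoly (\sum_(i < n) P i) A x = \sum_(i < n) opoly (P i) A x.
Proof.
elim: n => [|n IH]; first by rewrite !big_ord0 /opoly size_poly0 big_ord0.
rewrite !big_ord_recr /= -IH; apply/eqP; rewrite -subr_eq -opolyB; apply/eqP.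
by rewrite addrK.
Qed.

Lemma opoly_linear p (A : V -> V) : linear A -> linear (opoly p A).
Proof.
move=> lA c x y; rewrite /opoly scaler_sumr -big_split; apply: eq_bigr => i _ /=.
by rewrite iter_linear // scalerDr !scalerA mulrC.
Qed.
End OpolyLinear.

(** * Differentiation under the sum *)

Section Differentiation.
Variable R : realType.
Local Notation C := (complex R).
Local Notation normc := (@Normc.normc R).
Local Notation cR := (real_complex R).
Local Notation circle := (circle R).
Variables (P : nat -> {poly C}) (a : nat -> R) (S : R) (phi : C -> C).
Hypotheses (sP : forall i, (size (P i) <= 2 ^ i %/ 2)%N)
  (Pa : forall i z, normc z = 1 -> normc (P i).[z] <= a i)
  (aS : forall n, \sum_(i < n) 2 ^+ i * a i <= S)
  (Pphi : forall z, normc z <= 1 -> forall e, 0 < e -> exists N, forall n, (N <= n)%N ->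
     normc (\sum_(i < n) (P i).[z] - phi z) <= e).
Variables (H : hilbertType R) (T0 T1 : H -> H).
Hypotheses (hT0 : contraction_op T0) (hT1 : contraction_op T1).
Variable (E : R -> set circle -> H -> H).
Hypothesis hE : forall t : R, 0 <= t <= 1 -> semi_spectral_of (op_segment T0 T1 t) (E t).

Local Notation Tt := (op_segment T0 T1).
Local Notation Q := (fun x => T1 x - T0 x).

Let partial n : {poly C} := \sum_(i < n) P i.
Let l m := rep_left P m.
Let r m := rep_right P m.
Let bl m := bound_left a m.
Let br m := bound_right a m.

Let bl0 m : 0 <= bl m. Proof. exact: (bound_left_ge0 Pa). Qed.
Let br0 m : 0 <= br m. Proof. exact: (bound_right_ge0 Pa). Qed.

Lemma segment_linear t : linear (Tt t).
Proof.
have [l0 _] := hT0; have [l1 _] := hT1.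
move=> c x y; rewrite /op_segment l0 l1 !scalerDr !scalerA.
by rewrite [cR (1 - t) * c]mulrC [cR t * c]mulrC addrACA.
Qed.

Lemma diff_linear : linear Q.
Proof.
have [l0 _] := hT0; have [l1 _] := hT1.
by move=> c x y; rewrite l0 l1 scalerBr opprD addrACA.
Qed.

Lemma diff_bound x : rnorm (Q x) <= 2 * rnorm x.
Proof.
have [_ /opnorm_leP b0] := hT0; have [_ /opnorm_leP b1] := hT1.
apply: le_trans (rnormB _ _) _; rewrite mulr2n mulrDl; apply: lerD.
  exact: b1.
exact: b0.
Qed.

Lemma segment_sub s t x : Tt s x - Tt t x = cR (s - t) *: Q x.
Proof.
rewrite /op_segment opprD addrACA -!scalerBl -!rmorphB.
have -> : 1 - s - (1 - t) = - (s - t) by ring.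
by rewrite rmorphN scaleNr addrC scalerBr.
Qed.

Lemma calculus_bound t (p : {poly C}) M x : 0 <= t <= 1 ->
  (forall z, normc z = 1 -> normc p.[z] <= M) -> rnorm (opoly p (Tt t) x) <= M * rnorm x.
Proof. by move=> t01; exact: (von_neumann (hE t01)). Qed.

Lemma partial_unif e : 0 < e -> exists N, forall n, (N <= n)%N -> forall z, normc z <= 1 ->
  normc ((partial n).[z] - phi z) <= e.
Proof.
move=> e0.
have a0 i : 0 <= a i by exact: le_trans (normc_ge0 _) (Pa i (Normc.normc1 _)).
have b0 i : 0 <= 2 ^+ i * a i by rewrite mulr_ge0 // exprn_ge0.
have [N hN] := bounded_series_tail b0 aS e0.
exists N => n Nn z z1; rewrite /partial horner_sum.
apply: (@le_eps _ _ _ 1) => d d0; rewrite mulr1.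
(* The index [M] depends on [z], but the tail between [n] and [maxn n M] is bounded uniformly. *)
have [M hM] := Pphi z1 d0; have {}hM := hM (maxn n M) (leq_maxr _ _).
rewrite -(subrKA (\sum_(i < maxn n M) (P i).[z])); apply: le_trans (le_normcD _ _) (lerD _ hM).
rewrite -normcN opprB -!(big_mkord xpredT (fun i => (P i).[z])).
rewrite (big_cat_nat (leq0n n) (leq_maxl n M)) /= addrAC subrr add0r.
apply: le_trans (normc_sum _ _ _) _; apply: le_trans (hN _ (leq_trans Nn (leq_maxl n M))).
apply: (@le_trans _ _ (\sum_(n <= i < maxn n M) 2 ^+ i * a i)).
  apply: ler_sum => i _; apply: (@le_trans _ _ (a i)).
    by apply: poly_max_principle z1; exact: Pa.
  by rewrite ler_peMl // exprn_ege1 // ler1n.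
by rewrite [leRHS](big_cat_nat Nn (leq_maxl n M)) /= lerDr sumr_ge0.
Qed.

(** The range of [t] is a premise under the existential, so that [choice] yields one family defined
    for all [t]. *)
Lemma calculus_exists t : exists B, 0 <= t <= 1 -> op_cvg \oo (fun n => opoly (partial n) (Tt t)) B.
Proof.
have [t01|nt] := pselect (0 <= t <= 1); last by exists id.
suff [B hB] : exists B, op_cvg \oo (fun n => opoly (partial n) (Tt t)) B by exists B.
apply: op_cauchy_cvg => e e0; have e2 : 0 < e / 2 by rewrite divr_gt0.
have [N hN] := partial_unif e2; exists N => n m Nn Nm x.
rewrite -opolyB; apply: calculus_bound => // z z1.
have -> : (partial n - partial m).[z] = ((partial n).[z] - phi z) - ((partial m).[z] - phi z).
  by rewrite hornerD hornerN; ring.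
rewrite (splitr e); apply: le_trans (le_normcD _ _) _.
by rewrite normcN lerD // hN // z1.
Qed.

(** By the von Neumann inequality, two polynomials that are both uniformly close to [phi] give
    operators that are close in norm. *)
Lemma calculus_disk t B : 0 <= t <= 1 -> op_cvg \oo (fun n => opoly (partial n) (Tt t)) B ->
  disk_calculus phi (Tt t) B.
Proof.
move=> t01 hB; split.
  exists partial => e e0; have [N hN] := partial_unif e0.
  by apply/near_inftyP; exists N => n Nn z /closed_diskP z1; rewrite normcE lecR hN.
move=> p hp; apply/op_cvgP => e e0.
have e3 : 0 < e / 3 by rewrite divr_gt0.
have /near_inftyP [N hN] := hp _ e3.
have [N1 hN1] := partial_unif e3; have [N2 hN2] := (op_cvgP _ _).1 hB _ e3.
exists N => n Nn x; pose m := maxn N1 N2.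
apply: le_trans (rnorm_trans (opoly (partial m) (Tt t) x) _ _) _.
have -> : e * rnorm x = (e / 3 + e / 3) * rnorm x + e / 3 * rnorm x by field.
apply: lerD; last exact: hN2 (leq_maxr _ _) x.
rewrite -[poly_calculus _ _ _]/(opoly (p n) (Tt t) x) -opolyB.
apply: calculus_bound => // z z1; have z1' : normc z <= 1 by rewrite z1.
have -> : (p n - partial m).[z] = ((p n).[z] - phi z) - ((partial m).[z] - phi z).
  by rewrite hornerD hornerN; ring.
apply: le_trans (le_normcD _ _) _; rewrite normcN; apply: lerD.
  have /closed_diskP dz := z1'; have := hN n Nn z dz.
  by rewrite normcE lecR.
exact: hN1 (leq_maxl _ _) z z1'.
Qed.

Lemma rep_term_bound s t m x : 0 <= s <= 1 -> 0 <= t <= 1 ->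
  rnorm (opoly (l m) (Tt s) (Q (opoly (r m) (Tt t) x))) <= 2 * (bl m * br m) * rnorm x.
Proof.
move=> s01 t01.
apply: le_trans (calculus_bound (M := bl m) _ s01 _) _.
  by move=> z z1; apply: (rep_left_le Pa); rewrite z1.
apply: (@le_trans _ _ (bl m * (2 * (br m * rnorm x)))); last first.
  by rewrite le_eqVlt; apply/orP; left; apply/eqP; ring.
rewrite ler_wpM2l //; apply: le_trans (diff_bound _) _; rewrite ler_wpM2l //.
by apply: calculus_bound => // z z1; apply: (rep_right_le Pa); rewrite z1.
Qed.

Lemma rep_tail_bound s t N n e x : 0 <= s <= 1 -> 0 <= t <= 1 ->
  \sum_(N <= m < n) bl m * br m <= e ->
  rnorm (\sum_(N <= m < n) opoly (l m) (Tt s) (Q (opoly (r m) (Tt t) x))) <= 2 * e * rnorm x.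
Proof.
move=> s01 t01 h; apply: le_trans (rnorm_sum _ _ _) _.
apply: (@le_trans _ _ (\sum_(N <= m < n) 2 * (bl m * br m) * rnorm x)).
  by apply: ler_sum => m _; exact: rep_term_bound.
by rewrite -mulr_suml -mulr_sumr ler_wpM2r ?rnorm_ge0 // ler_wpM2l.
Qed.

Lemma double_exists t : 0 <= t <= 1 ->
  exists D, op_cvg \oo (sandwich Q (fun m => opoly (l m) (Tt t)) (fun m => opoly (r m) (Tt t))) D.
Proof.
move=> t01; apply: op_cauchy_cvg => e e0.
have e2 : 0 < e / 2 by rewrite divr_gt0.
have e4 : 0 < e / 2 / 2 by rewrite divr_gt0.
have [N hN] := bound_tail Pa aS e4; exists N.
have h n x : (N <= n)%N -> rnorm (sandwich Q (fun m => opoly (l m) (Tt t)) (fun m => opoly (r m) (Tt t)) n x -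
  sandwich Q (fun m => opoly (l m) (Tt t)) (fun m => opoly (r m) (Tt t)) N x) <= e / 2 * rnorm x.
  move=> Nn; rewrite /sandwich (big_cat_nat (leq0n N) Nn) /= addrAC subrr add0r.
  have -> : e / 2 * rnorm x = 2 * (e / 2 / 2) * rnorm x by field.
  by apply: rep_tail_bound => //; exact: hN.
move=> n m Nn Nm x; rewrite (splitr e) mulrDl.
apply: le_trans (rnorm_trans (sandwich Q (fun m => opoly (l m) (Tt t)) (fun m => opoly (r m) (Tt t)) N x) _ _) _.
by apply: lerD; [exact: h|rewrite rnormBC; exact: h].
Qed.

(** The factors of the block representation are polynomials of $T_t$, which [int_approx_poly]
    recognizes as integrals; [sandwich_cvg] carries the limit over to every other representation. *)
Lemma double_op t D : 0 <= t <= 1 ->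
  op_cvg \oo (sandwich Q (fun m => opoly (l m) (Tt t)) (fun m => opoly (r m) (Tt t))) D ->
  double_op_int (divided_difference phi) (E t) Q (E t) D.
Proof.
move=> t01 hD; have trep := tensor_rep_blocks sP Pa aS Pphi.
split; first by exists (fun m z => (rep_left P m).[z]), (fun m z => (rep_right P m).[z]).
move=> f g fg; have hf := tensor_rep_circle fg; have h0 := tensor_rep_circle trep.
have hA := hE t01.
have [F hF] := choice (fun n => semi_spectral_int_exists hA (rep_ucl hf n)).
have [G hG] := choice (fun n => semi_spectral_int_exists hA (rep_ucr hf n)).
exists F, G; split=> [n|n|]; [by have [] := hF n|by have [] := hG n|].
have fF n : int_approx (E t) (on_circle (f n)) (F n) by have [] := hF n.
have gG n : int_approx (E t) (on_circle (g n)) (G n) by have [] := hG n.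
apply: (sandwich_cvg hA diff_linear diff_bound _ hf h0 fF gG _ _ hD) => // m.
  exact: (@int_approx_poly _ _ _ _ hA (l m)).
exact: (@int_approx_poly _ _ _ _ hA (r m)).
Qed.

(** Each of the [2 * size p] terms of [opoly_sub] has a factor of norm at most $4M$, a power of norm
    at most $1$ and a middle factor of norm at most $2|s-t|$, whence the $16$. *)
Lemma opoly_lipschitz s t (p : {poly C}) M x : 0 <= s <= 1 -> 0 <= t <= 1 ->
  (forall z, normc z = 1 -> normc p.[z] <= M) ->
  rnorm (opoly p (Tt s) x - opoly p (Tt t) x) <= 16 * (size p)%:R * M * `|s - t| * rnorm x.
Proof.
move=> s01 t01 pM.
have M0 : 0 <= M by apply: le_trans (normc_ge0 _) (pM 1 (Normc.normc1 _)).
have X1 k z : normc z = 1 -> normc ('X^k : {poly C}).[z] <= 1.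
  by move=> z1; rewrite hornerXn normcX z1 expr1n.
have dc k k' : (k' <= k.+1)%N -> forall z, normc z = 1 -> normc (divided_coef k k' p).[z] <= 4 * M.
  by move=> kk z z1; apply: divided_coef_le => //; rewrite z1.
have dif y : rnorm (Tt s y - Tt t y) <= `|s - t| * (2 * rnorm y).
  by rewrite segment_sub rnormZ normc_real ler_wpM2l // diff_bound.
rewrite (opoly_sub x (segment_linear s) (segment_linear t) (leqnn _)).
have sc (y : R) : \sum_(k < size p) y = (size p)%:R * y.
  by rewrite sumr_const card_ord mulr_natl.
have -> : 16 * (size p)%:R * M * `|s - t| * rnorm x =
  \sum_(k < size p) (4 * M * (`|s - t| * (2 * (1 * rnorm x)))) +
  \sum_(k < size p) (1 * (`|s - t| * (2 * (4 * M * rnorm x)))).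
  by rewrite !sc; ring.
apply: le_trans (rnormD _ _) _; apply: lerD; apply: le_trans (rnorm_sum _ _ _) _; apply: ler_sum => k _.
  apply: le_trans (calculus_bound _ s01 (dc _ _ _)) _ => //.
  rewrite ler_wpM2l ?mulr_ge0 //; apply: le_trans (dif _) _; rewrite ler_wpM2l // ler_wpM2l //.
  by rewrite -opoly_Xn; exact: calculus_bound t01 (X1 _).
rewrite -opoly_Xn; apply: le_trans (calculus_bound _ s01 (X1 _)) _.
rewrite ler_wpM2l //; apply: le_trans (dif _) _; rewrite ler_wpM2l // ler_wpM2l //.
exact: calculus_bound t01 (dc _ _ _).
Qed.

Lemma derivative t D (F : R -> H -> H) : 0 <= t <= 1 ->
  (forall s, 0 <= s <= 1 -> op_cvg \oo (fun n => opoly (partial n) (Tt s)) (F s)) ->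
  op_cvg \oo (sandwich Q (fun m => opoly (l m) (Tt t)) (fun m => opoly (r m) (Tt t))) D ->
  op_derivative_within `[0, 1] F t D.
Proof.
move=> t01 hF hD e e0.
(* Each of two tails is at most [2 * (e / 8)]; with [e / 4] for the moving left factors this makes
   three quarters of [e]. *)
have e8 : 0 < e / 8 by rewrite divr_gt0.
have [N hN] := bound_tail Pa aS e8.
(* The Lipschitz constant of the left factor, times $2$ for [Q] and [br m] for the right factor. *)
pose c m := 16 * (size (l m))%:R * bl m * 2 * br m.
have c0 m : 0 <= c m by rewrite !mulr_ge0.
pose W := \sum_(m < N) c m + 1.
have W0 : 0 < W by rewrite ltr_wpDl // sumr_ge0.
have d0 : 0 < e / 4 / W by rewrite !divr_gt0.
apply/nbhs_ballP; exists (e / 4 / W) => // s; rewrite /ball /= => st nst.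
rewrite in_itv /= => s01; apply/opnorm_leP => x.
have st0 : s - t != 0 by rewrite subr_eq0.
pose G u n := \sum_(0 <= m < n) opoly (l m) (Tt u) (Q (opoly (r m) (Tt t) x)).
(* Over full blocks the difference quotient is an exact finite sum, with left factors at [s] and
   right factors at [t]. *)
have quot n : cR (s - t)^-1 *: (opoly (partial n) (Tt s) x - opoly (partial n) (Tt t) x) = G s (2 ^ n - 1)%N.
  have := rep_opoly_sub sP x n (segment_linear s) (segment_linear t).
  rewrite sumrB /partial !opoly_sum => <-; rewrite scaler_sumr /G big_mkord; apply: eq_bigr => m _.
  rewrite segment_sub (linear_funZ (opoly_linear _ (segment_linear s))) scalerA.
  by rewrite -rmorphM mulVf // scale1r.
have near_t n : (N <= n)%N -> rnorm (G s n - G t n) <= 3 / 4 * e * rnorm x.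
  move=> Nn; rewrite /G !(big_cat_nat (leq0n N) Nn) /= opprD addrACA.
  have -> : 3 / 4 * e * rnorm x = e / 4 * rnorm x + (2 * (e / 8) * rnorm x + 2 * (e / 8) * rnorm x) by field.
  apply: le_trans (rnormD _ _) _; apply: lerD; last first.
    apply: le_trans (rnormB _ _) _; apply: lerD; apply: rep_tail_bound => //; exact: hN.
  rewrite -sumrB; apply: le_trans (rnorm_sum _ _ _) _.
  apply: (@le_trans _ _ (\sum_(0 <= m < N) c m * (`|s - t| * rnorm x))).
    apply: ler_sum => m _.
    apply: le_trans (opoly_lipschitz (M := bl m) _ s01 t01 _) _.
      by move=> z z1; apply: (rep_left_le Pa); rewrite z1.
    have -> : c m * (`|s - t| * rnorm x) = 16 * (size (l m))%:R * bl m * `|s - t| * (2 * (br m * rnorm x)).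
      by rewrite /c; ring.
    rewrite ler_wpM2l ?mulr_ge0 //; apply: le_trans (diff_bound _) _; rewrite ler_wpM2l //.
    by apply: calculus_bound => // z z1; apply: (rep_right_le Pa); rewrite z1.
  rewrite -mulr_suml mulrA ler_wpM2r ?rnorm_ge0 // big_mkord.
  apply: (@le_trans _ _ (W * (e / 4 / W))).
    apply: ler_pM => //; first by rewrite sumr_ge0.
      by rewrite /W lerDl.
    by rewrite distrC ltW.
  by rewrite mulrC divfK // lt0r_neq0.
apply: (@le_eps _ _ _ (3 * rnorm x)) => d dd0.
(* With [s] fixed, the number of terms may depend on it: the errors of both values of [F] are made
   small relative to $|s-t|$. *)
have ds0 : 0 < d * `|s - t| by rewrite mulr_gt0 // normr_gt0.
have [N1 hN1] := (op_cvgP _ _).1 (hF s s01) _ ds0.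
have [N2 hN2] := (op_cvgP _ _).1 (hF t t01) _ ds0.
have [N3 hN3] := (op_cvgP _ _).1 hD _ dd0.
pose n := maxn (maxn N1 N2) (maxn N3 N).
have n1 := hN1 n (leq_trans (leq_maxl _ _) (leq_maxl _ _)) x.
have n2 := hN2 n (leq_trans (leq_maxr _ _) (leq_maxl _ _)) x.
have big := leq_pred_exp2 n.
have n3 := hN3 _ (leq_trans (leq_trans (leq_maxl N3 N) (leq_maxr (maxn N1 N2) _)) big) x.
have n4 := near_t _ (leq_trans (leq_trans (leq_maxr N3 N) (leq_maxr (maxn N1 N2) _)) big).
have inv y : rnorm y <= d * `|s - t| * rnorm x -> rnorm (cR (s - t)^-1 *: y) <= d * rnorm x.
  move=> h; rewrite rnormZ normc_real normfV mulrC ler_pdivrMr ?normr_gt0 //.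
  by rewrite mulrAC.
have -> : cR (s - t)^-1 *: (F s x - F t x) - D x =
   - (cR (s - t)^-1 *: (opoly (partial n) (Tt s) x - F s x)) +
   cR (s - t)^-1 *: (opoly (partial n) (Tt t) x - F t x) +
   ((G s (2 ^ n - 1)%N - G t (2 ^ n - 1)%N) + (G t (2 ^ n - 1)%N - D x)).
  rewrite -quot subrKA addrA; congr (_ - _); rewrite -scalerN -!scalerDr; congr (_ *: _).
  by rewrite opprB addrAC !subrKA.
apply: le_trans (rnormD _ _) _.
have -> : e * rnorm x + d * (3 * rnorm x) = (d * rnorm x + d * rnorm x) + (e * rnorm x + d * rnorm x) by ring.
apply: lerD; apply: le_trans (rnormD _ _) _; apply: lerD.
- by rewrite rnormN; exact: inv.
- exact: inv.
- apply: le_trans n4 _; rewrite ler_wpM2r ?rnorm_ge0 //; lra.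
- exact: n3.
Qed.
End Differentiation.

Theorem theorem5p1 (K : realType) (H : hilbertType K) (T R : H -> H)
    (hT : contraction_op T) (hR : contraction_op R)
    (E : K -> set (circle K) -> H -> H)
    (hE : forall t : K, 0 <= t <= 1 ->
      semi_spectral_of (op_segment T R t) (E t))
    (f : circle K -> complex K) (hf : besov_plus 1 +oo%E 1%:E f) :
  exists F : K -> H -> H,
    (forall t : K, 0 <= t <= 1 ->
       disk_calculus (analytic_ext f) (op_segment T R t) (F t)) /\
    (forall t : K, 0 <= t <= 1 ->
       exists2 D : H -> H,
         double_op_int (divided_difference (analytic_ext f))
           (E t) (fun x => R x - T x) (E t) D &
         op_derivative_within `[0, 1] F t D).
Proof.
have [a [fa [S aS]]] := besov_bounds hf.
have ext := analytic_ext_blocks fa aS.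
have a0 n : 0 <= a n by apply: le_trans (normc_ge0 _) (fa n 1 (Normc.normc1 _)).
(* The shift by two makes [P i] fit into half of a block of [2 ^ i] indices. *)
pose P i : {poly complex K} := if i is j.+2 then besov_poly f j else 0.
pose b i : K := if i is j.+2 then a j else 0.
have sP i : (size (P i) <= 2 ^ i %/ 2)%N.
  case: i => [|[|i]]; rewrite ?size_poly0 //= expnS mulKn //; exact: size_poly.
have Pb i z : Normc.normc z = 1 -> Normc.normc (P i).[z] <= b i.
  by case: i => [|[|i]] z1; rewrite /= ?horner0 ?Normc.normc0 //; exact: fa.
have bS n : \sum_(i < n) 2 ^+ i * b i <= 4 * S.
  apply: (@le_trans _ _ (\sum_(i < n.+2) 2 ^+ i * b i)).
    by rewrite !big_ord_recr /= -addrA lerDl addr_ge0 // mulr_ge0 ?exprn_ge0 //; case: (n) => [|[|]] /=.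
  rewrite !big_ord_recl /= !mulr0 !add0r.
  rewrite (eq_bigr (fun i : 'I_n => 4 * (2 ^+ i * a i))); last first.
    by move=> i _; rewrite /bump /= !add1n !exprS; ring.
  by rewrite -mulr_sumr ler_pM2l ?aS.
have Pf z : Normc.normc z <= 1 -> forall e, 0 < e -> exists N, forall n, (N <= n)%N ->
    Normc.normc (\sum_(i < n) (P i).[z] - analytic_ext f z) <= e.
  move=> z1 e e0; have [N hN] := ext z z1 e e0; exists N.+2 => -[|[|n]] // Nn.
  by rewrite !big_ord_recl /= !horner0 !add0r; apply: hN.
have [F hF] := choice (calculus_exists Pb bS Pf hE).
exists F; split=> t t01; first exact: (calculus_disk Pb bS Pf hE t01 (hF t t01)).
have [D hD] := double_exists Pb bS hT hR hE t01.
exists D; first exact: (double_op sP Pb bS Pf hT hR hE t01 hD).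
exact: (derivative sP Pb bS hT hR hE t01 hF hD).
Qed.
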